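(* Let $A=(A(i,j),\,0\le i,j\le n-1)$ be an irreducible and aperiodic $0$-$1$ matrix. (i) Let $\mu$ be a nonatomic shift-invariant probability measure on $\Sigma_A$ which is invariant and ergodic under $S_A$. Then there exist an irreducible, aperiodic and $S_A$-invariant shift of finite type $\Sigma_{A'}\subset\Sigma_A$ and a function $\phi\colon\Sigma_{A'}\to\mathbb{R}$ depending only on the single coordinate $x_0$ of every point $x\in\Sigma_{A'}$ such that $\mu$ is the unique (Markov) Gibbs measure of $\phi$ on $\Sigma_{A'}$. (ii) Conversely, if $\Sigma_{A'}\subset\Sigma_A$ is an irreducible, aperiodic and $S_A$-invariant shift of finite type and $\phi\colon\Sigma_{A'}\to\mathbb{R}$ is a function of a single coordinate, then the (Markov) Gibbs measure $\mu_\phi$ is invariant and ergodic under $S_A$.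
   Context: $\Sigma_A=\{x=(x_k)\in\{0,\dots,n-1\}^{\mathbb{Z}}: A(x_k,x_{k+1})=1\ \forall k\in\mathbb{Z}\}$, with shift $\sigma(x)_k=x_{k+1}$. The Gibbs relation is $R_A=\{(x,x')\in\Sigma_A\times\Sigma_A: x_k\ne x'_k\text{ for only finitely many }k\}$. $S_A\subset R_A$ is the subrelation in which $x,x'\in\Sigma_A$ are equivalent iff $x'$ is obtained from $x$ by a permutation of finitely many coordinates; equivalently, $(x,x')\in R_A$ and $\sum_{k\in\mathbb{Z}}(e^{(x_k)}-e^{(x'_k)})=0$, where $e^{(0)},\dots,e^{(n-1)}$ are the unit vectors of $\mathbb{Z}^n$. For an equivalence relation $R$ with countable classes, the saturation of $B$ is $R(B)=\{x':(x,x')\in R\text{ for some }x\in B\}$. A probability measure $\mu$ is quasi-invariant under $R$ if $\mu(R(B))=0$ whenever $\mu(B)=0$; ergodic if it is quasi-invariant and for every Borel $B$ either $R(B)$ or its complement is $\mu$-null; invariant if it is preserved by every Borel automorphism $W$ of the space with $(x,Wx)\in R$ for all $x$. If $\mu$ is quasi-invariant, its Radon-Nikodym derivative is a Borel map $\rho_\mu\colon R\to(0,\infty)$ with $\rho_\mu(x,x')\rho_\mu(x',x'')=\rho_\mu(x,x'')$ and $\rho_\mu(Wx,x)=\frac{d\mu W}{d\mu}(x)$ $\mu$-a.e. for every such $W$. $\Sigma_{A'}\subset\Sigma_A$ denotes the shift of finite type defined by a $0$-$1$ matrix $A'=(A'(i,j),\,0\le i,j\le n-1)$ with $A'(i,j)\le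 A(i,j)$ for all $i,j$. $A'$ may have zero rows and columns; ''irreducible and aperiodic'' refers to $\Sigma_{A'}$ as a shift of finite type over the alphabet of those symbols whose rows and columns in $A'$ are nonzero, i.e. the restriction of $A'$ to these symbols is irreducible and aperiodic. ''$S_A$-invariant'' means $S_A(\Sigma_{A'})=\Sigma_{A'}$. A probability measure on $\Sigma_A$ giving full measure to $\Sigma_{A'}$ is also regarded as a probability measure on $\Sigma_{A'}$, and vice versa. A probability measure $\mu$ on $\Sigma_{A'}$ is a Gibbs measure of $\phi\colon\Sigma_{A'}\to\mathbb{R}$ (here $\phi$ depends on one coordinate only) if it is quasi-invariant under the Gibbs relation $R_{A'}$ of $\Sigma_{A'}$ (defined like $R_A$) and $\log\rho_\mu(x,x')=\sum_{k\in\mathbb{Z}}(\phi(\sigma^k x)-\phi(\sigma^k x'))$ for all $(x,x')\in R_{A'}$ outside $N\times N$ for some $\mu$-null set $N$. It is known that for irreducible aperiodic $\Sigma_{A'}$ there is exactly one Gibbs measure $\mu_\phi$ of such a $\phi$, and it is a Markov measure. *)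

(* Defs.v *)
From HB Require Import structures.
From mathcomp Require Import all_boot all_order all_algebra.
From mathcomp Require Import all_classical all_reals all_analysis.

Set Implicit Arguments.
Unset Strict Implicit.
Unset Printing Implicit Defensive.

Import Order.TTheory GRing.Theory Num.Theory.
Import numFieldNormedType.Exports.

Local Open Scope classical_set_scope.
Local Open Scope ring_scope.

(* Alphabets are nonempty, 'I_n.+1 = {0, .., n}, because a measurableType has
   to be pointed. *)

HB.instance Definition _ n := isPointed.Build 'I_n.+1 ord0.

Definition coordinate_sets (n : nat) : set (set (int -> 'I_n.+1)) :=
  [set B | exists (k : int) (a : 'I_n.+1), B = [set x | x k = a]].

(* Bi-infinite sequences with the product sigma-algebra. The index set is
   countable and the alphabet is finite and discrete, so this is the Borel
   sigma-algebra of the product topology. A shift of finite type is a subset D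
   of this space, and a measure on D is a measure mu with mu D = 1. *)
Definition fullshift (n : nat) := g_sigma_algebraType (@coordinate_sets n).

Section Matrices.
Local Open Scope nat_scope.

Definition zero_one n (A : 'M[nat]_n) := forall i j, A i j = 0 \/ A i j = 1.

Definition irreducible_mx n (A : 'M[nat]_n) :=
  forall i j, exists2 k, 0 < k & 0 < (A ^+ k)%R i j.

(* For every i, the gcd of { k > 0 | A^k(i,i) > 0 } is 1. *)
Definition aperiodic_mx n (A : 'M[nat]_n) :=
  forall i d,
    (forall k, 0 < k -> 0 < (A ^+ k)%R i i -> d %| k) -> d = 1.

Definition symbols n (A : 'M[nat]_n) : {set 'I_n} :=
  [set i | [exists j, A i j != 0] && [exists j, A j i != 0]]%SET.

Definition essential_mx n (A : 'M[nat]_n) : 'M[nat]_#|symbols A| :=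
  mxsub enum_val enum_val A.

Definition irreducible_aperiodic_sft n (A : 'M[nat]_n) :=
  irreducible_mx (essential_mx A) /\ aperiodic_mx (essential_mx A).

End Matrices.

Section Shifts.
Context {n : nat}.
Implicit Types (A : 'M[nat]_n.+1) (x : fullshift n).

Definition sft A : set (fullshift n) :=
  [set x | forall k : int, A (x k) (x (k + 1)) = 1%N].

(* The k-th power of the shift. *)
Definition shift_pow (k : int) (x : fullshift n) : fullshift n :=
  fun j => x (j + k).

Definition gibbs_rel A : set (fullshift n * fullshift n) :=
  [set p | [/\ sft A p.1, sft A p.2 &
               finite_set [set k : int | p.1 k <> p.2 k]]].

Definition sym_rel A : set (fullshift n * fullshift n) :=
  [set p | [/\ sft A p.1, sft A p.2 &
     exists s : int -> int,
       [/\ bijective s, finite_set [set k | s k <> k] &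
           forall k, p.2 k = p.1 (s k)]]].

End Shifts.

Definition saturation {T : Type} (E : set (T * T)) (B : set T) : set T :=
  [set y | exists2 x, B x & E (x, y)].

(* Countable Borel equivalence relations E on a Borel subset D of T. *)
Section Relations.
Context {d : measure_display} {T : measurableType d} {R : realType}.
Implicit Types (D : set T) (E : set (T * T)) (mu : probability T R).

Definition borel_automorphism D (W : T -> T) :=
  [/\ set_bij D D W, measurable_fun D W &
      forall B, measurable B -> B `<=` D -> measurable (W @` B)].

Definition in_full_group D E (W : T -> T) :=
  borel_automorphism D W /\ (forall x, D x -> E (x, W x)).

Definition rel_quasi_invariant E mu :=
  forall B, measurable B -> mu B = 0%E -> mu (saturation E B) = 0%E.

Definition rel_ergodic D E mu :=
  rel_quasi_invariant E mu /\
  forall B, measurable B -> B `<=` D ->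
    mu (saturation E B) = 0%E \/ mu (D `\` saturation E B) = 0%E.

Definition rel_invariant D E mu :=
  forall W, in_full_group D E W ->
  forall B, measurable B -> B `<=` D -> mu (W @` B) = mu B.

(* The last clause is rho (W x, x) = (d muW / d mu) x for mu-almost every x,
   where muW B = mu (W B). *)
Definition is_RN_derivative D E mu (rho : T * T -> R) :=
  [/\ measurable_fun E rho,
      forall p, E p -> 0 < rho p,
      forall x y z, E (x, y) -> E (y, z) -> rho (x, y) * rho (y, z) = rho (x, z)
    & forall W, in_full_group D E W ->
      forall B, measurable B -> B `<=` D ->
        mu (W @` B) = (\int[mu]_(x in B) (rho (W x, x))%:E)%E].

Definition nonatomic mu := forall x, mu [set x] = 0%E.

End Relations.

Section Gibbs.
Context {n : nat} {R : realType}.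
Implicit Types (A : 'M[nat]_n.+1) (mu : probability (fullshift n) R).

Definition shift_invariant mu :=
  forall B, measurable B -> mu (shift_pow 1 @^-1` B) = mu B.

Definition depends_only_on (D : set (fullshift n)) (k : int)
    (phi : fullshift n -> R) :=
  forall x y, D x -> D y -> x k = y k -> phi x = phi y.

(* When phi depends on a single coordinate, the sum over all integers has
   finitely many nonzero terms; the finitely supported \sum_(_ \in _) would
   be 0 otherwise. *)
Definition gibbs_measure A (phi : fullshift n -> R) mu :=
  [/\ mu (sft A) = 1%E, rel_quasi_invariant (gibbs_rel A) mu &
      exists2 rho, is_RN_derivative (sft A) (gibbs_rel A) mu rho &
      exists2 N, mu.-negligible N &
      forall x y, gibbs_rel A (x, y) -> ~ (N x /\ N y) ->
        ln (rho (x, y)) =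
        \sum_(k \in [set: int]) (phi (shift_pow k x) - phi (shift_pow k y))].

Definition markov_measure mu :=
  exists (p : 'rV[R]_n.+1) (P : 'M[R]_n.+1),
    [/\ (forall i, 0 <= p 0 i) /\ \sum_i p 0 i = 1,
        (forall i j, 0 <= P i j) /\ (forall i, \sum_j P i j = 1),
        p *m P = p &
        forall (k : int) (m : nat) (a : nat -> 'I_n.+1),
          mu [set x | forall i : nat, (i <= m)%N -> x (k + i%:Z) = a i] =
          (p 0 (a 0%N) * \prod_(i < m) P (a i) (a i.+1))%:E].

End Gibbs.

(* Main.v *)
(* Write pr(w) for the mu-measure of a cylinder with word w.

   The common tool is the exchange of two blocks of x with the same end letters:
   it is a finite permutation of coordinates, so an S_A-invariant measure does
   not see it. Suppose mu is moreover shift-invariant and trivial on the tail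
   events (those unchanged when finitely many coordinates are altered). The mean
   ergodic theorem says that a second block with the wanted letters occurs far
   away with asymptotic frequency equal to its probability and independently of
   what happens near the origin. Exchanging a given block for such a far one
   therefore gives mu(U D) mu(V) = mu(V D) mu(U) for blocks U, V between the same
   end letters.

   (i) S_A-ergodicity implies tail triviality. With D an event of the past, the
   exchange relation is the Markov property, and the support of mu is the shift
   of finite type of A'(i,j) = [pr(ij) > 0]; it is irreducible because distant
   cylinders meet, aperiodic by tail triviality, and S_A-saturated because finite
   permutations preserve mu. On loops at a fixed letter, log (pr(aw)/pr(a)) is
   additive and depends only on the letter counts of w, so it extends to a linear
   function of these counts. Its coefficients are the potential: they give
   pr(au) exp(sum of phi over v) = pr(av) exp(sum of phi over u) for words with
   the same length and ends, which is the Gibbs property.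

   (ii) This swap rule characterizes Gibbs measures. By irreducibility and
   aperiodicity, two finite measures obeying it have comparable cylinder
   measures, and subtracting from one a multiple of the other preserves the rule;
   iterating, they are proportional. So the Gibbs measure is unique, hence
   shift-invariant, and the same applied to mu(B /\ _) for a tail event B makes
   it tail trivial. Since the swap rule only involves letter counts, mu is
   S_A-invariant. Finally, for an S_A-saturated B, the exchange relation with
   D = B shows that mu(B /\ _) obeys the swap rule too, whence mu(B) is 0 or 1. *)
Require Import Defs.
From HB Require Import structures.
From mathcomp Require Import all_boot all_order all_algebra.
From mathcomp Require Import all_classical all_reals all_analysis.
From mathcomp Require Import measurable_realfun.
From mathcomp Require Import ring lra zify.

Set Implicit Arguments.
Unset Strict Implicit.
Unset Printing Implicit Defensive.

Import Order.TTheory GRing.Theory Num.Theory.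
Import numFieldNormedType.Exports.

Local Open Scope classical_set_scope.
Local Open Scope ring_scope.

(** * Consistent weights on the words of a mixing graph *)

(** Three obstacles shape the formal argument. A finite permutation of coordinates may lead out of
    [sft A], so it is not itself an element of the full group; invariance is therefore applied to
    involutions that exchange two disjoint sets and fix all other points. Uniqueness of the Gibbs
    measure is proved for functions of a position and a word rather than for measures: a multiple
    can then be subtracted without signed measures, and the comparison constant does not depend on
    the word length, because a mixing time on each side is enough to connect any two words to common
    ends. Finally, the ergodic theorem is only needed for indicators, with a zero-one law on tail
    events in place of ergodicity: averages are Cauchy in L2 by minimality of the norm, and almost
    sure convergence along a fast subsequence serves only to identify the limit. In (ii) the
    exchange relation presupposes shift-invariance, tail triviality and invariance under finite
    permutations, so all three must be derived from the swap rule before ergodicity. *)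

Section Words.
Variable T : finType.

Fixpoint words (r : nat) : seq (seq T) :=
  if r is r'.+1 then [seq rcons w b | w <- words r', b <- enum T]
  else [:: [::]].

Lemma mem_words r w : (w \in words r) = (size w == r).
Proof.
elim: r w => [|r IH] w /=; first by rewrite inE; case: w.
apply/allpairsP/idP => [[[u b] /= [ur _ ->]]|].
  by rewrite size_rcons eqSS -IH.
case/lastP: w => [//|u b]; rewrite size_rcons eqSS -IH => ur.
by exists (u, b); split => //=; rewrite mem_enum.
Qed.

Lemma uniq_words r : uniq (words r).
Proof.
elim: r => [//|r IH] /=; apply: allpairs_uniq => //; first exact: enum_uniq.
by move=> [u a] [v b] _ _ /= /rcons_inj[-> ->].
Qed.

Lemma big_words0 (M : nmodType) (F : seq T -> M) :
  \sum_(w <- words 0) F w = F [::].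
Proof. by rewrite /= big_seq1. Qed.

Lemma big_wordsS (M : nmodType) r (F : seq T -> M) :
  \sum_(w <- words r.+1) F w = \sum_(w <- words r) \sum_(b : T) F (rcons w b).
Proof.
rewrite /= big_allpairs_dep /=; apply: eq_bigr => w _.
by rewrite big_enum.
Qed.

Lemma sum_const_seq (I : Type) (M : nmodType) (s : seq I) (c : M) :
  \sum_(i <- s) c = c *+ size s.
Proof. by elim: s => [|i s IH]; rewrite ?big_nil // big_cons IH mulrS. Qed.

End Words.

Section Specification.
Variables (R : realType) (T : finType) (S : pred T) (e : rel T) (wt : T -> R).
Hypothesis wt_gt0 : forall i, 0 < wt i.
Hypothesis eS : forall i j, e i j -> S j.

Definition weight (w : seq T) : R := \prod_(i <- w) wt i.

(** What is kept of a finite measure on a subshift: [f k w] stands for the mass of the word [w] at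
    position [k], consistent under extension on either side. The weights in [spec_swap] omit the
    first letter [a], which both words share. *)
Record specification (f : int -> seq T -> R) : Prop := Specification {
  spec_ge0 : forall k w, 0 <= f k w;
  spec_right : forall k w, f k w = \sum_(b : T) f k (rcons w b);
  spec_left : forall k w, f k w = \sum_(b : T) f (k - 1) (b :: w);
  spec_supp : forall k a w, ~~ (S a && path e a w) -> f k (a :: w) = 0;
  spec_swap : forall k a u v, S a -> path e a u -> path e a v ->
    size u = size v -> last a u = last a v ->
    f k (a :: u) * weight v = f k (a :: v) * weight u }.

Definition mixing_time r :=
  forall i j, S i -> S j ->
    exists w, [/\ size w = r, path e i w & last i w = j].

Lemma weight_cat u v : weight (u ++ v) = weight u * weight v.
Proof. by rewrite /weight big_cat. Qed.

Lemma weight_gt0 w : 0 < weight w.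
Proof. by rewrite /weight; apply: prodr_gt0. Qed.

(** One bound for all letter weights and their inverses, so that powers of it control the weight of
    a word from above and below by its length alone. *)
Let om := 1 + \sum_i wt i + \sum_i (wt i)^-1.

Lemma wt_le_om i : wt i <= om /\ (wt i)^-1 <= om.
Proof.
have h1 : wt i <= \sum_i wt i.
  by rewrite (bigD1 i) //= lerDl sumr_ge0 // => j _; apply: ltW.
have h2 : (wt i)^-1 <= \sum_i (wt i)^-1.
  by rewrite (bigD1 i) //= lerDl sumr_ge0 // => j _; rewrite invr_ge0 ltW.
have := wt_gt0 i; have : 0 < (wt i)^-1 by rewrite invr_gt0.
by rewrite /om; split; lra.
Qed.

Lemma om_ge1 : 1 <= om.
Proof.
have h1 : 0 <= \sum_i wt i by rewrite sumr_ge0 // => j _; apply: ltW.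
have h2 : 0 <= \sum_i (wt i)^-1.
  by rewrite sumr_ge0 // => j _; rewrite invr_ge0 ltW.
by rewrite /om; lra.
Qed.

Lemma weight_le w : weight w <= om ^+ size w.
Proof.
rewrite /weight; elim: w => [|i w IH]; first by rewrite big_nil.
rewrite big_cons exprS; apply: ler_pM => //; first exact: ltW.
- exact: ltW (weight_gt0 _).
- by have [] := wt_le_om i.
Qed.

Lemma weight_ge w : 1 <= om ^+ size w * weight w.
Proof.
rewrite /weight; elim: w => [|i w IH]; first by rewrite big_nil mulr1.
rewrite big_cons /= exprS mulrACA -[leLHS]mulr1.
apply: ler_pM => //.
have [_] := wt_le_om i.
by rewrite -ler_pdivrMr // mul1r.
Qed.

Section Compare.
Variable r : nat.
Hypothesis r_gt0 : (0 < r)%N.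
Hypothesis mix : mixing_time r.

Lemma spec_ext_right f k u m : specification f ->
  f k u = \sum_(v <- words T m) f k (u ++ v).
Proof.
move=> sf; elim: m => [|m IH]; first by rewrite big_words0 cats0.
rewrite big_wordsS IH; apply: eq_bigr => w _.
by rewrite (spec_right sf); apply: eq_bigr => b _; rewrite rcons_cat.
Qed.

Lemma spec_ext_left f k u m : specification f ->
  f k u = \sum_(v <- words T m) f (k - m%:Z) (v ++ u).
Proof.
move=> sf; elim: m k u => [|m IH] k u.
  by rewrite big_words0 subr0.
rewrite big_wordsS exchange_big /= (spec_left sf); apply: eq_bigr => b _.
rewrite IH; apply: eq_bigr => w _.
by rewrite cat_rcons; congr f; clear; lia.
Qed.

Lemma spec_le_right f k u v : specification f -> f k (u ++ v) <= f k u.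
Proof.
move=> sf; rewrite (spec_ext_right k u (size v) sf).
rewrite (big_rem v) ?mem_words //= lerDl sumr_ge0 // => w _.
exact: (spec_ge0 sf).
Qed.

Lemma spec_le_left f k u v : specification f ->
  f (k - (size v)%:Z) (v ++ u) <= f k u.
Proof.
move=> sf; rewrite (spec_ext_left k u (size v) sf).
rewrite (big_rem v) ?mem_words //= lerDl sumr_ge0 // => w _.
exact: (spec_ge0 sf).
Qed.

(** The two extensions contribute [2 * r - 1] weighted letters each, since the outermost left letter
    is not weighted; the exponent is rounded up to [4 * r]. The square counts the pairs of a left
    and a right extension. *)
Let C := om ^+ (4 * r) * (size (words T r))%:R ^+ 2.

(* Both words are extended by [r] letters on each side; the extensions of the
   second word can be chosen to have the outer letters of those of the first,
   and then [spec_swap] compares the two. *)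
Lemma spec_compare f k a u a' u' : specification f -> size u = size u' ->
  S a -> path e a u -> S a' -> path e a' u' ->
  f k (a :: u) * weight (a' :: u') <= C * (f k (a' :: u') * weight (a :: u)).
Proof.
move=> sf suu' Sa pu Sa' pu'.
have C1 x y : size x = r -> size y = r ->
  f (k - r%:Z) (x ++ (a :: u) ++ y) * weight (a' :: u') <=
    om ^+ (4 * r) * (f k (a' :: u') * weight (a :: u)).
  case: x => [r0|c x]; first by move: r_gt0; rewrite -r0.
  move=> sx sy.
  have rhs0 : 0 <= om ^+ (4 * r) * (f k (a' :: u') * weight (a :: u)).
    apply: mulr_ge0; first by rewrite exprn_ge0 // (le_trans ler01 om_ge1).
    by rewrite mulr_ge0 ?(spec_ge0 sf) // ltW ?weight_gt0.
  have [/andP[Sc]|n] := boolP (S c && path e c (x ++ (a :: u) ++ y)); last first.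
    by rewrite /= (spec_supp sf) // mul0r.
  rewrite cat_path /= => /and3P[px ea]; rewrite cat_path => /andP[_ py].
  have Sl : S (last a u).
    case/lastP: (u) pu => [//|u1 l]; rewrite rcons_path last_rcons => /andP[_].
    exact: eS.
  have Sl' : S (last a' u').
    case/lastP: (u') pu' => [//|u1 l]; rewrite rcons_path last_rcons => /andP[_].
    exact: eS.
  have Sy : S (last (last a u) y).
    case/lastP: (y) py => [//|y1 l].
    by rewrite rcons_path last_rcons => /andP[_]; apply: eS.
  (* The path from [c] to [a'] ends in [a'] itself, which is the first letter of the second word;
     dropping it leaves the left extension [x']. *)
  have [x1 [sx1 px1 lx1]] := mix Sc Sa'.
  have [y' [sy' py' ly']] := mix Sl' Sy.
  case/lastP: x1 sx1 px1 lx1 => [r0|x' a1]; first by move: r_gt0; rewrite -r0.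
  rewrite size_rcons last_rcons => sx1 px1 ?; subst a1.
  have E := @spec_swap f sf (k - r%:Z) c (x ++ (a :: u) ++ y)
    (x' ++ (a' :: u') ++ y') Sc.
  have {}E := E _ _ _ _.
  have {}E : f (k - r%:Z) (c :: x ++ (a :: u) ++ y) *
     weight (x' ++ (a' :: u') ++ y') =
     f (k - r%:Z) (c :: x' ++ (a' :: u') ++ y') *
     weight (x ++ (a :: u) ++ y).
    apply: E.
    - by rewrite cat_path px /= ea cat_path pu.
    - move: px1; rewrite rcons_path => /andP[px' ea'].
      by rewrite cat_path px' /= ea' cat_path pu'.
    - by move: sx sx1 sy sy' suu'; rewrite !size_cat /= ?size_cat; clear; lia.
    - by rewrite !last_cat /= ?last_cat ly'.
  have le1 : f (k - r%:Z) (c :: x' ++ (a' :: u') ++ y') <= f k (a' :: u').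
    have h1 := @spec_le_left f k ((a' :: u') ++ y') (c :: x') sf.
    have h2 := @spec_le_right f k (a' :: u') y' sf.
    apply: le_trans h2; apply: le_trans h1.
    by rewrite /= sx1.
  have W0 w := weight_gt0 w.
  have sz1 : size (x ++ y) = (r.*2.-1)%N.
    by rewrite size_cat; move: sx sy => /=; clear; lia.
  have sz2 : size (x' ++ y') = (r.*2.-1)%N.
    by rewrite size_cat; move: sx1 sy'; clear; lia.
  have b1 := weight_le (x ++ y); have b2 := weight_ge (x' ++ y').
  rewrite sz1 in b1; rewrite sz2 in b2.
  move: E b1 b2; rewrite !weight_cat.
  set F := f _ (c :: x ++ _); set G := f _ (c :: x' ++ _) in le1 *.
  set o := om ^+ _ => E b1 b2.
  have F0 : 0 <= F by apply: (spec_ge0 sf).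
  have G0 : 0 <= G by apply: (spec_ge0 sf).
  have o1 : 1 <= om ^+ 2 by rewrite exprn_ege1 // om_ge1.
  have o0 : 0 <= o by rewrite exprn_ge0 // (le_trans ler01 om_ge1).
  have oE : om ^+ (4 * r) = o ^+ 2 * om ^+ 2.
    by rewrite -exprM -exprD; congr (_ ^+ _); move: r_gt0; clear; lia.
  have step : F * weight (a' :: u') <= o ^+ 2 * (f k (a' :: u') * weight (a :: u)).
    apply: (@le_trans _ _ (F * weight (a' :: u') * (o * (weight x' * weight y')))).
      by rewrite ler_peMr // mulr_ge0 // ltW.
    have -> : F * weight (a' :: u') * (o * (weight x' * weight y')) =
      o * (G * (weight x * (weight (a :: u) * weight y))).
      by rewrite -E; ring.
    have -> : o * (G * (weight x * (weight (a :: u) * weight y))) =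
      o * ((G * weight (a :: u)) * (weight x * weight y)) by ring.
    rewrite expr2 -[leRHS]mulrA; apply: ler_wpM2l => //.
    rewrite [leLHS]mulrC; apply: ler_pM => //.
    - by rewrite mulr_ge0 // ltW.
    - by rewrite mulr_ge0 // ltW.
    - by rewrite ler_wpM2r // ltW.
  have X0 : 0 <= o ^+ 2 * (f k (a' :: u') * weight (a :: u)).
    apply: mulr_ge0; first exact: exprn_ge0.
    apply: mulr_ge0; [exact: (spec_ge0 sf)|exact: ltW].
  apply: le_trans step _; rewrite oE [leRHS]mulrAC; exact: ler_peMr.
rewrite (spec_ext_left k (a :: u) r sf).
under eq_bigr do rewrite (spec_ext_right _ _ r sf).
rewrite mulr_suml.
set B := om ^+ (4 * r) * (f k (a' :: u') * weight (a :: u)).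
have CB : C * (f k (a' :: u') * weight (a :: u)) =
  \sum_(x <- words T r) \sum_(y <- words T r) B.
  under eq_bigr do rewrite sum_const_seq.
  rewrite sum_const_seq -[RHS]mulr_natl -[X in _ = _ * X]mulr_natl /C /B.
  by move: (om ^+ _) (_%:R) (_ * weight _) => o n z; ring.
rewrite CB big_seq [leRHS]big_seq; apply: ler_sum => x xr.
rewrite mulr_suml big_seq [leRHS]big_seq; apply: ler_sum => y yr.
move: xr yr; rewrite !mem_words -catA => /eqP xr /eqP yr; exact: C1.
Qed.

(** Multiplying [spec_compare] for [f] and for [g], with the roles of the two words exchanged,
    cancels the weights and gives [f w * g w' <= C ^+ 2 * (f w' * g w)]. Summing over all [w'] of
    the length of [w] produces the total masses. The summand 1 covers the empty word. *)
Lemma spec_comparable f g k w : specification f -> specification g ->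
  f k w * g k [::] <= (1 + C ^+ 2) * f k [::] * g k w.
Proof.
move=> sf sg.
have C0 : 0 <= C.
  by rewrite mulr_ge0 // exprn_ge0 // ?(le_trans ler01 om_ge1) // ler0n.
have fg0 k' w' : 0 <= f k' w' /\ 0 <= g k' w'.
  by split; [apply: (spec_ge0 sf)|apply: (spec_ge0 sg)].
case: w => [|a u].
  have := mulr_ge0 (fg0 k [::]).1 (fg0 k [::]).2.
  have := exprn_ge0 2 C0; nra.
have rhs0 x : 0 <= (1 + C ^+ 2) * f k x * g k (a :: u).
  rewrite mulr_ge0 ?(fg0 _ _).2 // mulr_ge0 ?(fg0 _ _).1 //.
  by rewrite addr_ge0 // exprn_ge0.
have [/andP[Sa pu]|n] := boolP (S a && path e a u); last first.
  by rewrite (spec_supp sf) // mul0r.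
rewrite (spec_ext_right k [::] (size u).+1 sf).
rewrite (spec_ext_right k [::] (size u).+1 sg).
rewrite mulr_sumr [X in _ <= X * _]mulr_sumr mulr_suml.
rewrite big_seq [leRHS]big_seq; apply: ler_sum => -[|a' u'].
  by rewrite mem_words.
rewrite mem_words => /eqP [suu].
have [/andP[Sa' pu']|n] := boolP (S a' && path e a' u'); last first.
  by rewrite (spec_supp sg _ n) mulr0.
have h1 := spec_compare k sf (esym suu) Sa pu Sa' pu'.
have h2 := spec_compare k sg suu Sa' pu' Sa pu.
have W := weight_gt0 (a :: u); have W' := weight_gt0 (a' :: u').
have [F0 G0] := fg0 k (a :: u); have [F0' G0'] := fg0 k (a' :: u').
have h := ler_pM (mulr_ge0 F0 (ltW W')) (mulr_ge0 G0' (ltW W)) h1 h2.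
have {}h : f k (a :: u) * g k (a' :: u') <= C ^+ 2 * (f k (a' :: u') * g k (a :: u)).
  rewrite -(ler_pM2r (mulr_gt0 W W')).
  move: h; set x := f k (a :: u); set y := g k (a' :: u').
  set x' := f k (a' :: u'); set y' := g k (a :: u).
  set V := weight (a :: u); set V' := weight (a' :: u') => h.
  have -> : x * y * (V * V') = x * V' * (y * V) by ring.
  have -> : C ^+ 2 * (x' * y') * (V * V') = C * (x' * V) * (C * (y' * V')) by ring.
  exact: h.
apply: le_trans h _; have := mulr_ge0 F0' G0; nra.
Qed.

Lemma specB f g t : specification f -> specification g ->
  (forall k w, t * g k w <= f k w) ->
  specification (fun k w => f k w - t * g k w).
Proof.
move=> sf sg le; split.
- by move=> k w; rewrite subr_ge0.
- move=> k w; rewrite sumrB -mulr_sumr.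
  by rewrite -(spec_right sf) -(spec_right sg).
- move=> k w; rewrite sumrB -mulr_sumr.
  by rewrite -(spec_left sf) -(spec_left sg).
- move=> k a w n; rewrite (spec_supp sf) // (spec_supp sg) //.
  by rewrite mulr0 subr0.
- move=> k a u v Sa pu pv su lu.
  have h1 := spec_swap sf k Sa pu pv su lu.
  have h2 := spec_swap sg k Sa pu pv su lu.
  by rewrite !mulrBl h1 -!mulrA h2.
Qed.

(** If [t * g <= f], then [f - t * g] is again a specification, of mass [(1 - t)] times that of [g],
    so it dominates [(1 - t) / K * g]. Each round thus multiplies the deficit [1 - t] by
    [q = 1 - K^-1], and [t] tends to 1. *)
Lemma spec_dominates f g : specification f -> specification g ->
  (forall k, f k [::] = g k [::]) -> forall k w, g k w <= f k w.
Proof.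
move=> sf sg mass.
pose K := 1 + C ^+ 2; pose q := 1 - K^-1.
have C0 : 0 <= C.
  by rewrite mulr_ge0 // exprn_ge0 // ?(le_trans ler01 om_ge1) // ler0n.
have K1 : 1 <= K by rewrite lerDl exprn_ge0.
have K0 : 0 < K by apply: lt_le_trans K1.
have q0 : 0 <= q by rewrite subr_ge0 invf_le1.
have q1 : q < 1 by rewrite gtrBl invr_gt0.
have fg0 k' w' : 0 <= f k' w' /\ 0 <= g k' w'.
  by split; [apply: (spec_ge0 sf)|apply: (spec_ge0 sg)].
have step m k w : (1 - q ^+ m) * g k w <= f k w.
  elim: m k w => [|m IH] k w; first by rewrite subrr mul0r (fg0 _ _).1.
  have [m0|m0] := eqVneq (g k [::]) 0.
    have gz : g k w = 0.
      apply/eqP; rewrite eq_le (fg0 _ _).2 andbT -m0.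
      exact: (spec_le_right k [::] w sg).
    by rewrite gz mulr0 (fg0 _ _).1.
  have mp : 0 < g k [::] by rewrite lt_def m0 (fg0 _ _).2.
  have := spec_comparable k w sg (specB sf sg IH).
  rewrite mass -/K; set t := q ^+ m.
  have -> : g k [::] - (1 - t) * g k [::] = t * g k [::] by ring.
  have -> : K * g k [::] * (f k w - (1 - t) * g k w) =
    (K * (f k w - (1 - t) * g k w)) * g k [::] by ring.
  rewrite mulrA ler_pM2r // -ler_pdivrMl // exprS -/t.
  by rewrite /q => h; lra.
move=> k w; rewrite -subr_ge0.
have qm : (fun m => f k w - (1 - q ^+ m) * g k w) @ \oo --> f k w - g k w.
  rewrite -[X in _ --> _ - X]mul1r; apply: cvgB; first exact: cvg_cst.
  apply: cvgMl; rewrite -[X in _ --> X]subr0; apply: cvgB; first exact: cvg_cst.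
  by apply: cvg_expr; rewrite ger0_norm.
rewrite -(cvg_lim _ qm) //; apply: limr_ge; first by apply/cvg_ex; eexists; exact: qm.
by near=> m; rewrite subr_ge0.
Unshelve. all: by end_near. Qed.

Theorem spec_unique f g : specification f -> specification g ->
  (forall k, f k [::] = g k [::]) -> forall k w, f k w = g k w.
Proof.
move=> sf sg mass k w; apply/eqP; rewrite eq_le.
by rewrite !spec_dominates.
Qed.

End Compare.
End Specification.

(** * Additive functions, semigroups and transition matrices *)

(** [H] is the graph of an additive map on a subgroup of Z^m, and the third hypothesis says that it
    is single-valued. It extends to all of Z^m because one can divide in [R]; the induction
    eliminates the last coordinate. *)
Lemma additive_extension (R : numFieldType) (m : nat)
    (H : (nat -> int) -> R -> Prop) :
  H (fun=> 0) 0 ->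
  (forall c t c' t', H c t -> H c' t' -> H (fun i => c i - c' i) (t - t')) ->
  (forall c t, H c t -> (forall i, (i < m)%N -> c i = 0) -> t = 0) ->
  exists phi : nat -> R,
    forall c t, H c t -> \sum_(i < m) phi i * (c i)%:~R = t.
Proof.
elim: m H => [|m IH] H H0 HB Hz.
  by exists (fun=> 0) => c t Hct; rewrite big_ord0 (Hz c t Hct).
have HN c t : H c t -> H (fun i => - c i) (- t).
  move=> /(HB _ _ _ _ H0); rewrite sub0r.
  by congr (H _ _); apply/funext => i; rewrite sub0r.
have HD c t c' t' : H c t -> H c' t' -> H (fun i => c i + c' i) (t + t').
  move=> h /HN /(HB _ _ _ _ h); rewrite opprK.
  by congr (H _ _); apply/funext => i; rewrite opprK.
have HZ (z : int) c t : H c t -> H (fun i => z * c i) (z%:~R * t).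
  have Hn (k : nat) : H c t -> H (fun i => k%:Z * c i) (k%:R * t).
    elim: k => [|k IHk] h.
      by move: H0; rewrite mul0r; congr (H _ _); apply/funext => i; rewrite mul0r.
    move: (HD _ _ _ _ (IHk h) h); rewrite -natr1 mulrDl mul1r.
    congr (H _ _); apply/funext => i.
    by rewrite -[k.+1]addn1 PoszD mulrDl mul1r.
  case: z => k h; first exact: Hn.
  move: (HN _ _ (Hn k.+1 h)); rewrite NegzE mulrNz mulNr.
  by congr (H _ _); apply/funext => i; rewrite mulNr.
have [[cs [ts [Hs cm]]]|no] := pselect (exists c t, H c t /\ c m != 0).
  have [//||c t [czm Hct] cz|phi hphi] := IH (fun c t => c m = 0 /\ H c t).
  - by move=> c t c' t' [cz h] [cz' h']; split; [rewrite cz cz'|exact: HB].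
  - apply: Hz Hct _ => i; rewrite ltnS leq_eqVlt => /orP[/eqP -> //|]; exact: cz.
  (* The only coefficient that gives the right value at the chosen element [cs]. *)
  pose v := (ts - \sum_(i < m) phi i * (cs i)%:~R) / (cs m)%:~R.
  exists (fun i => if i == m then v else phi i) => c t Hct.
  have cm0 : (cs m)%:~R != 0 :> R by rewrite intr_eq0.
  (* Cross-multiplication with [cs] moves an arbitrary [c] into the subgroup with vanishing
     coordinate [m]. *)
  have /hphi : (cs m * c m - c m * cs m = 0 /\
     H (fun i => cs m * c i - c m * cs i) ((cs m)%:~R * t - (c m)%:~R * ts)).
    by split; [rewrite mulrC subrr|apply: HB; apply: HZ].
  rewrite big_ord_recr /= eqxx.
  under eq_bigr do rewrite rmorphB !rmorphM /= mulrBr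
    (mulrCA (phi _)) (mulrCA (phi _) (c m)%:~R).
  rewrite sumrB -!mulr_sumr.
  have -> : \sum_(i < m) (if i == m :> nat then v else phi i) * (c i)%:~R =
    \sum_(i < m) phi i * (c i)%:~R.
    by apply: eq_bigr => i _; rewrite ltn_eqF.
  rewrite /v; set s := \sum_(i < m) phi i * (c i)%:~R.
  set s' := \sum_(i < m) phi i * (cs i)%:~R => E.
  apply: (mulfI cm0); rewrite -[_ * t](subrK ((c m)%:~R * ts)) -E.
  by field.
have cz c t : H c t -> c m = 0.
  by move=> h; apply/eqP/negPn/negP => h'; apply: no; exists c, t.
have [//|//|c t Hct c0|phi hphi] := IH H.
  apply: Hz (Hct) _ => i; rewrite ltnS leq_eqVlt => /orP[/eqP ->|]; last exact: c0.
  exact: cz Hct.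
exists phi => c t Hct.
by rewrite big_ord_recr /= (cz c t Hct) mulr0 addr0; exact: hphi.
Qed.

(** Let [d] be the least positive difference of two elements [l] and [l + d]. A remainder modulo [d]
    of an element of [K] would be a smaller difference, so [d] divides all of [K] and is 1. Then [l]
    and [l + 1] generate every number from [l * l] on. *)
Lemma eventually_in_semigroup (K : nat -> Prop) : K 0%N ->
  (forall k l, K k -> K l -> K (k + l)%N) ->
  (forall d, (forall k, (0 < k)%N -> K k -> (d %| k)%N) -> d = 1%N) ->
  exists N, forall k, (N <= k)%N -> K k.
Proof.
move=> K0 KD Kgcd.
have KM q k : K k -> K (q * k)%N.
  by move=> h; elim: q => [|q IH]; rewrite ?mul0n // mulSn; apply: KD.
pose D d := `[< (0 < d)%N /\ exists l, K l /\ K (l + d)%N >].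
have exD : exists d, D d.
  apply: contrapT => no; have := Kgcd 2%N.
  apply/not_implyP; split => // k k0 Kk; case: no; exists k; apply/asboolP.
  by split => //; exists 0%N.
have [d /asboolP[d0 [l [Kl Kld]]] dmin] := ex_minnP exD.
have d1 : d = 1%N.
  apply: Kgcd => k _ Kk; apply/negPn/negP => nd.
  have r0 : (0 < k %% d)%N by rewrite lt0n.
  have : (d <= k %% d)%N.
    apply: dmin; apply/asboolP; split => //.
    exists ((k %/ d) * (l + d))%N; split; first exact: KM.
    have -> : ((k %/ d) * (l + d) + k %% d = k + (k %/ d) * l)%N.
      by rewrite {3}(divn_eq k d); lia.
    by apply: KD => //; apply: KM.
  by rewrite leqNgt ltn_mod d0.
move: Kld; rewrite d1 addn1 => Kl1.
exists (l * l)%N => k lk.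
have [l0|l0] := posnP l.
  by rewrite -[k]muln1; apply: KM; rewrite -l0 in Kl1 *; move: Kl1; rewrite l0.
(* The subtraction does not truncate: [k %/ l] is at least [l], which exceeds the remainder. *)
have -> : k = ((k %/ l - k %% l) * l + (k %% l) * l.+1)%N.
  have h1 := divn_eq k l.
  rewrite {1}h1 mulnBl mulnS; nia.
by apply: KD; apply: KM.
Qed.

(** * Paths of prescribed length and mixing times *)

Section Reach.
Variables (T : finType) (S : pred T) (e : rel T).

Definition reach k i j := exists w, [/\ size w = k, path e i w & last i w = j].

Lemma reachD k l i j h : reach k i j -> reach l j h -> reach (k + l) i h.
Proof.
move=> [u [su pu lu]] [v [sv pv lv]]; exists (u ++ v).
by rewrite size_cat su sv cat_path pu lu last_cat lu.
Qed.

Lemma exists_mixing_time :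
  (forall i j, S i -> S j -> exists2 k, (0 < k)%N & reach k i j) ->
  (forall i d, S i -> (forall k, (0 < k)%N -> reach k i i -> (d %| k)%N) ->
     d = 1%N) ->
  exists2 r, (0 < r)%N & mixing_time S e r.
Proof.
move=> irr aper.
have loops i : S i -> exists N, forall k, (N <= k)%N -> reach k i i.
  move=> Si; apply: eventually_in_semigroup; first by exists [::].
  - by move=> k l; apply: reachD.
  - by move=> d; apply: aper.
have ev (p : T * T) : exists N, S p.1 -> S p.2 ->
    forall k, (N <= k)%N -> reach k p.1 p.2.
  case: p => i j /=; have [Si|nSi] := boolP (S i); last by exists 0%N.
  have [Sj|nSj] := boolP (S j); last by exists 0%N.
  have [N hN] := loops i Si; have [l _ rl] := irr i j Si Sj.
  exists (N + l)%N => _ _ k Nk; rewrite -(@subnK l k); last by lia.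
  by apply: reachD rl; apply: hN; lia.
have [N hN] := choice ev.
(* A sum over the finitely many pairs bounds each of their thresholds. *)
exists (\sum_p N p).+1%N => // i j Si Sj.
apply: (hN (i, j) Si Sj); apply: leqW.
by rewrite (bigD1 (i, j)) //= leq_addr.
Qed.

End Reach.

Section Essential.
Variables (n : nat) (A : 'M[nat]_n).

(** Both ends must lie in [symbols A], so that paths match the powers of [essential_mx A] and not
    those of [A]. *)
Definition allowed : rel 'I_n :=
  fun i j => [&& A i j != 0%N, i \in symbols A & j \in symbols A].

Lemma essential_exp_gt0 k i j :
  (0 < (essential_mx A ^+ k)%R i j)%N <->
  reach allowed k (enum_val i) (enum_val j).
Proof.
elim: k i => [|k IH] i.
  rewrite expr0 mxE; split => [|[w [/size0nil -> _ /= /enum_val_inj ->]]].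
    by case: eqP => // -> _; exists [::].
  by rewrite eqxx.
rewrite exprS mxE lt0n; split.
  rewrite sum_nat_eq0 negb_forall => /existsP[/= h].
  rewrite /= muln_eq0 negb_or mxE => /andP[Ah]; rewrite -lt0n.
  move=> /IH[w [sw pw lw]]; exists (enum_val h :: w) => /=.
  by rewrite sw pw lw /allowed Ah !enum_valP.
case=> -[|h w] [] // [sw] /= /andP[ih pw] lw.
have /and3P[Aih Si Sh] := ih.
rewrite sum_nat_eq0 negb_forall; apply/existsP.
exists (enum_rank_in Sh h); rewrite /= muln_eq0 negb_or mxE.
rewrite enum_rankK_in // Aih -lt0n; apply/IH.
by exists w; rewrite enum_rankK_in.
Qed.

Lemma irreducible_aperiodic_sftP :
  irreducible_aperiodic_sft A <->
  (forall i j, i \in symbols A -> j \in symbols A ->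
     exists2 k, (0 < k)%N & reach allowed k i j) /\
  (forall i d, i \in symbols A ->
     (forall k, (0 < k)%N -> reach allowed k i i -> (d %| k)%N) -> d = 1%N).
Proof.
split=> -[irr aper]; split.
- move=> i j Si Sj.
  have [k k0 /essential_exp_gt0] := irr (enum_rank_in Si i) (enum_rank_in Sj j).
  by rewrite !enum_rankK_in // => h; exists k.
- move=> i d Si h; apply: (aper (enum_rank_in Si i)) => k k0 /essential_exp_gt0.
  by rewrite enum_rankK_in //; apply: h.
- move=> i j; have [k k0 h] := irr _ _ (enum_valP i) (enum_valP j).
  by exists k => //; apply/essential_exp_gt0.
- move=> i d h; apply: (aper _ _ (enum_valP i)) => k k0 r.
  by apply: h => //; apply/essential_exp_gt0.
Qed.

End Essential.

(** * The mean ergodic theorem *)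

Section CesaroSums.
Variable R : realFieldType.
Implicit Types a : nat -> R.

(** The variance of [a 0, ..., a (M - 1)] is nonnegative. *)
Lemma sqr_mean_le a M :
  (M%:R^-1 * \sum_(j < M) a j) ^+ 2 <= M%:R^-1 * \sum_(j < M) a j ^+ 2.
Proof.
case: M => [|M]; first by rewrite !big_ord0 !mulr0 expr0n.
set m := _ * \sum_(j < _) a j.
have E : \sum_(j < M.+1) (a j - m) ^+ 2 =
  \sum_(j < M.+1) a j ^+ 2 - M.+1%:R * m ^+ 2.
  under eq_bigr do rewrite sqrrB.
  rewrite big_split sumrB /= sumr_const card_ord.
  have -> : \sum_(i < M.+1) a i * m *+ 2 = M.+1%:R * m * m *+ 2.
    rewrite sumrMnl -mulr_suml; congr (_ * _ *+ 2).
    by rewrite /m mulrA divff ?mul1r // gt_eqF.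
  by rewrite -[m ^+ 2 *+ _]mulr_natl; ring.
have : 0 <= \sum_(j < M.+1) (a j - m) ^+ 2 by apply: sumr_ge0 => j _; exact: sqr_ge0.
by rewrite E subr_ge0 mulrC -ler_pdivlMr // mulrC.
Qed.

Lemma sum_shift_close a i M : (forall k, 0 <= a k <= 1) ->
  `|\sum_(j < M) a (i + j)%N - \sum_(j < M) a j| <= i%:R.
Proof.
move=> a01; elim: i => [|i IH]; first by rewrite subrr normr0.
have E : \sum_(j < M) a (i.+1 + j)%N =
  \sum_(j < M) a (i + j)%N + (a (i + M)%N - a i).
  have h1 : \sum_(j < M.+1) a (i + j)%N = \sum_(j < M) a (i + j)%N + a (i + M)%N.
    by rewrite big_ord_recr.
  have h2 : \sum_(j < M.+1) a (i + j)%N = a i + \sum_(j < M) a (i.+1 + j)%N.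
    rewrite big_ord_recl addn0; congr (_ + _); apply: eq_bigr => j _.
    by rewrite /= /bump /= addnA addn1.
  by move: h1; rewrite h2 => h1; lra.
rewrite E -natr1 addrAC; apply: le_trans (ler_normD _ _) _; apply: lerD => //.
have := a01 (i + M)%N; have := a01 i; rewrite ler_norml; lra.
Qed.

End CesaroSums.

(** * Expectations of bounded measurable functions *)

Section BoundedIntegral.
Context d (T : measurableType d) (R : realType) (mu : probability T R).
Implicit Types f g : T -> R.

Definition bounded_mfun f :=
  measurable_fun setT f /\ exists M, forall x, `|f x| <= M.

Lemma bmf_integrable f : bounded_mfun f -> mu.-integrable setT (EFin \o f).
Proof.
move=> [mf [M hM]]; apply: measurable_bounded_integrable => //.
  by rewrite [X in (X < _)%E]probability_setT ltry.
exists M; split; first exact: num_real.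
by move=> y My x _; apply: le_trans (hM x) (ltW My).
Qed.

Lemma bmf_cst (c : R) : bounded_mfun (fun=> c).
Proof. by split; [exact: measurable_cst|exists `|c|]. Qed.

Lemma bmfD f g : bounded_mfun f -> bounded_mfun g ->
  bounded_mfun (fun x => f x + g x).
Proof.
move=> [mf [M hM]] [mg [N hN]]; split; first exact: measurable_funD.
by exists (M + N) => x; apply: le_trans (ler_normD _ _) _; exact: lerD.
Qed.

Lemma bmfM f g : bounded_mfun f -> bounded_mfun g ->
  bounded_mfun (fun x => f x * g x).
Proof.
move=> [mf [M hM]] [mg [N hN]]; split; first exact: measurable_funM.
by exists (M * N) => x; rewrite normrM; exact: ler_pM.
Qed.

Lemma bmfZ (c : R) f : bounded_mfun f -> bounded_mfun (fun x => c * f x).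
Proof. by move=> bf; apply: bmfM => //; exact: bmf_cst. Qed.

Lemma bmfN f : bounded_mfun f -> bounded_mfun (fun x => - f x).
Proof.
move=> /(bmfZ (-1)); congr bounded_mfun; apply/funext => x.
by rewrite mulN1r.
Qed.

Lemma bmfB f g : bounded_mfun f -> bounded_mfun g ->
  bounded_mfun (fun x => f x - g x).
Proof. by move=> bf bg; apply: bmfD => //; exact: bmfN. Qed.

Lemma bmfX f : bounded_mfun f -> bounded_mfun (fun x => f x ^+ 2).
Proof. by move=> bf; under eq_fun do rewrite expr2; exact: bmfM. Qed.

Lemma bmf_norm f : bounded_mfun f -> bounded_mfun (fun x => `|f x|).
Proof.
move=> [mf [M hM]]; split; first exact: measurableT_comp.
by exists M => x; rewrite normr_id.
Qed.

Lemma bmf_sum (s : nat) (F : nat -> T -> R) : (forall i, bounded_mfun (F i)) ->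
  bounded_mfun (fun x => \sum_(i < s) F i x).
Proof.
move=> bF; elim: s => [|s IH].
  by under eq_fun do rewrite big_ord0; exact: bmf_cst.
by under eq_fun do rewrite big_ord_recr; exact: bmfD.
Qed.

Lemma bmf_indic (B : set T) : measurable B -> bounded_mfun (\1_B).
Proof.
move=> mB; split; first exact: measurable_indic.
by exists 1 => x; rewrite indicE; case: (_ \in _); rewrite ?normr1 ?normr0.
Qed.

Lemma bmf_comp (h : T -> T) f : measurable_fun setT h -> bounded_mfun f ->
  bounded_mfun (f \o h).
Proof.
by move=> mh [mf [M hM]]; split; [exact: measurableT_comp|exists M => x; exact: hM].
Qed.

Definition mean f : R := \int[mu]_x f x.

Lemma meanD f g : bounded_mfun f -> bounded_mfun g ->
  mean (fun x => f x + g x) = mean f + mean g.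
Proof. by move=> bf bg; apply: RintegralD => //; exact: bmf_integrable. Qed.

Lemma meanB f g : bounded_mfun f -> bounded_mfun g ->
  mean (fun x => f x - g x) = mean f - mean g.
Proof. by move=> bf bg; apply: RintegralB => //; exact: bmf_integrable. Qed.

Lemma meanZ c f : bounded_mfun f -> mean (fun x => c * f x) = c * mean f.
Proof. by move=> bf; apply: RintegralZl => //; exact: bmf_integrable. Qed.

Lemma mean_cst c : mean (fun=> c) = c.
Proof. by rewrite /mean Rintegral_cst // [X in fine X]probability_setT mulr1. Qed.

Lemma le_mean f g : bounded_mfun f -> bounded_mfun g ->
  (forall x, f x <= g x) -> mean f <= mean g.
Proof. by move=> bf bg fg; apply: le_Rintegral => //; exact: bmf_integrable. Qed.

Lemma mean_sum (s : nat) (F : nat -> T -> R) : (forall i, bounded_mfun (F i)) ->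
  mean (fun x => \sum_(i < s) F i x) = \sum_(i < s) mean (F i).
Proof.
move=> bF; elim: s => [|s IH].
  by rewrite big_ord0 -[RHS]mean_cst; congr mean; apply/funext=> x; rewrite big_ord0.
rewrite big_ord_recr /= -IH -meanD //; last exact: bmf_sum.
by congr mean; apply/funext=> x; rewrite big_ord_recr.
Qed.

Lemma mean_indic (B : set T) : measurable B -> mean (\1_B) = fine (mu B).
Proof. by move=> mB; rewrite /mean /Rintegral integral_indic // setIT. Qed.

Lemma mean_preserved (h : T -> T) f : measurable_fun setT h ->
  (forall B, measurable B -> mu (h @^-1` B) = mu B) -> bounded_mfun f ->
  mean (f \o h) = mean f.
Proof.
move=> mh muh bf; rewrite /mean /Rintegral; congr fine.
have := @integral_pushforward _ _ _ _ R h mh mu setT (EFin \o f).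
move=> <- //; last 2 first.
- by apply/measurable_EFinP; case: bf.
- by rewrite preimage_setT; apply: (@bmf_integrable (f \o h)); exact: bmf_comp.
by apply: eq_measure_integral => A mA _; exact: muh.
Qed.

Lemma mean_cvg (F : nat -> T -> R) (l : R) :
  (forall k, bounded_mfun (F k)) -> (exists M, forall k x, `|F k x| <= M) ->
  {ae mu, forall x, F ^~ x @ \oo --> l} -> mean (F k) @[k --> \oo] --> l.
Proof.
move=> bF [M hM] cF.
have [] := @dominated_convergence _ T R mu setT measurableT
  (fun k => EFin \o F k) (cst l%:E) (cst M%:E).
- by move=> k; apply/measurable_EFinP; case: (bF k).
- exact: measurable_cst.
- by apply: filterS cF => x /= h _; apply: cvg_EFin => //; exact: nearW.
- by apply: (@bmf_integrable (cst M)); exact: bmf_cst.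
- by apply: aeW => x k _; rewrite /= lee_fin.
move=> _ _; rewrite integral_cst // [X in (_ * X)%E]probability_setT mule1 => h.
exact: fine_cvg h.
Qed.

End BoundedIntegral.

(** * Orbit averages of an indicator under a zero-one law *)

Section MeanErgodic.
Context d (T : measurableType d) (R : realType) (mu : probability T R).
Variables (th : T -> T) (V : set T) (eqv : T -> T -> Prop).
Hypothesis mth : measurable_fun setT th.
Hypothesis inv_th : forall B, measurable B -> mu (th @^-1` B) = mu B.
Hypothesis mV : measurable V.
Hypothesis eqvV : forall x y, eqv x y ->
  exists J, forall j, (J <= j)%N -> V (iter j th x) <-> V (iter j th y).
Hypothesis zero_one_law : forall B, measurable B ->
  (forall x y, eqv x y -> B x <-> B y) -> mu B = 0%E \/ mu B = 1%E.

Local Notation mean := (mean mu).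
Let bmf := @bounded_mfun d T R.

Definition avg (g : T -> R) (N : nat) (x : T) : R :=
  N%:R^-1 * \sum_(j < N) g (iter j th x).

Let f : T -> R := \1_V.
Let a N := avg f N.
Let s N := mean (fun x => a N x ^+ 2).

Lemma iter_measurable j : measurable_fun setT (iter j th).
Proof.
elim: j => [|j IH] /=; first exact: measurable_id.
by apply: (measurableT_comp mth IH).
Qed.

Lemma iter_preserves j B : measurable B -> mu (iter j th @^-1` B) = mu B.
Proof.
move=> mB; elim: j => [//|j IH].
have -> : iter j.+1 th @^-1` B = th @^-1` (iter j th @^-1` B).
  by apply/seteqP; split=> x; rewrite /preimage /= -iterSr.
rewrite inv_th // -[X in measurable X]setTI; exact: iter_measurable.
Qed.

Lemma bmf_avg g N : bmf g -> bmf (avg g N).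
Proof.
move=> bg; apply: bmfZ; apply: (bmf_sum N (F := fun j x => g (iter j th x))).
by move=> j; apply: (@bmf_comp _ _ _ (iter j th)) => //; exact: iter_measurable.
Qed.

Lemma mean_avg g N : bmf g -> (0 < N)%N -> mean (avg g N) = mean g.
Proof.
move=> bg N0; have bgj j : bmf (fun x => g (iter j th x)).
  by apply: (@bmf_comp _ _ _ (iter j th)) => //; exact: iter_measurable.
rewrite /avg meanZ; last exact: (bmf_sum N (F := fun j x => g (iter j th x))).
rewrite (mean_sum mu N (F := fun j x => g (iter j th x))) //.
under eq_bigr => j _ do rewrite (mean_preserved (iter_measurable j)
   (fun B mB => iter_preserves j mB) bg).
by rewrite sumr_const card_ord -[X in _ * X]mulr_natl mulrA mulVf ?mul1r // pnatr_eq0 -lt0n.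
Qed.

Let bf : bmf f. Proof. exact: bmf_indic. Qed.

Let ba N : bmf (a N). Proof. exact: bmf_avg. Qed.

Lemma f01 x : 0 <= f x <= 1.
Proof. by rewrite /f indicE; case: (_ \in _); rewrite ?lexx ?ler01. Qed.

Lemma avg01 g N x : (forall x, 0 <= g x <= 1) -> 0 <= avg g N x <= 1.
Proof.
move=> g01; case: N => [|N]; first by rewrite /avg big_ord0 mulr0 lexx ler01.
rewrite /avg mulr_ge0 ?invr_ge0 ?ler0n //=; last first.
  by apply: sumr_ge0 => j _; have /andP[] := g01 (iter j th x).
rewrite ler_pdivrMl ?ltr0n // mulr1.
have -> : N.+1%:R = \sum_(j < N.+1) (1 : R) by rewrite sumr_const card_ord.
by apply: ler_sum => j _; have /andP[] := g01 (iter j th x).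
Qed.

(* The orbit averages of [g] and of [f] agree up to [K / M]: this holds for
   the averages of [f] themselves and is stable under convex combinations. *)
Let close (g : T -> R) (K : R) := [/\ bmf g, forall x, 0 <= g x <= 1, 0 <= K &
  forall M x, (0 < M)%N -> `|avg g M x - a M x| <= K / M%:R].

(** The [M]-average of the [N]-average is the mean over [i < N] of the averages over the windows
    from [i] to [i + M], and moving a window by [i] changes its sum by at most [i]. *)
Lemma close_avg N : (0 < N)%N -> close (a N) N%:R.
Proof.
move=> N0; split => //.
  by move=> x; apply: avg01; exact: f01.
move=> M x M0; have NR : N%:R != 0 :> R by rewrite pnatr_eq0 -lt0n.
pose b k := f (iter k th x).
have b01 k : 0 <= b k <= 1 by exact: f01.
have -> : avg (a N) M x - a M x =
  (N%:R^-1 / M%:R) * \sum_(i < N) (\sum_(j < M) b (i + j)%N - \sum_(j < M) b j).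
  rewrite sumrB sumr_const card_ord exchange_big /= mulrBr; congr (_ - _).
    rewrite /avg /a /avg -mulr_sumr mulrCA mulrA; congr (_ * _).
    by apply: eq_bigr => j _; apply: eq_bigr => i _; rewrite /b iterD.
  have -> : a M x = M%:R^-1 * \sum_(j < M) b j by [].
  rewrite -[X in _ = _ * X]mulr_natl; move: (\sum_(j < M) b j) => S.
  by field; rewrite NR pnatr_eq0 -lt0n M0.
rewrite normrM ger0_norm ?mulr_ge0 ?invr_ge0 ?ler0n //.
rewrite [leLHS]mulrAC ler_pM2r ?invr_gt0 ?ltr0n //.
rewrite ler_pdivrMl ?ltr0n //; apply: le_trans (ler_norm_sum _ _ _) _.
have -> : N%:R * N%:R = \sum_(i < N) (N%:R : R).
  by rewrite sumr_const card_ord -[RHS]mulr_natl.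
apply: ler_sum => i _; apply: le_trans (sum_shift_close _ _ b01) _.
by rewrite ler_nat ltnW.
Qed.

Lemma close_mid g h K L : close g K -> close h L ->
  close (fun x => 2^-1 * (g x + h x)) (K + L).
Proof.
move=> [bg g01 K0 hg] [bh h01 L0 hh]; split.
- by apply: bmfZ; exact: bmfD.
- by move=> x; have := g01 x; have := h01 x; lra.
- exact: addr_ge0.
move=> M x M0; have -> : avg (fun y => 2^-1 * (g y + h y)) M x =
    2^-1 * (avg g M x + avg h M x).
  by rewrite /avg -mulr_sumr big_split /= mulrCA mulrDr.
rewrite mulrDl; have := hg M x M0; have := hh M x M0.
rewrite !ler_norml; have := divr_ge0 K0 (ler0n R M); have := divr_ge0 L0 (ler0n R M).
lra.
Qed.

(** Averaging along orbits does not increase the second moment, by convexity and invariance;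
    replacing the average of [g] by that of [f] costs [2 * K / M], as both lie in [0, 1]. *)
Lemma close_sqr g K M : close g K -> (0 < M)%N ->
  s M <= mean (fun x => g x ^+ 2) + 2 * K / M%:R.
Proof.
move=> [bg g01 K0 hg] M0.
have bg2 := bmfX bg.
rewrite -(mean_avg bg2 M0) -[X in _ <= _ + X](mean_cst mu) -meanD; last 2 first.
- exact: bmf_avg.
- exact: bmf_cst.
apply: le_mean; [exact/bmfX/ba| |].
  by apply: bmfD; [exact: bmf_avg|exact: bmf_cst].
move=> x; have := sqr_mean_le (fun j => g (iter j th x)) M.
rewrite -/(avg g M x) -/(avg (fun y => g y ^+ 2) M x).
have := hg M x M0; have := avg01 M x g01; have := avg01 M x f01.
rewrite -/(a M x); set u := a M x; set v := avg g M x; set c := K / M%:R.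
rewrite ler_norml -mulrA -/c; nra.
Qed.

(** This infimum over the averages plays the role of the least squared norm in the closed convex
    hull of the orbit of [f]: [dist_le] extends the lower bound to all functions satisfying [close],
    by letting [M] grow in [close_sqr]. *)
Let dist := inf [set s M | M in [set M | (0 < M)%N]].

Let s_ge0 M : 0 <= s M.
Proof.
rewrite -(mean_cst mu 0); apply: le_mean; [exact: bmf_cst|exact/bmfX/ba|].
by move=> x; exact: sqr_ge0.
Qed.

Let has_inf_s : has_inf [set s M | M in [set M | (0 < M)%N]].
Proof. by split; [exists (s 1), 1%N|exists 0 => _ [M _ <-]]. Qed.

Lemma dist_le g K : close g K -> dist <= mean (fun x => g x ^+ 2).
Proof.
move=> cg; rewrite leNgt; apply/negP; rewrite -subr_gt0.
set e := _ - _ => e0; have K0 : 0 <= K by case: cg.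
have [M hM] : exists M : nat, 2 * K / e < M%:R.
  by exists (Num.trunc (2 * K / e)).+1; exact: truncnS_gt.
have M0 : (0 < M)%N.
  rewrite lt0n; apply/eqP => M0; move: hM; rewrite M0 ltNge => /negP; apply.
  by rewrite divr_ge0 ?mulr_ge0 // ltW.
have h1 := close_sqr cg M0.
have h2 : dist <= s M by apply: ge_inf; [case: has_inf_s|exists M].
have : 2 * K / M%:R < e.
  by rewrite ltr_pdivrMr ?ltr0n // [ltRHS]mulrC -ltr_pdivrMr.
move: h1 h2; rewrite /e; lra.
Qed.

Lemma s_near_dist e : 0 < e ->
  exists N, forall M, (N <= M)%N -> (0 < M)%N -> s M <= dist + e.
Proof.
move=> e0; have e2 : 0 < e / 2 by rewrite divr_gt0.
have [_ [N /= N0 <-] hN] := inf_adherent e2 has_inf_s.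
exists (Num.trunc (2 * N%:R / (e / 2))).+1 => M hM M0.
apply: le_trans (close_sqr (close_avg N0) M0) _.
have : 2 * N%:R / M%:R <= e / 2.
  rewrite ler_pdivrMr ?ltr0n // [leRHS]mulrC -ler_pdivrMr // ltW //.
  apply: (@lt_le_trans _ _ (Num.trunc (2 * N%:R / (e / 2))).+1%:R).
    exact: truncnS_gt.
  by rewrite ler_nat.
by move: hN; rewrite -/dist -/(s N) => hN h; move: (ltW hN); rewrite {1}/s; lra.
Qed.

(** Parallelogram law: both averages have almost minimal norm, while their midpoint, being [close],
    has squared norm at least [dist]. The losses add up to [4 * (e / 4)]. *)
Lemma avg_cauchy e : 0 < e -> exists N, forall M M', (N <= M)%N -> (N <= M')%N ->
  (0 < M)%N -> (0 < M')%N -> mean (fun x => (a M x - a M' x) ^+ 2) <= e.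
Proof.
move=> e0; have [N hN] := s_near_dist (divr_gt0 e0 (ltr0n R 4)).
exists N => M M' NM NM' M0 M0'.
have h1 := hN M NM M0; have h2 := hN M' NM' M0'.
have h3 := dist_le (close_mid (close_avg M0) (close_avg M0')).
have bM := bmfX (ba M); have bM' := bmfX (ba M').
have bmid : bmf (fun x => (2^-1 * (a M x + a M' x)) ^+ 2).
  by apply/bmfX/bmfZ/bmfD; exact: ba.
have -> : mean (fun x => (a M x - a M' x) ^+ 2) =
  2 * s M + 2 * s M' - 4 * mean (fun x => (2^-1 * (a M x + a M' x)) ^+ 2).
  have e1 := meanZ mu 2 bM; have e2 := meanZ mu 2 bM'; have e3 := meanZ mu 4 bmid.
  rewrite /s -e1 -e2 -e3.
  rewrite -(meanD mu (bmfZ 2 bM) (bmfZ 2 bM')).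
  rewrite -(meanB mu (bmfD (bmfZ 2 bM) (bmfZ 2 bM')) (bmfZ 4 bmid)).
  by congr mean; apply/funext => x /=; field.
lra.
Qed.

Let c := fine (mu V).

Lemma mean_a N : (0 < N)%N -> mean (a N) = c.
Proof. by move=> N0; rewrite mean_avg // mean_indic. Qed.

(** Only the first [J] terms of the two sums can differ. Hence the asymptotics of the averages are
    [eqv]-invariant, and the zero-one law applies to them. *)
Lemma avg_eqv x y e : eqv x y -> 0 < e ->
  exists K, forall N, (K <= N)%N -> `|a N x - a N y| <= e.
Proof.
move=> /eqvV[J hJ] e0; exists (J + (Num.trunc (J%:R / e)).+1)%N => N hN.
have N0 : (0 < N)%N by lia.
rewrite /a /avg -mulrBr -sumrB normrM ger0_norm ?invr_ge0 ?ler0n //.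
rewrite ler_pdivrMl ?ltr0n //; apply: (@le_trans _ _ J%:R); last first.
  rewrite -ler_pdivrMr // ltW //.
  apply: (@lt_le_trans _ _ (Num.trunc (J%:R / e)).+1%:R).
    exact: truncnS_gt.
  by rewrite ler_nat; lia.
apply: le_trans (ler_norm_sum _ _ _) _.
pose F i : R := `|f (iter i th x) - f (iter i th y)|.
rewrite (_ : \sum_(i < N) _ = \sum_(i < N) F i) // -(big_mkord xpredT F).
rewrite (@big_cat_nat _ _ _ J) //=; last by lia.
rewrite [X in _ + X]big1_seq ?addr0; last first.
  move=> i; rewrite mem_index_iota => /and3P[_ Ji _]; rewrite /F /f !indicE.
  have -> : (iter i th x \in V) = (iter i th y \in V).
    by apply/idP/idP => /set_mem/(hJ i Ji)/mem_set.
  by rewrite subrr normr0.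
rewrite big_mkord; apply: (@le_trans _ _ (\sum_(i < J) 1)).
  apply: ler_sum => i _; rewrite /F ler_norml.
  by have := f01 (iter i th x); have := f01 (iter i th y); lra.
by rewrite sumr_const card_ord.
Qed.

(** The set where the upper limit of [U] is at most [t] is invariant, hence null or of full measure.
    In the latter case the positive parts of [U k - t] tend to 0 almost surely and so do their
    means, which are however at least [c' - t]. *)
Lemma limsup_ge_mean (U : nat -> T -> R) (t c' : R) :
  (forall k, bmf (U k)) -> (forall k x, `|U k x| <= 1) ->
  (forall x y (e : R), eqv x y -> 0 < e ->
     exists K, forall k, (K <= k)%N -> `|U k x - U k y| <= e) ->
  (forall k, mean (U k) = c') -> t < c' ->
  mu.-negligible [set x | forall m, exists K, forall k, (K <= k)%N ->
    U k x <= t + m.+1%:R^-1].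
Proof.
move=> bU U1 Ueqv mU tc; set B := [set x | _].
have BE : B = \bigcap_m \bigcup_K \bigcap_(k in [set k | (K <= k)%N])
    (U k @^-1` [set y | y <= t + m.+1%:R^-1]).
  apply/seteqP; split => [x Bx m _|x Bx m].
    by have [K hK] := Bx m; exists K => // k; exact: hK.
  by have [K _ hK] := Bx m I; exists K => k; exact: hK.
have mB : measurable B.
  rewrite BE; apply: bigcap_measurable => // m _; apply: bigcup_measurable => K _.
  apply: bigcap_measurable; first by exists K => /=.
  move=> k _; rewrite -[X in measurable X]setTI; apply: (bU k).1 => //.
  by rewrite -set_itvE; exact: measurable_itv.
have Bsub x y : eqv x y -> (B x <-> B y).
  have half : forall x y, (forall e, 0 < e ->
     exists K, forall k, (K <= k)%N -> `|U k x - U k y| <= e) -> B x -> B y.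
    move=> {}x {}y hxy Bx m.
    (* Half of the slack pays for the passage from [x] to [y], the other half for the bound at [x];
       the predecessor below undoes the successor in [B]. *)
    have e0 : 0 < (m.+1 * 2)%:R^-1 :> R by rewrite invr_gt0 ltr0n.
    have [K hK] := hxy _ e0; have [L hL] := Bx (m.+1 * 2).-1.
    exists (K + L)%N => k hk.
    have := hK k (leq_trans (leq_addr _ _) hk).
    have := hL k (leq_trans (leq_addl _ _) hk).
    have -> : m.+1%:R^-1 = (m.+1 * 2)%:R^-1 + (m.+1 * 2)%:R^-1 :> R.
      by rewrite natrM invfM -splitr.
    rewrite prednK // ler_norml; set w := (_ * _)%:R^-1; lra.
  move=> xy; split; [refine (half x y _)|refine (half y x _)] => e e0.
    exact: Ueqv xy e0.
  by have [K hK] := Ueqv x y e xy e0; exists K => k kK; rewrite distrC hK.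
have [B0|B1] := zero_one_law mB Bsub; first by exists B; split.
exfalso.
(* The positive part of [U k - t]. *)
pose h k x := 2^-1 * (`|U k x - t| + (U k x - t)).
have bh k : bmf (h k).
  have b1 : bmf (fun x => U k x - t) by exact: (bmfB (bU k) (bmf_cst _ _)).
  exact: (bmfZ _ (bmfD (bmf_norm b1) b1)).
have h0 : mean (h k) @[k --> \oo] --> 0.
  apply: mean_cvg => //.
    exists (1 + `|t|) => k x; rewrite /h.
    have p1 : `|U k x - t| <= 1 + `|t|.
      by apply: le_trans (ler_normB _ _) _; rewrite lerD2r U1.
    have : - `|U k x - t| <= U k x - t <= `|U k x - t| by rewrite -ler_norml.
    move: p1; set u := `|U k x - t|; set v := `|t| => p1 /andP[p2 p3].
    by rewrite ler_norml; apply/andP; split; lra.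
  exists (~` B); split; first exact: measurableC.
    by rewrite probability_setC // B1 subee.
  move=> x; apply: contra_not => Bx; rewrite /= in Bx.
  have {}Bx : B x by apply: contrapT.
  apply/cvgrPdist_le => e e0.
  have [K hK] := Bx (Num.trunc e^-1).
  exists K => // k /= kK; rewrite sub0r normrN /h.
  have := hK k kK.
  have : (Num.trunc e^-1).+1%:R^-1 <= e.
    by rewrite invf_ple ?posrE ?ltr0n // ltW // truncnS_gt.
  set v := _^-1; have [p|p] := leP 0 (U k x - t).
    by rewrite (ger0_norm p) ger0_norm; lra.
  by move=> _ _; rewrite (ltr0_norm p) addNr mulr0 normr0 ltW.
have : 0 >= c' - t.
  rewrite -(cvg_lim (@Rhausdorff R) h0); apply: limr_ge.
    by apply/cvg_ex; exists 0.
  apply: nearW => k; have bt := bmf_cst T t.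
  rewrite -(mU k) -[X in _ - X](mean_cst mu) -(meanB mu (bU k) bt).
  apply: (le_mean mu (bmfB (bU k) bt) (bh k)).
  by move=> x; rewrite /h; have := ler_norm (U k x - t); lra.
lra.
Qed.

(** Written as the summand of [epsilon_trick0], which supplies the summability for the
    Borel-Cantelli argument. *)
Let rate (k : nat) : R := 1 / (2 ^ k.+1)%:R.

Let rate_gt0 k : 0 < rate k.
Proof. by rewrite divr_gt0 // ltr0n expn_gt0. Qed.

Let rateS k : rate k = 2 * rate k.+1.
Proof.
rewrite /rate [in RHS]expnS natrM; field.
by rewrite !pnatr_eq0 -!lt0n expn_gt0.
Qed.

(** The cube is chosen for Chebyshev's inequality: a deviation of at least [rate k] uses up two
    factors and leaves [rate k] as the bound on the probability. *)
Lemma avg_subsequence : exists n_ : nat -> nat,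
  [/\ forall k, (k < n_ k)%N &
      forall k, mean (fun x => (a (n_ k.+1) x - a (n_ k) x) ^+ 2) <= rate k ^+ 3].
Proof.
have ex k := avg_cauchy (exprn_gt0 3 (rate_gt0 k)).
have [n0 hn0] := choice ex.
pose n_ k := (k.+1 + \sum_(i < k.+1) n0 i)%N.
have n0n k : (n0 k <= n_ k)%N.
  by rewrite /n_ big_ord_recr /= addnA leq_addl.
have nS k : (n_ k <= n_ k.+1)%N.
  by rewrite /n_ [in leqRHS]big_ord_recr /=; lia.
exists n_; split => k; first by rewrite /n_ ltn_addr.
by apply: hn0; rewrite ?(leq_trans (n0n k)) // /n_ addSn.
Qed.

(** By Borel-Cantelli the subsequence is almost surely Cauchy. By [limsup_ge_mean], applied to the
    averages and to their negatives, it is almost surely infinitely often above [c - e] and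
    infinitely often below [c + e] for each [e > 0], so its limit is [c]. *)
Lemma avg_subsequence_cvg (n_ : nat -> nat) : (forall k, (k < n_ k)%N) ->
  (forall k, mean (fun x => (a (n_ k.+1) x - a (n_ k) x) ^+ 2) <= rate k ^+ 3) ->
  {ae mu, forall x, a (n_ k) x @[k --> \oo] --> c}.
Proof.
move=> kn hn.
pose F k := [set x | rate k <= `|a (n_ k.+1) x - a (n_ k) x|].
have bdiff k : bmf (fun x => a (n_ k.+1) x - a (n_ k) x) by exact: (bmfB (ba _) (ba _)).
have mF k : measurable (F k).
  have := (bmf_norm (bdiff k)).1; move=> /(_ measurableT `[rate k, +oo[%classic).
  rewrite setTI => /(_ (measurable_itv _)); congr measurable.
  by apply/seteqP; split => x; rewrite /F /= in_itv /= andbT.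
have muF k : (mu (F k) <= (1 / (2 ^ k.+1)%:R)%:E)%E.
  rewrite -[mu (F k)]fineK ?fin_num_measure // lee_fin -/(rate k).
  rewrite -(mean_indic mu (mF k)) -(ler_pM2l (exprn_gt0 2 (rate_gt0 k))).
  rewrite -exprSr; apply: le_trans (hn k).
  rewrite -(meanZ mu _ (bmf_indic R (mF k))); apply: le_mean.
  - exact: (bmfZ _ (bmf_indic R (mF k))).
  - exact: (bmfX (bdiff k)).
  move=> x; rewrite indicE; have [/set_mem Fx|_] := boolP (x \in F k).
    by rewrite mulr1 -[leRHS]real_normK ?num_real // lerXn2r // nnegrE ltW.
  by rewrite mulr0 sqr_ge0.
have limF : mu (lim_sup_set F) = 0%E.
  apply: lim_sup_set_cvg0 => //.
  apply: (@le_lt_trans _ _ (1%:E : \bar R)); last exact: ltry.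
  apply: le_trans (epsilon_trick0 xpredT ler01).
  by apply: lee_nneseries => k _ //; exact: muF.
have norm_a N x : `|a N x| <= 1.
  by have /andP[u v] := avg01 N x f01; rewrite ger0_norm.
have Ueqv x y (e : R) : eqv x y -> 0 < e ->
    exists K, forall k, (K <= k)%N -> `|a (n_ k) x - a (n_ k) y| <= e.
  move=> xy e0; have [K hK] := avg_eqv xy e0; exists K => k Kk; apply: hK.
  exact: leq_trans Kk (ltnW (kn k)).
have mean_n k : mean (a (n_ k)) = c by apply: mean_a; exact: leq_trans (kn k).
pose up m := [set x | forall l, exists K, forall k, (K <= k)%N ->
    a (n_ k) x <= (c - m.+1%:R^-1) + l.+1%:R^-1].
pose lo m := [set x | forall l, exists K, forall k, (K <= k)%N ->
    - a (n_ k) x <= (- c - m.+1%:R^-1) + l.+1%:R^-1].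
have negup m : mu.-negligible (up m).
  apply: (@limsup_ge_mean (fun k => a (n_ k)) _ c) => //.
  by rewrite gtrBl.
have neglo m : mu.-negligible (lo m).
  apply: (@limsup_ge_mean (fun k x => - a (n_ k) x) _ (- c)) => //.
  - by move=> k; exact: (bmfN (ba _)).
  - by move=> k x; rewrite normrN.
  - move=> x y e xy e0; have [K hK] := Ueqv x y e xy e0; exists K => k kK.
    by rewrite opprK addrC distrC hK.
  - move=> k; rewrite -(mean_n k) -[RHS]mulN1r -(meanZ mu _ (ba _)).
    by congr mean; apply/funext => x; rewrite mulN1r.
  - by rewrite gtrBl.
have neg : mu.-negligible (lim_sup_set F `|` (\bigcup_m up m `|` \bigcup_m lo m)).
  apply: negligibleU; last by apply: negligibleU; exact: negligible_bigcup.
  exists (lim_sup_set F); split => //.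
  by apply: bigcap_measurable => // k _; apply: bigcup_measurable.
apply: negligibleS neg => x /=; apply: contra_notP => nx.
have nF : exists K, forall k, (K <= k)%N -> `|a (n_ k.+1) x - a (n_ k) x| < rate k.
  apply: contrapT => no; apply: nx; left => K _.
  apply: contrapT => no'; apply: no; exists K => k Kk; rewrite ltNge.
  by apply/negP => h; apply: no'; exists k.
have [K hK] := nF.
(* Since [rate j = 2 * rate j - 2 * rate j.+1], the increments telescope. *)
have osc k j : (K <= k)%N -> (k <= j)%N ->
    `|a (n_ j) x - a (n_ k) x| <= 2 * rate k - 2 * rate j.
  move=> Kk; elim: j => [|j IH]; first by rewrite leqn0 => /eqP ->; rewrite !subrr normr0.
  rewrite leq_eqVlt => /predU1P[<-|kj]; first by rewrite !subrr normr0.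
  have h1 := IH kj; have h2 := hK j (leq_trans Kk kj).
  rewrite (_ : a (n_ j.+1) x - a (n_ k) x =
    (a (n_ j.+1) x - a (n_ j) x) + (a (n_ j) x - a (n_ k) x)); last by ring.
  apply: le_trans (ler_normD _ _) _.
  move: h1 h2 (rateS j); move: (rate j) (rate j.+1) (rate k) => u v w h1 h2 uv.
  have -> : 2 * w - 2 * v = u + (2 * w - 2 * u) by rewrite uv; ring.
  exact: lerD (ltW h2) h1.
have freq_up m k : exists2 j, (k <= j)%N & c - m.+1%:R^-1 < a (n_ j) x.
  apply: contrapT => no; apply: nx; right; left; exists m => // l; exists k => j kj.
  have : ~ c - m.+1%:R^-1 < a (n_ j) x by move=> h; apply: no; exists j.
  by move=> /negP; rewrite -leNgt => h; rewrite (le_trans h) // lerDl ltW.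
have freq_lo m k : exists2 j, (k <= j)%N & a (n_ j) x < c + m.+1%:R^-1.
  apply: contrapT => no; apply: nx; right; right; exists m => // l; exists k => j kj.
  have : ~ a (n_ j) x < c + m.+1%:R^-1 by move=> h; apply: no; exists j.
  move=> /negP; rewrite -leNgt => h; rewrite -opprD.
  by apply: (@le_trans _ _ (- (c + m.+1%:R^-1))); rewrite ?lerN2 // lerDl ltW.
have rate_le k : rate k <= k.+1%:R^-1.
  rewrite /rate div1r lef_pV2 ?posrE ?ltr0n ?expn_gt0 // ler_nat.
  exact: ltnW (ltn_expl _ _).
apply/cvgrPdist_le => e e0.
(* One third of [e] bounds the one-sided distance to [c] at the times [i] and [j], two thirds the
   oscillation [2 * rate k]. *)
pose m := Num.trunc (3 / e).
have me : m.+1%:R^-1 <= e / 3.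
  rewrite invf_ple ?posrE ?ltr0n ?divr_gt0 // invf_div ltW //; exact: truncnS_gt.
exists (K + m)%N => // k /= Kmk.
have Kk : (K <= k)%N by apply: leq_trans Kmk; exact: leq_addr.
have [i ki hi] := freq_up m k; have [j kj hj] := freq_lo m k.
have := osc k i Kk ki; have := osc k j Kk kj.
have rk : rate k <= e / 3.
  apply: le_trans (rate_le k) _; apply: le_trans me.
  rewrite lef_pV2 ?posrE ?ltr0n // ler_nat ltnS.
  by apply: leq_trans Kmk; exact: leq_addl.
move: hi hj me rk (rate_gt0 i) (rate_gt0 j).
move: (m.+1%:R^-1) (rate i) (rate j) (rate k) => w ri rj rk hi hj we rke ri0 rj0.
rewrite !ler_norml => /andP[p1 p2] /andP[p3 p4]; apply/andP; split; lra.
Qed.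

(** The Cauchy property carries the L2 limit [c] from the subsequence to the whole sequence of
    averages; pairing with the indicator of [D] gives the claim. *)
Theorem mean_ergodic D : measurable D ->
  N%:R^-1 * \sum_(j < N) fine (mu (D `&` iter j th @^-1` V)) @[N --> \oo]
    --> fine (mu D) * fine (mu V).
Proof.
move=> mD; rewrite -/c.
have [n_ [kn hn]] := avg_subsequence.
have bc : bmf (fun=> c) by exact: bmf_cst.
have b2 N : bmf (fun x => (a N x - c) ^+ 2) by exact: (bmfX (bmfB (ba N) bc)).
have c01 : 0 <= c <= 1.
  rewrite /c fine_ge0 //= -lee_fin fineK ?fin_num_measure //.
  exact: probability_le1.
have L2 : mean (fun x => (a (n_ k) x - c) ^+ 2) @[k --> \oo] --> 0.
  apply: (mean_cvg (F := fun k x => (a (n_ k) x - c) ^+ 2)).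
  - by move=> k; exact: b2.
  - exists 1 => k x; rewrite ger0_norm ?sqr_ge0 //.
    by have := avg01 (n_ k) x f01; rewrite -/(a _ _) expr2; nra.
  apply: filterS (avg_subsequence_cvg kn hn) => x h.
  rewrite (_ : 0 = (c - c) ^+ 2); last by rewrite subrr expr0n.
  have h' : a (n_ k) x - c @[k --> \oo] --> c - c by apply: cvgB => //; exact: cvg_cst.
  by under eq_fun do rewrite expr2; rewrite expr2; exact: cvgM.
have bD := bmf_indic R mD.
have E N : N%:R^-1 * \sum_(j < N) fine (mu (D `&` iter j th @^-1` V)) =
    mean (fun x => \1_D x * a N x).
  have mDV j : measurable (D `&` iter j th @^-1` V).
    apply: measurableI => //; rewrite -[X in measurable X]setTI.
    exact: iter_measurable.
  under eq_bigr do rewrite -(mean_indic mu (mDV _)).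
  rewrite -(mean_sum mu N (fun j => bmf_indic R (mDV j))) -(meanZ mu).
    congr mean; apply/funext => x; rewrite /a /avg [RHS]mulrCA.
    by congr (_ * _); rewrite mulr_sumr; apply: eq_bigr => j _; rewrite indicI.
  exact: (bmf_sum N (fun j => bmf_indic R (mDV j))).
apply/cvgrPdist_le => e e0.
have e2 : 0 < e / 2 by lra.
have e16 : 0 < (e / 4) ^+ 2 by rewrite exprn_gt0 // divr_gt0.
have [N hN] := avg_cauchy e16.
have /cvgrPdist_le /(_ _ e16) [k0 _ hk0] := L2.
exists N.+1 => // M /= NM.
have M0 : (0 < M)%N by apply: leq_trans NM.
pose k := maxn k0 N.
have h1 : mean (fun x => (a M x - a (n_ k) x) ^+ 2) <= (e / 4) ^+ 2.
  apply: hN => //; first exact: ltnW.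
    by apply: leq_trans (ltnW (kn k)); exact: leq_maxr.
  exact: leq_ltn_trans (kn k).
have h2 : mean (fun x => (a (n_ k) x - c) ^+ 2) <= (e / 4) ^+ 2.
  have := hk0 k (leq_maxl _ _); rewrite sub0r normrN; apply: le_trans.
  exact: ler_norm.
have bd : bmf (fun x => (a M x - a (n_ k) x) ^+ 2) by exact: (bmfX (bmfB (ba _) (ba _))).
have h3 : mean (fun x => (a M x - c) ^+ 2) <= (e / 2) ^+ 2.
  apply: (@le_trans _ _ (2 * mean (fun x => (a M x - a (n_ k) x) ^+ 2) +
      2 * mean (fun x => (a (n_ k) x - c) ^+ 2))).
    rewrite -(meanZ mu _ bd) -(meanZ mu _ (b2 _)).
    rewrite -(meanD mu (bmfZ _ bd) (bmfZ _ (b2 _))).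
    apply: (le_mean mu (b2 M)); first exact: (bmfD (bmfZ _ bd) (bmfZ _ (b2 _))).
    move=> x; rewrite -subr_ge0; move: (a M x) (a (n_ k) x) => u v.
    rewrite (_ : _ - _ = ((u - v) - (v - c)) ^+ 2) ?sqr_ge0 //; ring.
  rewrite (_ : (e / 2) ^+ 2 = 2 * (e / 4) ^+ 2 + 2 * (e / 4) ^+ 2); last by field.
  by apply: lerD; rewrite ler_pM2l.
have -> : fine (mu D) * c = mean (fun x => \1_D x * c).
  rewrite -(mean_indic mu mD) mulrC -(meanZ mu _ bD).
  by congr mean; apply/funext => x; rewrite mulrC.
rewrite E -(meanB mu (bmfM bD bc) (bmfM bD (ba M))).
(* AM-GM: [|y| <= e/2 + y^2 / (e/2)] *)
have bb : bmf (fun x => e / 2 + (e / 2)^-1 * (a M x - c) ^+ 2).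
  exact: (bmfD (bmf_cst _ _) (bmfZ _ (b2 M))).
have pw x : `|\1_D x * c - \1_D x * a M x| <= e / 2 + (e / 2)^-1 * (a M x - c) ^+ 2.
  have y2 : `|a M x - c| <= e / 2 + (e / 2)^-1 * (a M x - c) ^+ 2.
    rewrite -(ler_pM2l e2) mulrDr mulVKf ?gt_eqF // -[(a M x - c) ^+ 2]real_normK ?num_real //.
    have := normr_ge0 (a M x - c); move: (`|a M x - c|) => u; nra.
  rewrite -mulrBr normrM distrC; apply: le_trans y2; rewrite indicE.
  by case: (x \in D); rewrite ?normr1 ?mul1r // normr0 mul0r.
have Mb : mean (fun x => e / 2 + (e / 2)^-1 * (a M x - c) ^+ 2) <= e.
  rewrite (meanD mu (bmf_cst _ _) (bmfZ _ (b2 M))) mean_cst (meanZ mu _ (b2 M)).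
  have : (e / 2)^-1 * mean (fun x => (a M x - c) ^+ 2) <= e / 2.
    by rewrite ler_pdivrMl // -expr2.
  lra.
apply: le_trans Mb; rewrite ler_norml; apply/andP; split.
  rewrite lerNl -[X in X <= _]mulN1r -(meanZ mu _ (bmfB (bmfM bD bc) (bmfM bD (ba M)))).
  apply: (le_mean mu) => //; first exact: (bmfZ _ (bmfB (bmfM bD bc) (bmfM bD (ba M)))).
  by move=> x; apply: le_trans (pw x); rewrite mulN1r -normrN ler_norm.
apply: (le_mean mu) => //; first exact: (bmfB (bmfM bD bc) (bmfM bD (ba M))).
by move=> x; apply: le_trans (pw x); rewrite ler_norm.
Qed.

End MeanErgodic.

(** * Cylinders *)

Section Cylinders.
Variable n : nat.
Local Notation X := (fullshift n).
Local Notation I := 'I_n.+1.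
Implicit Types (x y : X) (k : int) (L : nat) (w u v : seq I).

Definition word k L x : seq I := mkseq (fun i : nat => x (k + i%:Z)) L.

Arguments word : simpl never.

Definition cyl k w : set X := [set x | word k (size w) x = w].

Lemma size_word k L x : size (word k L x) = L.
Proof. exact: size_mkseq. Qed.

Lemma nth_word k L x (i : nat) : (i < L)%N ->
  nth ord0 (word k L x) i = x (k + i%:Z).
Proof. exact: nth_mkseq. Qed.

Lemma wordS k L x : word k L.+1 x = x k :: word (k + 1) L x.
Proof.
rewrite /word /mkseq /= addr0; congr cons.
by rewrite (iotaDl 1 0) -map_comp; apply: eq_map => i /=; congr x; lia.
Qed.

Lemma word_rcons k L x : word k L.+1 x = rcons (word k L x) (x (k + L%:Z)).
Proof. by rewrite /word mkseqS. Qed.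

Lemma word_cat k L M x : word k (L + M) x = word k L x ++ word (k + L%:Z) M x.
Proof.
elim: M => [|M IH]; first by rewrite addn0 cats0.
by rewrite addnS !word_rcons IH rcons_cat PoszD addrA.
Qed.

Lemma eq_word k L x y : (forall i, k <= i < k + L%:Z -> x i = y i) ->
  word k L x = word k L y.
Proof.
move=> xy; apply: (@eq_from_nth _ ord0); rewrite ?size_word // => i iL.
by rewrite !nth_word //; apply: xy; lia.
Qed.

Lemma cyl_word k L x : cyl k (word k L x) x.
Proof. by rewrite /cyl /= size_word. Qed.

Lemma cylE k w x i : cyl k w x -> k <= i < k + (size w)%:Z ->
  x i = nth ord0 w `|i - k|%N.
Proof.
rewrite /cyl /= => <- ki; rewrite size_word in ki *; rewrite nth_word; last by lia.
by congr x; lia.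
Qed.

Lemma cylP k w x : (forall i : nat, (i < size w)%N -> x (k + i%:Z) = nth ord0 w i) ->
  cyl k w x.
Proof.
move=> h; apply: (@eq_from_nth _ ord0); rewrite ?size_word // => i iL.
by rewrite nth_word // h.
Qed.

Lemma cyl0 k : cyl k [::] = setT.
Proof. by apply/seteqP; split. Qed.

Lemma cyl_cat k u v : cyl k (u ++ v) = cyl k u `&` cyl (k + (size u)%:Z) v.
Proof.
rewrite /cyl; apply/seteqP; split => x /=; rewrite size_cat word_cat.
  by move=> /eqP; rewrite eqseq_cat ?size_word // => /andP[/eqP -> /eqP ->].
by move=> [-> ->].
Qed.

Lemma cyl1 k a : cyl k [:: a] = [set x | x k = a].
Proof.
by apply/seteqP; split => x; rewrite /cyl /= wordS; [case|move=> /= ->].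
Qed.

Lemma cyl_cons k a w : cyl k (a :: w) = [set x | x k = a] `&` cyl (k + 1) w.
Proof. by rewrite -cat1s cyl_cat cyl1. Qed.

Lemma cyl_rcons k w a :
  cyl k (rcons w a) = cyl k w `&` [set x | x (k + (size w)%:Z) = a].
Proof. by rewrite -cats1 cyl_cat cyl1. Qed.

Lemma measurable_coord k a : measurable ([set x | x k = a] : set X).
Proof. by apply: sub_sigma_algebra; exists k, a. Qed.

Lemma measurable_cyl k w : measurable (cyl k w).
Proof.
elim: w k => [|a w IH] k; first by rewrite cyl0; exact: measurableT.
by rewrite cyl_cons; apply: measurableI; [exact: measurable_coord|exact: IH].
Qed.

Lemma measurable_to_fullshift d (T : measurableType d) (D : set T) (h : T -> X) :
  (forall k a, measurable D -> measurable (D `&` [set t | h t k = a])) ->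
  measurable_fun D h.
Proof.
move=> mh mD; apply: (@measurability _ _ _ _ D h (@coordinate_sets n)) => //.
by move=> _ [_ [k [a ->]] <-]; exact: mh.
Qed.

Lemma measurable_reindex (s : int -> int) :
  measurable_fun setT (fun x : X => (fun j => x (s j)) : X).
Proof.
apply: measurable_to_fullshift => k a _; rewrite setTI.
exact: measurable_coord.
Qed.

(** One implication suffices, because agreement on the half-open window from [k] to [k + L] is
    symmetric in [x] and [y]. *)
Definition window_set k L (B : set X) :=
  forall x y, (forall i, k <= i < k + L%:Z -> x i = y i) -> B x -> B y.

Lemma window_set_cyl k L B w : window_set k L B -> size w = L ->
  B `&` cyl k w = set0 \/ B `&` cyl k w = cyl k w.
Proof.
move=> wB sw.
have [[x [Bx wx]]|no] := pselect (exists x, B x /\ cyl k w x).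
  right; apply/seteqP; split => y [] // wy; split => //.
  apply: wB Bx => i ki; rewrite (cylE wx) ?(cylE wy) ?sw //.
left; apply/seteqP; split => // x [Bx wx]; apply: no; by exists x.
Qed.

Lemma bigcup_words (B : set X) k L :
  B = \big[setU/set0]_(w <- words I L) (B `&` cyl k w).
Proof.
apply/seteqP; split => x.
  move=> Bx; rewrite -bigcup_seq; exists (word k L x) => /=.
    by rewrite mem_words size_word.
  by split => //; exact: cyl_word.
by rewrite -bigcup_seq => -[w _ []].
Qed.

Lemma measurable_window_set k L B : window_set k L B -> measurable B.
Proof.
move=> wB; rewrite (bigcup_words B k L) big_seq.
apply: bigsetU_measurable => w; rewrite mem_words => /eqP sw.
by have [->|->] := window_set_cyl wB sw => //; exact: measurable_cyl.
Qed.

Lemma measure_bigsetU_seq (R : realType) (m : {measure set X -> \bar R})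
    (J : choiceType) (s : seq J) (F : J -> set X) : uniq s ->
  (forall i, measurable (F i)) -> (forall i j x, F i x -> F j x -> i = j) ->
  m (\big[setU/set0]_(i <- s) F i) = (\sum_(i <- s) m (F i))%E.
Proof.
move=> us mF dF; elim: s us => [|i s IH]; first by rewrite !big_nil measure0.
rewrite /= => /andP[is_ us]; rewrite !big_cons -(IH us); apply: measureU => //.
  by apply: bigsetU_measurable => j _.
apply/seteqP; split => // x [Fi]; rewrite -bigcup_seq => -[j /= js Fj].
by rewrite (dF _ _ _ Fi Fj) js in is_.
Qed.

Lemma measure_words (R : realType) (m : {measure set X -> \bar R}) k L (B : set X) :
  measurable B -> m B = (\sum_(w <- words I L) m (B `&` cyl k w))%E.
Proof.
(* Cylinders of words of different lengths may meet; emptying those of the wrong length makes the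
   family disjoint over all words. *)
move=> mB; pose F w := if size w == L then B `&` cyl k w else set0.
have E (Y : Type) (y0 : Y) (op : Y -> Y -> Y) (G : set X -> Y) :
    \big[op/y0]_(w <- words I L) G (B `&` cyl k w) =
    \big[op/y0]_(w <- words I L) G (F w).
  rewrite big_seq [RHS]big_seq; apply: eq_bigr => w.
  by rewrite mem_words /F => ->.
rewrite [X in m X](bigcup_words B k L) (E _ _ _ id) (E _ _ _ m).
apply: measure_bigsetU_seq; first exact: uniq_words.
- by move=> w; rewrite /F; case: ifP => // _; apply: measurableI => //; exact: measurable_cyl.
- move=> u v x; rewrite /F; case: ifP => // /eqP su; case: ifP => // /eqP sv.
  by rewrite /cyl /= su sv => -[_ <-] [_ <-].
Qed.

Lemma measure_coord (R : realType) (m : {measure set X -> \bar R}) k (B : set X) :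
  measurable B -> m B = (\sum_(a : I) m (B `&` [set x | x k = a]))%E.
Proof.
move=> mB; rewrite (measure_words m k 1 mB) big_wordsS big_words0.
by apply: eq_bigr => a _; rewrite /= cyl1.
Qed.

(** Window sets form a generating pi-system, and each is a finite disjoint union of central
    cylinders of any large radius. The threshold [N0] lets the caller assume that a given block lies
    inside the window. *)
Lemma eq_measure_cyl (R : realType) (m1 m2 : {measure set X -> \bar R}) (N0 : nat) :
  (m1 setT < +oo)%E ->
  (forall (N : nat) w, (N0 <= N)%N -> size w = (2 * N).+1 ->
     m1 (cyl (- N%:Z) w) = m2 (cyl (- N%:Z) w)) ->
  forall B, measurable B -> m1 B = m2 B.
Proof.
move=> fin eqc; pose G := [set B | exists k L, window_set k L B].
have GT : G setT by exists 0, 0%N => x y.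
have mG B : G B -> measurable B by move=> [k [L]]; exact: measurable_window_set.
move=> B0 mB0; have GB0 : <<s G >> B0.
  apply: (@smallest_sub _ (sigma_algebra setT) (@coordinate_sets n) <<s G>>) mB0.
    exact: smallest_sigma_algebra.
  move=> _ [k [a ->]]; apply: sub_sigma_algebra.
  by exists k, 1%N => x y xy /= <-; symmetry; apply: xy; lia.
apply: (g_sigma_algebra_measure_unique _ mG (fun=> setT)) GB0 => //.
- by rewrite bigcup_const //; exists 0%N.
- move=> A B [k [L wA]] [l [M wB]].
  exists (- (`|k|%N + L + `|l|%N + M)%N%:Z), (2 * (`|k|%N + L + `|l|%N + M))%N.
  move=> x y xy [Ax Bx]; split.
    by apply: wA Ax => i ki; apply: xy; lia.
  by apply: wB Bx => i ki; apply: xy; lia.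
- move=> B [k [L wB0]]; pose N := (N0 + `|k|%N + L)%N.
  have wB : window_set (- N%:Z) (2 * N).+1 B.
    by move=> x y xy; apply: wB0 => i ki; apply: xy; rewrite /N; lia.
  have mB := measurable_window_set wB.
  rewrite (measure_words m1 (- N%:Z) (2 * N).+1 mB).
  rewrite (measure_words m2 (- N%:Z) (2 * N).+1 mB).
  rewrite big_seq [RHS]big_seq; apply: eq_bigr => w; rewrite mem_words => /eqP sw.
  have [->|->] := window_set_cyl wB sw; first by rewrite !measure0.
  by apply: eqc => //; rewrite /N; lia.
Qed.

End Cylinders.

Section CountableUnions.
Context d (T : measurableType d) (U : countType).
Implicit Types F : U -> set T.

Lemma bigcup_unpickle F :
  \bigcup_i F i = \bigcup_k (oapp F set0 (unpickle k)).
Proof.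
apply/seteqP; split => x [i _].
  by move=> Fi; exists (pickle i) => //; rewrite pickleK.
by case: (unpickle i) => //= j Fj; exists j.
Qed.

Lemma measurable_bigcup_countable F : (forall i, measurable (F i)) ->
  measurable (\bigcup_i F i).
Proof.
move=> mF; rewrite bigcup_unpickle; apply: bigcupT_measurable => k.
case: (unpickle k) => [i|] /=; [exact: mF|exact: measurable0].
Qed.

Lemma measurable_bigcap_countable F : (forall i, measurable (F i)) ->
  measurable (\bigcap_i F i).
Proof.
move=> mF; rewrite -[X in measurable X]setCK setC_bigcap.
apply: measurableC; apply: measurable_bigcup_countable => i; exact: measurableC.
Qed.

Lemma measure_bigcup_countable0 (R : realType) (mu : {measure set T -> \bar R}) F :
  (forall i, measurable (F i)) -> (forall i, mu (F i) = 0%E) ->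
  mu (\bigcup_i F i) = 0%E.
Proof.
move=> mF F0; apply/negligibleP; first exact: measurable_bigcup_countable.
rewrite bigcup_unpickle; apply: negligible_bigcup => k.
case: (unpickle k) => [i|] /=; last exact: negligible_set0.
by apply/negligibleP; [exact: mF|exact: F0].
Qed.

End CountableUnions.

(** * Shifts of finite type and overwriting of blocks *)

Section Shifts.
Variable n : nat.
Local Notation X := (fullshift n).
Local Notation I := 'I_n.+1.
Implicit Types (x y : X) (k : int) (L N : nat) (w u v : seq I) (A : 'M[nat]_n.+1).

Lemma measurable_coord2 (Q : I -> I -> Prop) k l :
  measurable ([set x | Q (x k) (x l)] : set X).
Proof.
pose N := (`|k|%N + `|l|%N)%N.
apply: (@measurable_window_set _ (- N%:Z) (2 * N).+1) => x y xy /=.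
by rewrite (xy k) ?(xy l) //; rewrite /N; lia.
Qed.

Lemma measurable_sft A : measurable (sft A).
Proof.
have -> : sft A = \bigcap_k [set x | A (x k) (x (k + 1)) = 1%N].
  by apply/seteqP; split => x h k; [move=> _; exact: h|exact: h].
by apply: measurable_bigcap_countable => k; exact: (measurable_coord2 (fun a b => A a b = 1%N)).
Qed.

Definition step A : rel I := fun i j => A i j == 1%N.

Lemma path_word (e : rel I) x k L : (forall i, k <= i < k + L%:Z -> e (x i) (x (i + 1))) ->
  path e (x k) (word (k + 1) L x).
Proof.
elim: L => [//|L IH] h; rewrite word_rcons rcons_path IH /=; last first.
  by move=> i ki; apply: h; lia.
have -> : last (x k) (word (k + 1) L x) = x (k + L%:Z).
  by case: L {IH h} => [|L]; [rewrite /= addr0|rewrite word_rcons last_rcons; congr x; lia].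
have -> : k + 1 + L%:Z = k + L%:Z + 1 by lia.
by apply: h; lia.
Qed.

Definition overwrite k u x : X :=
  fun j => if k <= j < k + (size u)%:Z then nth ord0 u `|j - k| else x j.

Lemma overwrite_out k u x j : ~~ (k <= j < k + (size u)%:Z) -> overwrite k u x j = x j.
Proof. by rewrite /overwrite => /negbTE ->. Qed.

Lemma cyl_overwrite k u x : cyl k u (overwrite k u x).
Proof.
apply: cylP => i iu; rewrite /overwrite ifT; last by lia.
by congr nth; lia.
Qed.

Lemma eq_overwrite k u x y : cyl k u y ->
  (forall j, ~~ (k <= j < k + (size u)%:Z) -> y j = x j) -> overwrite k u x = y.
Proof.
move=> uy yx; apply/funext => j; rewrite /overwrite; case: ifPn => [kj|/yx //].
by rewrite (cylE uy).
Qed.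

Lemma overwrite_id k u x : cyl k u x -> overwrite k u x = x.
Proof. by move=> ux; apply: eq_overwrite. Qed.

Lemma overwrite_overwrite k u v x : size u = size v -> overwrite k u (overwrite k v x) = overwrite k u x.
Proof.
move=> suv; apply: eq_overwrite; first exact: cyl_overwrite.
by move=> j kj; rewrite !overwrite_out // -?suv.
Qed.

Lemma measurable_overwrite k u : measurable_fun setT (overwrite k u).
Proof.
apply: measurable_to_fullshift => l a _; rewrite setTI.
have [kl|kl] := boolP (k <= l < k + (size u)%:Z); last first.
  rewrite (_ : [set _ | _] = [set x | x l = a]); first exact: measurable_coord.
  by apply/seteqP; split => x /=; rewrite overwrite_out.
rewrite (_ : [set _ | _] = if nth ord0 u `|l - k| == a then setT else set0).
  by case: ifP.
by apply/seteqP; split => x /=; rewrite /overwrite kl; case: eqP.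
Qed.

Lemma sft_overwrite A k a u v x : sft A x -> cyl k (a :: u) x -> path (step A) a v ->
  size u = size v -> last a u = last a v -> sft A (overwrite k (a :: v) x).
Proof.
move=> xA ux pv suv luv j.
have in_v (i : nat) : (i < size (a :: v))%N -> overwrite k (a :: v) x (k + i%:Z) = nth ord0 (a :: v) i.
  move=> iv; have iv' : (i < (size v).+1)%N by [].
  rewrite (cylE (cyl_overwrite k (a :: v) x)); last by rewrite [size _]/=; lia.
  by congr nth; lia.
(* The end letters of the block do not change, so both boundary coordinates count as outside too.
   Every transition then lies entirely in [a :: v] or entirely in [x]. *)
have out i : i <= k \/ k + (size u)%:Z <= i -> overwrite k (a :: v) x i = x i.
  move=> ki; have [kj|/overwrite_out //] := boolP (k <= i < k + (size (a :: v))%:Z).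
  have [ik|ik] := boolP (i == k).
    have h0 := in_v 0%N isT; rewrite (_ : k + 0%:Z = k) in h0; last by lia.
    rewrite (eqP ik) h0 (cylE ux); last by rewrite [size _]/=; lia.
    by rewrite subrr.
  have -> : i = k + (size u)%:Z by move: kj ki ik; rewrite [size _]/= suv; lia.
  rewrite (in_v (size u)); last by rewrite [size (_ :: _)]/= suv.
  rewrite (cylE ux); last by rewrite [size (_ :: _)]/= suv; lia.
  rewrite suv.
  have -> : absz (k + (size v)%:Z - k)%R = size v by lia.
  by rewrite -{2}suv -[size v]/(size (a :: v)).-1 -[size u]/(size (a :: u)).-1 !nth_last.
have [kj|kj] := boolP (k <= j < k + (size v)%:Z); last first.
  by rewrite !out; [exact: xA|lia|lia].
have [i iv ->] : exists2 i : nat, (i < size v)%N & j = k + i%:Z.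
  by exists `|j - k|%N; lia.
have -> : k + i%:Z + 1 = k + (i.+1)%:Z by lia.
rewrite !in_v //=; last exact: leqW.
by apply/eqP; have /pathP := pv; move=> /(_ ord0 i iv).
Qed.

Definition agree_off N x y := forall i : int, (N < `|i|)%N -> x i = y i.

Definition central_word N x := word (- N%:Z) (2 * N).+1 x.

Lemma finite_diffP x y : finite_set [set k : int | x k <> y k] <->
  exists N, agree_off N x y.
Proof.
split=> [/finite_seqP[s sE]|[N h]].
  exists (\sum_(i <- s) `|i|%N)%N => i Ni; apply: contrapT => xy.
  have is_ : i \in s.
    by have : [set` s] i by rewrite -sE.
  by move: Ni; rewrite (big_rem i) //= ltnNge leq_addr.
apply: (@sub_finite_set _ _ [set` [seq i%:Z - N%:Z | i <- iota 0 (2 * N).+1]]).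
  move=> i xi; have iN : (`|i| <= N)%N by rewrite leqNgt; apply/negP => /h.
  apply/mapP; exists (absz (i + N%:Z)%R); last by lia.
  by rewrite mem_iota; lia.
exact: finite_seq.
Qed.

Lemma gibbs_relP A x y :
  gibbs_rel A (x, y) <-> [/\ sft A x, sft A y & exists N, agree_off N x y].
Proof. by split=> -[? ? /finite_diffP]. Qed.

End Shifts.

(** * Finite permutations of coordinates *)

(** Images under an involution are preimages, so measurability of [W] gives that of its images. The
    full-group elements constructed below are all of this form. *)
Lemma involution_full_group d (T : measurableType d) (D : set T) (E : set (T * T))
    (W : T -> T) : measurable_fun setT W -> involutive W ->
  (forall x, D x -> D (W x) /\ E (x, W x)) ->
  in_full_group D E W /\ forall B, W @` B = W @^-1` B.
Proof.
move=> mW WK h.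
have im B : W @` B = W @^-1` B.
  apply/seteqP; split => [_ [x Bx <-]|x Bx]; first by rewrite /= WK.
  by exists (W x).
split=> //; split; last by move=> x /h[].
split.
- split; first by move=> x /h[].
  + by move=> x y _ _; exact: (inv_inj WK).
  + by move=> x /h[Wx _]; exists (W x).
- exact: measurable_funTS.
- by move=> B mB _; rewrite im -[X in measurable X]setTI; exact: mW.
Qed.

Section Permutations.
Variable n : nat.
Local Notation X := (fullshift n).
Local Notation I := 'I_n.+1.
Implicit Types (x y : X) (k : int) (L N : nat) (w u v : seq I) (A : 'M[nat]_n.+1).

Definition reindex (s : int -> int) x : X := fun j => x (s j).

Record finite_perm (s t : int -> int) N : Prop := FinitePerm {
  fpermK : cancel s t;
  fpermKV : cancel t s;
  fperm_out : forall i : int, (N < `|i|)%N -> s i = i }.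

Lemma finite_perm_sym s t N : finite_perm s t N -> finite_perm t s N.
Proof.
move=> [st ts out]; split => // i Ni.
by apply: (can_inj st); rewrite ts out.
Qed.

Lemma finite_perm_rel A s t N x : finite_perm s t N ->
  sft A x -> sft A (reindex s x) -> sym_rel A (x, reindex s x).
Proof.
move=> [st ts out] xA sxA; split => //=; exists s; split => //.
  by exists t.
apply: (@sub_finite_set _ _ [set` [seq i%:Z - N%:Z | i <- iota 0 (2 * N).+1]]).
  move=> i si; have iN : (`|i| <= N)%N by rewrite leqNgt; apply/negP => /out.
  by apply/mapP; exists (absz (i + N%:Z)%R); [rewrite mem_iota; lia|lia].
exact: finite_seq.
Qed.

Section Invariance.
Variables (R : realType) (mu : probability X R) (A : 'M[nat]_n.+1).
Hypothesis mu_inv : rel_invariant (sft A) (sym_rel A) mu.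
Variables (s t : int -> int) (N : nat).
Hypothesis fst : finite_perm s t N.

Let sr : X -> X := reindex s.
Let tr : X -> X := reindex t.

Let srK x : tr (sr x) = x.
Proof. by apply/funext => j; rewrite /tr /sr /reindex (fpermKV fst). Qed.

Let trK x : sr (tr x) = x.
Proof. by apply/funext => j; rewrite /tr /sr /reindex (fpermK fst). Qed.

(** [reindex s] need not preserve [sft A], but the map that uses it on [D1], its inverse on [D2] and
    the identity elsewhere does. *)
Lemma perm_invariant_disjoint (D1 D2 : set X) : measurable D1 -> measurable D2 ->
  D1 `<=` sft A -> D2 `<=` sft A -> (forall x, D1 x <-> D2 (reindex s x)) ->
  (forall x, D1 x -> D2 x -> False) -> mu D1 = mu D2.
Proof.
move=> m1 m2 s1 s2 D12 disj.
have D21 x : D2 x -> D1 (tr x) by move=> D2x; apply/D12; rewrite -/(sr _) trK.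
pose W x := if x \in D1 then sr x else if x \in D2 then tr x else x.
have W1 x : D1 x -> W x = sr x by move=> h; rewrite /W mem_set.
have W2 x : D2 x -> W x = tr x.
  move=> h; rewrite /W (mem_set h) memNset // => h1; exact: disj h1 h.
have W0 x : ~ D1 x -> ~ D2 x -> W x = x by move=> h1 h2; rewrite /W !memNset.
have mW : measurable_fun setT W.
  move=> _ B mB; rewrite setTI.
  have -> : W @^-1` B = (D1 `&` sr @^-1` B) `|` (D2 `&` tr @^-1` B)
      `|` (~` D1 `&` ~` D2 `&` B).
    apply/seteqP; split => x /=.
      have [x1|x1] := pselect (D1 x); first by rewrite W1 // => Bx; left; left.
      have [x2|x2] := pselect (D2 x); first by rewrite W2 // => Bx; left; right.
      by rewrite W0 // => Bx; right.
    by move=> [[[x1]|[x2]]|[[x1 x2]]] Bx; [rewrite W1|rewrite W2|rewrite W0].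
  have ms : measurable (sr @^-1` B).
    by rewrite -[X in measurable X]setTI; exact: measurable_reindex.
  have mt : measurable (tr @^-1` B).
    by rewrite -[X in measurable X]setTI; exact: measurable_reindex.
  apply: measurableU; first by apply: measurableU; exact: measurableI.
  by apply: measurableI => //; apply: measurableI; exact: measurableC.
have WK : involutive W.
  move=> x; have [x1|x1] := pselect (D1 x).
    by rewrite (W1 x) // W2 //; exact/D12.
  have [x2|x2] := pselect (D2 x); last by rewrite !W0.
  by rewrite (W2 x) // W1 //; exact: D21.
have [fW imW] : in_full_group (sft A) (sym_rel A) W /\ forall B, W @` B = W @^-1` B.
  apply: involution_full_group => // x xA.
  have [x1|x1] := pselect (D1 x).
    rewrite W1 //; have sx : sft A (sr x) by apply/s2/D12.
    by split => //; exact: (finite_perm_rel fst xA sx).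
  have [x2|x2] := pselect (D2 x).
    rewrite W2 //; have tx : sft A (tr x) by apply/s1/D21.
    by split => //; exact: (finite_perm_rel (finite_perm_sym fst) xA tx).
  rewrite W0 //; split => //; exact: (@finite_perm_rel A id id 0).
rewrite -(mu_inv fW m1 s1); congr (mu _); rewrite imW; apply/seteqP; split => x /=.
  have [x1|x1] := pselect (D1 x).
    by rewrite W1 // => h; case: (disj (sr x) h); apply/D12.
  by have [x2|x2] := pselect (D2 x) => //; rewrite W0.
by move=> x2; rewrite W2 //; exact: D21.
Qed.

(* Splitting according to the letters [x k] and [x (s k)], for [k] in the
   support of [s], makes a set and its image disjoint or equal. *)
Lemma perm_invariant_on (K : seq int) (D1 D2 : set X) :
  measurable D1 -> measurable D2 -> D1 `<=` sft A -> D2 `<=` sft A ->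
  (forall x, D1 x <-> D2 (reindex s x)) ->
  (forall x k, D1 x -> k \notin K -> x k = x (s k)) -> mu D1 = mu D2.
Proof.
elim: K D1 D2 => [|k K IH] D1 D2 m1 m2 s1 s2 D12 DK.
  congr (mu _); apply/seteqP; split => x Dx.
    suff -> : x = reindex s x by apply/D12.
    by apply/funext => j; exact: DK.
  have h : D1 (tr x) by apply/D12; rewrite -/(sr _) trK.
  suff <- : tr x = x by [].
  by rewrite -[RHS]trK; apply/funext => j; exact: DK.
(* [reindex s x] has the letter [x k] at [t k] and the letter [x (s k)] at [k], so the pieces of
   [D1] and [D2] correspond. *)
rewrite (measure_coord mu k m1) (measure_coord mu (t k) m2).
apply: eq_bigr => a _.
have m1a : measurable (D1 `&` [set x | x k = a]).
  by apply: measurableI => //; exact: measurable_coord.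
have m2a : measurable (D2 `&` [set x | x (t k) = a]).
  by apply: measurableI => //; exact: measurable_coord.
rewrite (measure_coord mu (s k) m1a) (measure_coord mu k m2a).
apply: eq_bigr => b _.
set F1 : set X := _ `&` [set x | x (s k) = b]; set F2 : set X := _ `&` [set x | x k = b].
have mF1 : measurable F1 by apply: measurableI => //; exact: measurable_coord.
have mF2 : measurable F2 by apply: measurableI => //; exact: measurable_coord.
have sF1 : F1 `<=` sft A by move=> x [[/s1]].
have sF2 : F2 `<=` sft A by move=> x [[/s2]].
have F12 x : F1 x <-> F2 (reindex s x).
  rewrite /F1 /F2 /reindex /=; split => -[[] /D12 d];
  by rewrite (fpermKV fst) => *.
(* Distinct letters at [k] make the pieces disjoint; equal ones mean that [s] does nothing visible
   at [k], which leaves the list. *)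
have [ab|ab] := eqVneq a b; last first.
  apply: perm_invariant_disjoint => // x [[_ /= xa] _] [_ /= xb].
  by rewrite -xa xb eqxx in ab.
apply: IH => // x j [[D1x /= xk] /= xsk] jK.
have [->|jk] := eqVneq j k; first by rewrite xk xsk.
by apply: DK => //; rewrite inE negb_or jk.
Qed.

Lemma perm_invariant (D1 D2 : set X) : measurable D1 -> measurable D2 ->
  D1 `<=` sft A -> D2 `<=` sft A -> (forall x, D1 x <-> D2 (reindex s x)) ->
  mu D1 = mu D2.
Proof.
move=> m1 m2 s1 s2 D12.
apply: (@perm_invariant_on [seq i%:Z - N%:Z | i <- iota 0 (2 * N).+1]) => //.
move=> x k _ kN; rewrite (fperm_out fst) // ltnNge; apply/negP => kN'.
move/negP: kN; apply; apply/mapP; exists (absz (k + N%:Z)%R); last by lia.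
by rewrite mem_iota; lia.
Qed.

End Invariance.

Lemma perm_eq_reindex k u v : perm_eq u v ->
  exists s t N, [/\ finite_perm s t N,
    (forall i, ~~ (k <= i < k + (size u)%:Z) -> s i = i) &
    forall x, cyl k u x <-> cyl k v (reindex s x)].
Proof.
move=> puv; have suv : size u = size v by exact: perm_size.
have [Is pIs vE] : exists2 Is, perm_eq Is (iota 0 (size u)) & v = map (nth ord0 u) Is.
  by apply/(perm_iotaP ord0); rewrite perm_sym.
have sIs : size Is = size u by rewrite (perm_size pIs) size_iota.
have uIs : uniq Is by rewrite (perm_uniq pIs) iota_uniq.
have mIs i : (i \in Is) = (i < size u)%N by rewrite (perm_mem pIs) mem_iota.
pose s i : int := if k <= i < k + (size u)%:Z then k + (nth 0%N Is `|i - k|)%:Z else i.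
pose t i : int := if k <= i < k + (size u)%:Z then k + (index `|i - k|%N Is)%:Z else i.
have nIs i : (i < size u)%N -> (nth 0%N Is i < size u)%N.
  by move=> iu; rewrite -mIs mem_nth // sIs.
have xIs i : (i < size u)%N -> (index i Is < size u)%N.
  by move=> iu; rewrite -sIs index_mem mIs.
exists s, t, (`|k| + size u)%N; split.
- split.
  + move=> i; rewrite /s; case: ifPn => ki; last by rewrite /t (negbTE ki).
    have iu : (`|i - k| < size u)%N by lia.
    rewrite /t; have -> : k <= k + (nth 0%N Is `|i - k|)%:Z < k + (size u)%:Z.
      by have := nIs _ iu; lia.
    have -> : absz (k + (nth 0%N Is `|i - k|)%:Z - k)%R = nth 0%N Is `|i - k| by lia.
    by rewrite index_uniq ?sIs //; lia.
  + move=> i; rewrite /t; case: ifPn => ki; last by rewrite /s (negbTE ki).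
    have iu : (`|i - k| < size u)%N by lia.
    rewrite /s; have -> : k <= k + (index `|i - k|%N Is)%:Z < k + (size u)%:Z.
      by have := xIs _ iu; lia.
    have -> : absz (k + (index `|i - k|%N Is)%:Z - k)%R = index `|i - k|%N Is by lia.
    by rewrite nth_index ?mIs //; lia.
  + by move=> i ki; rewrite /s ifN //; move: ki; clear; lia.
- by move=> i ki; rewrite /s ifN.
- move=> x; have sE i : (i < size u)%N -> s (k + i%:Z) = k + (nth 0%N Is i)%:Z.
    move=> iu; have ki : k <= k + i%:Z < k + (size u)%:Z by lia.
    by rewrite /s ki; have -> : absz (k + i%:Z - k)%R = i by lia.
  have vn i : (i < size u)%N -> nth ord0 v i = nth ord0 u (nth 0%N Is i).
    by move=> iu; rewrite vE (nth_map 0%N) ?sIs.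
  split=> cx; apply: cylP => i.
    rewrite -suv => iu; rewrite /reindex sE // vn // (cylE cx).
      by congr nth; lia.
    by have := nIs _ iu; lia.
  move=> iu; have ju := xIs _ iu.
  have nj : nth 0%N Is (index i Is) = i by rewrite nth_index ?mIs.
  have := cylE cx (i := k + (index i Is)%:Z); rewrite /reindex sE // nj -suv => ->; last by lia.
  by rewrite (_ : absz _ = index i Is) ?vn ?nj //; lia.
Qed.

Lemma agree_off_overwrite N x y : agree_off N x y ->
  y = overwrite (- N%:Z) (central_word N y) x.
Proof.
move=> xy; symmetry; apply: eq_overwrite; first exact: cyl_word.
by move=> j; rewrite size_word => jN; rewrite xy //; lia.
Qed.

Lemma sym_relP A x y : sym_rel A (x, y) <-> [/\ sft A x, sft A y &
  exists N, agree_off N x y /\ perm_eq (central_word N x) (central_word N y)].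
Proof.
split=> [[/= xA yA [s [bs fs ys]]]|[xA yA [N [xy pxy]]]]; split => //.
  have /finite_seqP[K KE] := fs.
  pose N := (\sum_(i <- K) `|i|)%N.
  have out i : (N < `|i|)%N -> s i = i.
    move=> Ni; apply: contrapT => si; have : [set` K] i by rewrite -KE.
    by move=> /= iK; move: Ni; rewrite /N (big_rem i) //= ltnNge leq_addr.
  exists N; split; first by move=> i Ni; rewrite ys out.
  pose J := [seq - N%:Z + i%:Z | i <- iota 0 (2 * N).+1].
  have wJ z : central_word N z = [seq z i | i <- J] by rewrite /J -map_comp.
  have mJ i : (i \in J) = (`|i| <= N)%N.
    apply/mapP/idP => [[j]|iN]; first by rewrite mem_iota => + ->; lia.
    by exists (absz (i + N%:Z)%R); [rewrite mem_iota; lia|lia].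
  have uJ : uniq J by rewrite map_inj_uniq ?iota_uniq // => i j; lia.
  have sinj := bij_inj bs.
  have -> : central_word N y = [seq x i | i <- [seq s i | i <- J]].
    by rewrite wJ -map_comp; apply: eq_map => i /=; rewrite ys.
  rewrite wJ; apply: perm_map; apply: uniq_perm => //.
    by rewrite (map_inj_uniq sinj).
  (* A point sent outside the window would have an image fixed by [s], hence equal to the point
     itself by injectivity. *)
  have sub : {subset [seq s i | i <- J] <= J}.
    move=> _ /mapP[i iJ ->]; rewrite mJ leqNgt; apply/negP => /[dup] si.
    by move=> /out /sinj E; move: iJ; rewrite mJ -E leqNgt si.
  have [||_ E] := uniq_min_size _ sub; rewrite ?size_map ?(map_inj_uniq sinj) //.
have [s [t [M [fst sout hs]]]] := perm_eq_reindex (- N%:Z) pxy.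
have ysx : y = reindex s x.
  rewrite [LHS](agree_off_overwrite xy); apply: eq_overwrite.
    by apply/hs; exact: cyl_word.
  by move=> j; rewrite size_word => jN; rewrite /reindex sout // size_word.
by rewrite ysx in yA *; have [] := finite_perm_rel fst xA yA.
Qed.

End Permutations.

(** * Shift-invariant tail-trivial measures and block exchange *)

Section Saturation.
Variable n : nat.
Local Notation X := (fullshift n).
Local Notation I := 'I_n.+1.
Variables (A : 'M[nat]_n.+1) (P : rel (seq I)) (E : set (X * X)).
Hypothesis EP : forall x y, E (x, y) <-> [/\ sft A x, sft A y &
  exists N, agree_off N x y /\ P (central_word N x) (central_word N y)].

(** The points with central word [v] that are related to a point of [B] with central word [u]: a
    preimage under overwriting. Countably many such pieces make the saturation measurable. [P] is
    trivial for [gibbs_rel] and [perm_eq] for [sym_rel]. *)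
Definition saturation_piece (B : set X) (p : nat * seq I * seq I) : set X :=
  let: (N, u, v) := p in
  if [&& P u v, size u == (2 * N).+1 & size v == (2 * N).+1] then
    sft A `&` cyl (- N%:Z) v `&` overwrite (- N%:Z) u @^-1` (B `&` sft A)
  else set0.

Lemma saturation_pieces B : saturation E B = \bigcup_p saturation_piece B p.
Proof.
apply/seteqP; split => y.
  move=> [x Bx /EP[xA yA [N [xy Pxy]]]].
  exists (N, central_word N x, central_word N y) => //.
  rewrite /saturation_piece Pxy !size_word !eqxx; split; first by split => //; exact: cyl_word.
  suff xE : overwrite (- N%:Z) (central_word N x) y = x by rewrite /preimage /mkset xE.
  apply: eq_overwrite; first exact: cyl_word.
  by move=> j; rewrite size_word => jN; apply: xy; lia.
move=> [[[N u] v] _] /=; case: ifP => // /and3P[Puv /eqP su /eqP sv] [[yA vy] [Bx xA]].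
exists (overwrite (- N%:Z) u y) => //; apply/EP; split => //; exists N; split.
  by move=> i Ni; rewrite overwrite_out // su; lia.
move: (cyl_overwrite (- N%:Z) u y) vy; rewrite /cyl /= su sv /central_word => -> ->.
exact: Puv.
Qed.

Lemma measurable_saturation_piece B p : measurable B -> measurable (saturation_piece B p).
Proof.
move: p => [[N u] v] mB /=; case: ifP => // _.
apply: measurableI; first by apply: measurableI; [exact: measurable_sft|exact: measurable_cyl].
rewrite -[X in measurable X]setTI; apply: measurable_overwrite => //.
by apply: measurableI => //; exact: measurable_sft.
Qed.

Lemma measurable_saturation B : measurable B -> measurable (saturation E B).
Proof.
move=> mB; rewrite saturation_pieces; apply: measurable_bigcup_countable => p.
exact: measurable_saturation_piece.
Qed.

End Saturation.

(** * Shift-invariance and recurrence *)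

Section Shift.
Variable n : nat.
Local Notation X := (fullshift n).
Local Notation I := 'I_n.+1.
Implicit Types (x y : X) (k : int) (L N j : nat) (w u v : seq I).

Lemma iter_shift j x : iter j (shift_pow 1) x = shift_pow j%:Z x.
Proof.
apply/funext => i; elim: j x i => [|j IH] x i; first by rewrite /shift_pow addr0.
by rewrite iterSr IH /shift_pow; congr x; lia.
Qed.

Lemma measurable_shift k (B : set X) : measurable B -> measurable (shift_pow k @^-1` B).
Proof.
move=> mB; have := @measurable_reindex n (fun i => i + k) measurableT B mB.
by rewrite setTI.
Qed.

Lemma window_set_shift k L (l : int) (B : set X) : window_set k L B ->
  window_set (k + l) L (shift_pow l @^-1` B).
Proof.
move=> wB x y xy; apply: wB => i ki; rewrite /shift_pow; apply: xy; lia.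
Qed.

Variables (R : realType) (mu : probability X R).
Hypothesis mu_shift : shift_invariant mu.

Lemma shift_invariant_nat j B : measurable B -> mu (shift_pow j%:Z @^-1` B) = mu B.
Proof.
move=> mB; have := @iter_preserves _ _ R mu (shift_pow 1) _ mu_shift j B mB.
move=> <-; last by move=> _ C mC; rewrite setTI; exact: measurable_shift.
by congr (mu _); apply/seteqP; split => x /=; rewrite iter_shift.
Qed.

Lemma shift_invariant_int k B : measurable B -> mu (shift_pow k @^-1` B) = mu B.
Proof.
case: k => j mB; first exact: shift_invariant_nat.
rewrite -(shift_invariant_nat j.+1); last exact: measurable_shift.
congr (mu _); apply/seteqP; split => x /=;
by rewrite (_ : shift_pow _ _ = x) //; apply/funext => i; rewrite /shift_pow; congr x; lia.
Qed.

Definition tail_trivial := forall B, measurable B ->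
  (forall N x y, agree_off N x y -> B x -> B y) -> mu B = 0%E \/ mu B = 1%E.

Hypothesis mu_tail : tail_trivial.

Lemma shift_ergodic k L (D V : set X) : measurable D -> window_set k L V ->
  N%:R^-1 * \sum_(j < N) fine (mu (D `&` shift_pow j%:Z @^-1` V)) @[N --> \oo]
    --> fine (mu D) * fine (mu V).
Proof.
move=> mD wV.
have h := @mean_ergodic _ _ R mu (shift_pow 1) V (fun x y => exists N, agree_off N x y)
  _ mu_shift (measurable_window_set wV) _ _ D mD.
have E N : \sum_(j < N) fine (mu (D `&` shift_pow j%:Z @^-1` V)) =
    \sum_(j < N) fine (mu (D `&` iter j (shift_pow 1) @^-1` V)).
  apply: eq_bigr => j _; congr (fine (mu (_ `&` _))).
  by apply/seteqP; split => x /=; rewrite iter_shift.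
under eq_fun do rewrite E; apply: h.
- by move=> _ C mC; rewrite setTI; exact: measurable_shift.
- move=> x y [N xy]; exists (`|k| + N).+1%N => j jN; rewrite !iter_shift.
  by split; apply: wV => i ki; rewrite /shift_pow xy //; lia.
- move=> B mB hB; apply: mu_tail => // N x y xy; apply: (hB x y _).1.
  by exists N.
Qed.

(** Otherwise the averages from [J] on would vanish, whereas their limit is the nonzero product of
    the two measures. *)
Lemma shift_ergodic_meet k L (D V : set X) J : measurable D -> window_set k L V ->
  mu D != 0%E -> mu V != 0%E ->
  exists2 j, (J <= j)%N & mu (D `&` shift_pow j%:Z @^-1` V) != 0%E.
Proof.
move=> mD wV D0 V0; apply: contrapT => no.
have wV' := @window_set_shift k L J%:Z V wV.
have h := shift_ergodic mD wV'; rewrite shift_invariant_nat in h; last first.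
  exact: measurable_window_set wV.
have z j : fine (mu (D `&` shift_pow j%:Z @^-1` (shift_pow J%:Z @^-1` V))) = 0.
  apply/eqP/negPn/negP => ne; apply: no; exists (J + j)%N; first exact: leq_addr.
  apply: contra ne => /eqP E; rewrite (_ : _ @^-1` _ = shift_pow (J + j)%N%:Z @^-1` V) ?E //.
  apply/seteqP; split => x /=;
  by rewrite (_ : shift_pow _ (shift_pow _ x) = shift_pow (J + j)%N%:Z x) //;
    apply/funext => i; rewrite /shift_pow; congr x; lia.
have {}h : (fun=> 0 : R) @ \oo --> fine (mu D) * fine (mu V).
  by apply: cvg_trans h; apply: near_eq_cvg; apply: nearW => N; rewrite big1 ?mulr0.
have /eqP : fine (mu D) * fine (mu V) = 0.
  by rewrite -(cvg_lim (@Rhausdorff R) h); exact: (cvg_lim (@Rhausdorff R) (cvg_cst 0)).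
rewrite mulf_eq0 => /orP[] /eqP E.
- by move: D0; rewrite -[mu D]fineK ?fin_num_measure // E eqxx.
- move: V0; rewrite -[mu V]fineK ?fin_num_measure ?E ?eqxx //.
  exact: measurable_window_set wV.
Qed.

End Shift.

(** * The exchange relation *)

Section Exchange.
Variable n : nat.
Local Notation X := (fullshift n).
Local Notation I := 'I_n.+1.
Implicit Types (x y : X) (k : int) (L N j l g : nat) (w u v : seq I).

(* Exchanges a block on [0 .. l] with a block of length [l' + 1] that follows
   it after a gap of length [g]. *)
Definition block_exchange l l' g (i : int) : int :=
  if 0 <= i <= l'%:Z then i + (l + 1 + g)%N%:Z
  else if l'%:Z < i < (l' + 1 + g)%N%:Z then i - l'%:Z + l%:Z
  else if (l' + 1 + g)%N%:Z <= i <= (l' + 1 + g + l)%N%:Z then i - (l' + 1 + g)%N%:Z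
  else i.

Lemma block_exchangeK l l' g : cancel (block_exchange l l' g) (block_exchange l' l g).
Proof.
move=> i; rewrite {2}/block_exchange.
by do ![case: ifPn => ?]; rewrite /block_exchange; do ![case: ifPn => ?]; lia.
Qed.

Lemma block_exchange_head l l' g i : 0 <= i <= l'%:Z ->
  block_exchange l l' g i = i + (l + 1 + g)%N%:Z.
Proof. by rewrite /block_exchange => ->. Qed.

Lemma block_exchange_neg l l' g i : i < 0 -> block_exchange l l' g i = i.
Proof. by move=> i0; rewrite /block_exchange; do ![case: ifPn => ?]; lia. Qed.

Lemma finite_perm_block_exchange l l' g :
  finite_perm (block_exchange l l' g) (block_exchange l' l g) (l + l' + 1 + g).
Proof.
split; try exact: block_exchangeK.
by move=> i; rewrite /block_exchange; repeat (case: ifPn => ?); lia.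
Qed.

Lemma sft_block_exchange A l l' g x : sft A x ->
  x 0 = x (l + 1 + g)%N%:Z -> x l%:Z = x (l + 1 + g + l')%N%:Z ->
  sft A (reindex (block_exchange l l' g) x).
Proof.
move=> xA x0 xl i; set s := block_exchange l l' g.
(* A transition is legal once its letters occur at consecutive places of [x]. At each seam one index
   is replaced by the matching end of the other block, which carries the same letter. *)
have ends c a b : s a = c \/ x (s a) = x c -> s b = c + 1 \/ x (s b) = x (c + 1) ->
    A (x (s a)) (x (s b)) = 1%N.
  by move=> [->|->] [->|->]; exact: xA.
rewrite /reindex.
have s1 k : 0 <= k <= l'%:Z -> s k = k + (l + 1 + g)%N%:Z.
  by rewrite /s /block_exchange; do ![case: ifPn => ?]; lia.
have s3 k : (l' + 1 + g)%N%:Z <= k <= (l' + 1 + g + l)%N%:Z ->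
    s k = k - (l' + 1 + g)%N%:Z.
  by rewrite /s /block_exchange; do ![case: ifPn => ?]; lia.
have s0 : s 0 = (l + 1 + g)%N%:Z by rewrite s1; lia.
have sl' : s l'%:Z = (l + 1 + g + l')%N%:Z by rewrite s1; lia.
have sg : s (l' + 1 + g)%N%:Z = 0 by rewrite s3; lia.
have sl : s (l' + 1 + g + l)%N%:Z = l%:Z by rewrite s3; lia.
have s2 k : l'%:Z < k < (l' + 1 + g)%N%:Z -> s k = k - l'%:Z + l%:Z.
  by rewrite /s /block_exchange; do ![case: ifPn => ?]; lia.
have s4 k : k < 0 \/ (l' + 1 + g + l)%N%:Z < k -> s k = k.
  by rewrite /s /block_exchange; do ![case: ifPn => ?]; lia.
(* The seams are at -1, [l'], [l' + g] and [l' + 1 + g + l]; for [g = 0] the middle two coincide. *)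
have [->|i1] := eqVneq i (-1).
  apply: (ends (-1)); last by right; rewrite addNr s0 x0.
  by left; rewrite s4; lia.
have [->|i2] := eqVneq i l'%:Z.
  apply: (ends l%:Z); first by right; rewrite sl' xl.
  have [g0|g0] := posnP g.
    right; rewrite (_ : l'%:Z + 1 = (l' + 1 + g)%N%:Z) ?sg ?x0; last by lia.
    by congr x; lia.
  by left; rewrite s2; lia.
have [i3|i3] := eqVneq i (l' + g)%N%:Z.
  have g0 : (0 < g)%N by lia.
  rewrite i3.
  apply: (ends (l + g)%N%:Z); first by left; rewrite s2; lia.
  right; rewrite (_ : (l' + g)%N%:Z + 1 = (l' + 1 + g)%N%:Z) ?sg ?x0; last by lia.
  by congr x; lia.
have [->|i4] := eqVneq i (l' + 1 + g + l)%N%:Z.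
  apply: (ends (l' + 1 + g + l)%N%:Z).
    by right; rewrite sl xl; congr x; lia.
  by left; rewrite s4; lia.
apply: (ends (s i)); left => //.
by rewrite /s /block_exchange; do ![case: ifPn => ?]; lia.
Qed.

Section ExchangeTheorem.
Variables (R : realType) (mu : probability X R) (A : 'M[nat]_n.+1).
Hypothesis mu_sft : mu (sft A) = 1%E.
Hypothesis mu_shift : shift_invariant mu.
Hypothesis mu_tail : tail_trivial mu.
Hypothesis mu_inv : rel_invariant (sft A) (sym_rel A) mu.

Lemma measure_sftI (B : set X) : measurable B -> mu (B `&` sft A) = mu B.
Proof.
move=> mB; have mA := measurable_sft A.
have -> : mu B = (mu (B `\` sft A) + mu (B `&` sft A))%E by exact: measureDI.
rewrite (_ : mu (B `\` sft A) = 0%E) ?add0e //.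
apply/eqP; rewrite eq_le measure_ge0 andbT.
have <- : mu (~` sft A) = 0%E.
  by rewrite probability_setC // mu_sft subee.
apply: le_measure; last by move=> x [].
  by rewrite inE; exact: measurableD.
by rewrite inE; exact: measurableC.
Qed.

(** For every gap [g >= G] the block exchange maps [U] at 0, [V] after the gap and [D] onto the
    configuration with [U] and [V] interchanged, so these have the same measure. Averaging over the
    gaps decouples the far block. *)
Theorem exchange a b l l' (U V D : set X) :
  window_set 0 l.+1 U -> window_set 0 l'.+1 V -> measurable D ->
  (forall x, U x -> x 0 = a /\ x l%:Z = b) ->
  (forall x, V x -> x 0 = a /\ x l'%:Z = b) ->
  (exists G, forall g, (G <= g)%N -> forall x, sft A x -> U x ->
     V (shift_pow (l + 1 + g)%N%:Z x) ->
     D x <-> D (reindex (block_exchange l l' g) x)) ->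
  fine (mu (U `&` D)) * fine (mu V) = fine (mu (V `&` D)) * fine (mu U).
Proof.
move=> wU wV mD Uab Vab [G hG].
have mU := measurable_window_set wU; have mV := measurable_window_set wV.
pose T m g (P Q : set X) : set X :=
  P `&` shift_pow (m + 1 + g)%N%:Z @^-1` Q `&` sft A.
have forw m m' g (P Q : set X) x : window_set 0 m.+1 P -> window_set 0 m'.+1 Q ->
    (forall x, P x -> x 0 = a /\ x m%:Z = b) ->
    (forall x, Q x -> x 0 = a /\ x m'%:Z = b) ->
    T m g P Q x -> T m' g Q P (reindex (block_exchange m m' g) x).
  move=> wP wQ Pab Qab [[Px Qx] xA]; have [x0 xm] := Pab _ Px.
  have [] := Qab _ Qx; rewrite /shift_pow add0r => x0' xm'; split; first split.
  - apply: wQ Qx => i ki; rewrite /shift_pow /reindex /block_exchange.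
    by rewrite ifT //; lia.
  - apply: wP Px => i ki; rewrite /preimage /shift_pow /reindex /block_exchange.
    by congr x; do ![case: ifPn => ?]; lia.
  - apply: sft_block_exchange => //; first by rewrite x0 -x0'.
    by rewrite xm -xm'; congr x; lia.
have E g : (G <= g)%N -> mu (U `&` D `&` shift_pow (l + 1 + g)%N%:Z @^-1` V) =
    mu (V `&` D `&` shift_pow (l' + 1 + g)%N%:Z @^-1` U).
  move=> Gg; have mA := measurable_sft A.
  have mUV : measurable (U `&` D `&` shift_pow (l + 1 + g)%N%:Z @^-1` V).
    by apply: measurableI; [exact: measurableI|exact: measurable_shift].
  have mVU : measurable (V `&` D `&` shift_pow (l' + 1 + g)%N%:Z @^-1` U).
    by apply: measurableI; [exact: measurableI|exact: measurable_shift].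
  rewrite -(measure_sftI mUV) -(measure_sftI mVU).
  apply: (perm_invariant mu_inv (finite_perm_block_exchange l l' g)).
  - exact: measurableI.
  - exact: measurableI.
  - by move=> x [].
  - by move=> x [].
  move=> x; split.
    move=> [[[Ux Dx] Vx] xA].
    have [[Vy Uy] yA] := forw l l' g U V x wU wV Uab Vab (conj (conj Ux Vx) xA).
    by split => //; split => //; split => //; apply/(hG g Gg x).
  set y := reindex _ x; move=> [[[Vy Dy] Uy] yA].
  have := forw l' l g V U y wV wU Vab Uab (conj (conj Vy Uy) yA).
  have -> : reindex (block_exchange l' l g) y = x.
    by apply/funext => i; rewrite /y /reindex block_exchangeK.
  move=> [[Ux Vx] xA].
  by split => //; split => //; split => //; apply/(hG g Gg x).
(* The offsets start both averages at gap [G], so that their [j]-th terms are the two sides of [E]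
   at gap [G + j]. *)
have lim1 := @shift_ergodic _ _ _ mu_shift mu_tail _ _ (U `&` D) _
  (measurableI _ _ mU mD) (@window_set_shift _ _ _ (l + 1 + G)%N%:Z _ wV).
have lim2 := @shift_ergodic _ _ _ mu_shift mu_tail _ _ (V `&` D) _
  (measurableI _ _ mV mD) (@window_set_shift _ _ _ (l' + 1 + G)%N%:Z _ wU).
rewrite !shift_invariant_int // in lim1 lim2.
suff EE : (fun N : nat => N%:R^-1 * \sum_(j < N) fine (mu (U `&` D `&`
      shift_pow j%:Z @^-1` (shift_pow (l + 1 + G)%N%:Z @^-1` V)))) =
    (fun N : nat => N%:R^-1 * \sum_(j < N) fine (mu (V `&` D `&`
      shift_pow j%:Z @^-1` (shift_pow (l' + 1 + G)%N%:Z @^-1` U)))).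
  rewrite EE in lim1.
  by rewrite -(cvg_lim (@Rhausdorff R) lim1) (cvg_lim (@Rhausdorff R) lim2).
have sh (m : nat) j (B : set X) : shift_pow j%:Z @^-1` (shift_pow (m + 1 + G)%N%:Z @^-1` B) =
    shift_pow (m + 1 + (G + j))%N%:Z @^-1` B.
  apply/seteqP; split => x /=;
  by rewrite (_ : shift_pow _ (shift_pow _ x) = shift_pow (m + 1 + (G + j))%N%:Z x) //;
    apply/funext => i; rewrite /shift_pow; congr x; lia.
apply/funext => N; congr (_ * _); apply: eq_bigr => j _.
by rewrite !sh E // leq_addr.
Qed.

End ExchangeTheorem.
End Exchange.

(** * The swap rule and Gibbs measures *)

Section GibbsSpecification.
Variables (R : realType) (n : nat) (A : 'M[nat]_n.+1) (wt : 'I_n.+1 -> R).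
Local Notation X := (fullshift n).
Local Notation I := 'I_n.+1.
Hypothesis wt_gt0 : forall i, 0 < wt i.
Hypothesis A01 : zero_one A.
Hypothesis Aia : irreducible_aperiodic_sft A.
Implicit Types (x y : X) (k : int) (L N : nat) (w u v : seq I) (mu nu : probability X R).

Lemma allowed_step i j : allowed A i j -> step A i j.
Proof. by move=> /and3P[+ _ _]; rewrite /step; case: (A01 i j) => ->. Qed.

Lemma sft_symbols x k : sft A x -> x k \in symbols A.
Proof.
move=> xA; rewrite inE; apply/andP; split; apply/existsP.
  by exists (x (k + 1)); rewrite xA.
by exists (x (k - 1)); have := xA (k - 1); rewrite subrK => ->.
Qed.

Lemma sft_allowed x k : sft A x -> allowed A (x k) (x (k + 1)).
Proof. by move=> xA; rewrite /allowed !sft_symbols // andbT xA. Qed.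

Lemma allowed_cyl x k a w : sft A x -> cyl k (a :: w) x ->
  (a \in symbols A) && path (allowed A) a w.
Proof.
move=> xA; rewrite cyl_cons => -[/= <- wx]; rewrite sft_symbols //=.
have := @path_word n (allowed A) x k (size w); rewrite wx; apply.
by move=> i _; exact: sft_allowed.
Qed.

(** Relative to a set [B], because the uniqueness argument is also applied to [mu] restricted to
    [B]. *)
Definition gibbs_swap mu (B : set X) := forall k a u v,
  a \in symbols A -> path (allowed A) a u -> path (allowed A) a v ->
  size u = size v -> last a u = last a v ->
  fine (mu (B `&` cyl k (a :: u))) * weight wt v =
  fine (mu (B `&` cyl k (a :: v))) * weight wt u.

Lemma measure_specification mu (B : set X) : mu (sft A) = 1%E -> measurable B ->
  gibbs_swap mu B ->
  specification [in symbols A] (allowed A) wt (fun k w => fine (mu (B `&` cyl k w))).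
Proof.
move=> muA mB sw; have mBc k w : measurable (B `&` cyl k w).
  by apply: measurableI => //; exact: measurable_cyl.
have split k w l : fine (mu (B `&` cyl k w)) =
    \sum_b fine (mu (B `&` cyl k w `&` [set x | x l = b])).
  rewrite [in LHS](measure_coord mu l (mBc k w)) -sum_fine // => b _.
  by rewrite fin_num_measure //; apply: measurableI => //; exact: measurable_coord.
split => //.
- by move=> k w; exact: fine_ge0.
- move=> k w; rewrite (split _ _ (k + (size w)%:Z)); apply: eq_bigr => b _.
  by rewrite cyl_rcons setIA.
- move=> k w; rewrite (split _ _ (k - 1)); apply: eq_bigr => b _.
  by rewrite cyl_cons subrK -setIA [cyl k w `&` _]setIC.
- move=> k a w nS; rewrite -(measure_sftI muA) //.
  rewrite (_ : _ `&` sft A = set0) ?measure0 //.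
  apply/seteqP; split => // x [[_ wx] xA].
  by rewrite (allowed_cyl xA wx) in nS.
Qed.

Lemma specificationZ (S : pred I) (e : rel I) (f : int -> seq I -> R) c : 0 <= c ->
  specification S e wt f -> specification S e wt (fun k w => c * f k w).
Proof.
move=> c0 sf; split.
- by move=> k w; rewrite mulr_ge0 // (spec_ge0 sf).
- by move=> k w; rewrite (spec_right sf) mulr_sumr.
- by move=> k w; rewrite (spec_left sf) mulr_sumr.
- by move=> k a w h; rewrite (spec_supp sf) ?mulr0.
- by move=> k a u v Sa pu pv su lu; rewrite -!mulrA (spec_swap sf k Sa pu pv su lu).
Qed.

(** [mu] restricted to [B] and [nu] scaled by [mu B] are specifications with the same total mass. *)
Lemma gibbs_proportional mu nu (B : set X) :
  mu (sft A) = 1%E -> nu (sft A) = 1%E -> measurable B ->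
  gibbs_swap mu B -> gibbs_swap nu setT ->
  forall C, measurable C -> (mu (B `&` C) = mu B * nu C)%E.
Proof.
move=> muA nuA mB swB swT.
have [irr aper] := (irreducible_aperiodic_sftP A).1 Aia.
have [r r0 mix] := exists_mixing_time irr aper.
have eS i j : allowed A i j -> j \in symbols A by case/and3P.
have sB := measure_specification muA mB swB.
have sT := measure_specification nuA measurableT swT.
have c0 : 0 <= fine (mu B) by exact: fine_ge0.
have U := spec_unique wt_gt0 eS r0 mix sB (specificationZ c0 sT).
have {}U k w : mu (B `&` cyl k w) = (mu B * nu (cyl k w))%E.
  have mc := measurable_cyl k w.
  rewrite -[LHS]fineK ?fin_num_measure //; last exact: measurableI.
  rewrite -[mu B]fineK ?fin_num_measure // -[nu _]fineK ?fin_num_measure // -EFinM.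
  rewrite U ?setTI // => l; rewrite !cyl0 setIT setTI.
  by rewrite probability_setT mulr1.
pose c : {nonneg R} := NngNum c0.
move=> C mC.
have E1 (D : set X) : mrestr mu mB D = mu (B `&` D) by rewrite /mrestr setIC.
have E2 (D : set X) : mscale c nu D = (mu B * nu D)%E.
  by rewrite /mscale /= fineK ?fin_num_measure.
have h : mrestr mu mB C = mscale c nu C.
  apply: (@eq_measure_cyl n R (mrestr mu mB) (mscale c nu) 0) => //=.
    by rewrite E1; apply: le_lt_trans (probability_le1 mu _) _; rewrite ?setIT ?ltry.
  by move=> N w _ _; rewrite E1 E2 U.
by rewrite -E1 -E2.
Qed.

Lemma gibbs_zero_one mu (B : set X) : mu (sft A) = 1%E -> measurable B ->
  gibbs_swap mu setT -> gibbs_swap mu B -> mu B = 0%E \/ mu B = 1%E.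
Proof.
move=> muA mB swT swB; have := gibbs_proportional muA muA mB swB swT mB.
rewrite setIid -[mu B]fineK ?fin_num_measure // -EFinM => -[].
move: (fine _) => b /eqP; rewrite -subr_eq0 -{1}[b]mulr1 -mulrBr mulf_eq0.
by case/orP => [/eqP ->|]; [left|rewrite subr_eq0 => /eqP <-; right].
Qed.

Lemma gibbs_unique mu nu : mu (sft A) = 1%E -> nu (sft A) = 1%E ->
  gibbs_swap mu setT -> gibbs_swap nu setT ->
  forall C, measurable C -> nu C = mu C.
Proof.
move=> muA nuA swm swn C mC.
have := gibbs_proportional muA nuA measurableT swm swn mC.
by rewrite setTI [X in (X * _)%E]probability_setT mul1e.
Qed.

End GibbsSpecification.

Section Energy.
Variables (R : realType) (n : nat) (phi : 'I_n.+1 -> R).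
Local Notation X := (fullshift n).
Implicit Types (x y : X) (k : int) (L N : nat).

Definition boltzmann (i : 'I_n.+1) : R := expR (phi i).

Lemma boltzmann_gt0 i : 0 < boltzmann i.
Proof. exact: expR_gt0. Qed.

Lemma fsbig_window (F : int -> R) k L :
  (forall j, ~~ (k <= j < k + L%:Z) -> F j = 0) ->
  \sum_(j \in [set: int]) F j = \sum_(i < L) F (k + i%:Z).
Proof.
move=> F0; rewrite (fsbigE [seq k + i%:Z | i <- iota 0 L]) //.
- rewrite big_map -(big_mkord xpredT (fun i : nat => F (k + i%:Z))) /index_iota subn0.
  by apply: eq_bigl => i; rewrite in_setT.
- by rewrite map_inj_uniq ?iota_uniq // => i j /addrI [].
- move=> j _ jr; apply: F0; apply: contra jr => kj; apply/mapP.
  by exists (absz (j - k)%R); [rewrite mem_iota; lia|lia].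
Qed.

Lemma weight_word x k L :
  weight boltzmann (word k L x) = expR (\sum_(i < L) phi (x (k + i%:Z))).
Proof.
rewrite expR_sum /weight /word /mkseq big_map.
by rewrite -(big_mkord xpredT (fun i : nat => expR (phi (x (k + i%:Z))))) /index_iota subn0.
Qed.

Lemma energy_difference x y k L :
  (forall j, ~~ (k <= j < k + L%:Z) -> x j = y j) ->
  \sum_(j \in [set: int]) (phi (x j) - phi (y j)) =
  ln (weight boltzmann (word k L x) / weight boltzmann (word k L y)).
Proof.
move=> xy; rewrite (fsbig_window (k := k) (L := L)); last first.
  by move=> j /xy ->; rewrite subrr.
by rewrite !weight_word -expRN -expRD expRK sumrB.
Qed.

End Energy.

(** * From Gibbs measures to the swap rule *)

Section GibbsMeasure.
Variables (R : realType) (n : nat) (A : 'M[nat]_n.+1).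
Local Notation X := (fullshift n).
Local Notation I := 'I_n.+1.
Implicit Types (x y : X) (k : int) (L N : nat) (w u v : seq I).

Lemma measurable_saturation_gibbs (B : set X) :
  measurable B -> measurable (saturation (gibbs_rel A) B).
Proof.
apply: (@measurable_saturation n A (fun _ _ => true)) => x y.
by rewrite gibbs_relP; split=> -[? ? [N]]; [|case]; split => //; exists N.
Qed.

Lemma measurable_saturation_sym (B : set X) :
  measurable B -> measurable (saturation (sym_rel A) B).
Proof. by apply: (@measurable_saturation n A perm_eq) => x y; exact: sym_relP. Qed.

Variables (phi : I -> R) (k0 : int) (Phi : X -> R) (mu : probability X R).
Hypothesis Phi_phi : forall x, sft A x -> Phi x = phi (x k0).
Hypothesis gibbs : gibbs_measure A Phi mu.
Hypothesis A01 : zero_one A.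
Let wt := boltzmann phi.

Lemma gibbs_sum x y N : sft A x -> sft A y -> agree_off N x y ->
  \sum_(k \in [set: int]) (Phi (shift_pow k x) - Phi (shift_pow k y)) =
  ln (weight wt (central_word N x) / weight wt (central_word N y)).
Proof.
move=> xA yA xy; rewrite -energy_difference; last first.
  by move=> j jN; apply: xy; lia.
have sA z k : sft A z -> sft A (shift_pow k z).
  by move=> zA i; have := zA (i + k); rewrite /shift_pow addrAC.
(* A sum over all integers is unaffected by the choice of the coordinate [k0] that the potential
   reads. *)
rewrite [RHS](reindex_fsbigT (fun j => j + k0)) /=; last first.
  by exists (fun j => j - k0) => j; [rewrite addrK|rewrite subrK].
apply: eq_fsbigr => j _; rewrite (Phi_phi (sA _ j xA)) (Phi_phi (sA _ j yA)).
by rewrite /shift_pow (addrC k0).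
Qed.

(** Where [W] multiplies weights by [c], the derivative is [c] off the exceptional null set; the
    rest of [B] has a null image by quasi-invariance. *)
Lemma gibbs_full_group W (B : set X) (c : R) :
  in_full_group (sft A) (gibbs_rel A) W -> measurable B -> B `<=` sft A ->
  (forall x, B x -> exists N, agree_off N x (W x) /\
     weight wt (central_word N (W x)) = c * weight wt (central_word N x)) ->
  mu (W @` B) = (c%:E * mu B)%E.
Proof.
move=> fW mB sB hB.
have [muA quasi [rho [_ rho0 _ rhoW] [N [N' [mN' N'0 NN']] hN]]] := gibbs.
have [[bij mW imW] EW] := fW.
have mB1 : measurable (B `\` N') by exact: measurableD.
have mB2 : measurable (B `&` N') by exact: measurableI.
have sB1 : B `\` N' `<=` sft A by move=> x [/sB].
have sB2 : B `&` N' `<=` sft A by move=> x [/sB].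
have B20 : mu (B `&` N') = 0%E.
  apply/eqP; rewrite eq_le measure_ge0 andbT -N'0.
  by apply: le_measure; rewrite ?inE // => x [].
have W20 : mu (W @` (B `&` N')) = 0%E.
  apply/eqP; rewrite eq_le measure_ge0 andbT -(quasi _ mB2 B20).
  apply: le_measure; rewrite ?inE; [exact: imW|exact: measurable_saturation_gibbs|].
  by move=> _ [x Bx <-]; exists x => //; apply/EW/sB2.
have W1 : mu (W @` (B `\` N')) = (c%:E * mu (B `\` N'))%E.
  rewrite rhoW // -integral_cst //; apply: eq_integral => x /set_mem [Bx N'x].
  congr EFin; have xE := EW x (sB x Bx).
  have [M [xW hw]] := hB x Bx.
  have Wx : gibbs_rel A (W x, x).
    by apply/gibbs_relP; case: xE => xA WxA _; split => //; exists M => i Mi; rewrite xW.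
  have lnr := hN (W x) x Wx (fun h => N'x (NN' _ h.2)).
  rewrite -[LHS]lnK ?posrE ?rho0 // lnr (@gibbs_sum _ _ M); [|by case: Wx|by case: Wx|by move=> i Mi; rewrite xW].
  have wx0 := weight_gt0 (boltzmann_gt0 phi) (central_word M x).
  rewrite hw mulfK ?gt_eqF // lnK // posrE -(pmulr_lgt0 _ wx0) -hw.
  exact: weight_gt0 (boltzmann_gt0 phi) _.
have BE : B = (B `\` N') `|` (B `&` N') by rewrite setUC setUIDK.
rewrite [in LHS]BE image_setU.
have injW : W @` (B `\` N') `&` W @` (B `&` N') = set0.
  apply/seteqP; split => // _ [[x [Bx N'x] <-] [y [By N'y] E]].
  case: N'x; case: bij => _ inj _.
  by rewrite -(inj _ _ _ _ E) ?inE //; exact: sB.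
have mI1 := imW _ mB1 sB1; have mI2 := imW _ mB2 sB2.
have -> : mu (W @` (B `\` N') `|` W @` (B `&` N')) =
    (mu (W @` (B `\` N')) + mu (W @` (B `&` N')))%E by exact: measureU.
rewrite W1 W20 adde0; congr (_ * _)%E.
have -> : mu B = (mu (B `\` N') + mu (B `&` N'))%E by exact: measureDI.
by rewrite B20 adde0.
Qed.

(** The involution exchanging the blocks [a :: u] and [a :: v] belongs to the full group of the
    Gibbs relation, preserves [B] inside the shift of finite type, and multiplies weights by
    [weight wt v / weight wt u] on the first cylinder. *)
Lemma gibbs_measure_swap (B : set X) : measurable B ->
  (forall N x y, sft A x -> sft A y -> agree_off N x y -> B x -> B y) ->
  gibbs_swap A wt mu B.
Proof.
move=> mB tB k a u v Sa pu pv suv luv.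
have [muA _ _] := gibbs.
have [-> //|uv] := eqVneq u v.
have stepP w : path (allowed A) a w -> path (step A) a w.
  by apply: sub_path => i j; exact: allowed_step.
pose U : set X := sft A `&` cyl k (a :: u); pose V : set X := sft A `&` cyl k (a :: v).
have disj x : U x -> V x -> False.
  move=> [_ +] [_]; rewrite /cyl /= suv => -> [E].
  by rewrite E eqxx in uv.
have mU : measurable U.
  by apply: measurableI; [exact: measurable_sft|exact: measurable_cyl].
have mV : measurable V.
  by apply: measurableI; [exact: measurable_sft|exact: measurable_cyl].
pose W x : X := if x \in U then overwrite k (a :: v) x else
  if x \in V then overwrite k (a :: u) x else x.
have WU x : U x -> W x = overwrite k (a :: v) x by move=> h; rewrite /W mem_set.
have WV x : V x -> W x = overwrite k (a :: u) x.
  by move=> h; rewrite /W (mem_set h) memNset // => /disj; apply.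
have W0 x : ~ U x -> ~ V x -> W x = x by move=> h1 h2; rewrite /W !memNset.
have UV x : U x -> V (overwrite k (a :: v) x).
  move=> [xA ux]; split; last exact: cyl_overwrite.
  exact: sft_overwrite xA ux (stepP _ pv) suv luv.
have VU x : V x -> U (overwrite k (a :: u) x).
  move=> [xA vx]; split; last exact: cyl_overwrite.
  exact: sft_overwrite xA vx (stepP _ pu) (esym suv) (esym luv).
have WK : involutive W.
  move=> x; have [Ux|nUx] := pselect (U x).
    rewrite (WU x Ux) WV; last exact: UV.
    by rewrite overwrite_overwrite ?overwrite_id //= ?suv //; case: Ux.
  have [Vx|nVx] := pselect (V x); last by rewrite !W0.
  rewrite (WV x Vx) WU; last exact: VU.
  by rewrite overwrite_overwrite ?overwrite_id //= ?suv //; case: Vx.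
have off x j : ~~ (k <= j < k + (size (a :: u))%:Z) -> W x j = x j.
  move=> kj; have [Ux|nUx] := pselect (U x).
    by rewrite WU // overwrite_out //; move: kj => /=; rewrite suv.
  by have [Vx|nVx] := pselect (V x); [rewrite WV // overwrite_out|rewrite W0].
have WA x : sft A x -> sft A (W x).
  move=> xA; have [Ux|nUx] := pselect (U x); first by rewrite WU //; case: (UV x Ux).
  by have [Vx|nVx] := pselect (V x); [rewrite WV //; case: (VU x Vx)|rewrite W0].
pose N := (`|k| + size u + 1)%N.
have agr x : agree_off N x (W x) by move=> j Nj; rewrite off //=; lia.
have mW : measurable_fun setT W.
  have mem_fun (Z : set X) : measurable Z -> measurable_fun setT (fun x => x \in Z).
    move=> mZ; apply: (measurable_fun_bool true); rewrite setTI.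
    rewrite (_ : _ @^-1` _ = Z) //; apply/seteqP; split => x /= h.
      exact: set_mem h.
    exact: mem_set.
  apply: measurable_fun_ifT; [exact: mem_fun|exact: measurable_overwrite|].
  by apply: measurable_fun_ifT; [exact: mem_fun|exact: measurable_overwrite|exact: measurable_id].
have [fW imW] : in_full_group (sft A) (gibbs_rel A) W /\ forall C, W @` C = W @^-1` C.
  apply: involution_full_group => // x xA; split; first exact: WA.
  by apply/gibbs_relP; split => //; [exact: WA|exists N].
have mUB : measurable (U `&` B) by exact: measurableI.
have im : W @` (U `&` B) = V `&` B.
  rewrite imW; apply/seteqP; split => x /= [].
    move=> UWx BWx; have Vx : V x.
      by rewrite -(WK x) (WU _ UWx); exact: UV.
    split => //; apply: (tB N (W x) x UWx.1 Vx.1) => // j Nj.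
    by rewrite (agr x j Nj).
  move=> Vx Bx; have UWx : U (W x) by rewrite WV //; exact: VU.
  by split => //; exact: (tB N x (W x) Vx.1 UWx.1 (agr x) Bx).
have wv := weight_gt0 (boltzmann_gt0 phi) u.
have E : mu (V `&` B) = ((weight wt v / weight wt u)%:E * mu (U `&` B))%E.
  rewrite -im; apply: gibbs_full_group => //; first by move=> x [[]].
  move=> x [Ux Bx]; exists N; split; first exact: agr.
  (* [l] and [m] are the numbers of letters of the central word before and after the block. *)
  pose l := absz (k + N%:Z)%R.
  pose m := ((2 * N).+1 - l - (size u).+1)%N.
  have cE z : weight wt (central_word N z) = weight wt (word (- N%:Z) l z) *
      (weight wt (word k (size u).+1 z) * weight wt (word (k + (size u).+1%:Z) m z)).
    rewrite -!weight_cat -word_cat; congr weight.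
    have -> : word k ((size u).+1 + m) z = word (- N%:Z + l%:Z) ((size u).+1 + m) z.
      by congr (word _ _ z); rewrite /l /N; lia.
    by rewrite -word_cat /central_word; congr (word _ _ z); rewrite /m /l /N; lia.
  have e1 : word (- N%:Z) l (W x) = word (- N%:Z) l x.
    by apply: eq_word => i il; apply: off => /=; move: il; rewrite /l /N; lia.
  have e2 : word (k + (size u).+1%:Z) m (W x) = word (k + (size u).+1%:Z) m x.
    by apply: eq_word => i il; apply: off => /=; move: il; lia.
  rewrite !cE e1 e2.
  have -> : word k (size u).+1 (W x) = a :: v.
    by rewrite (WU x Ux) suv; exact: (cyl_overwrite k (a :: v) x).
  have -> : word k (size u).+1 x = a :: u by case: Ux.
  rewrite /weight !big_cons -/(weight wt v) -/(weight wt u).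
  by field; rewrite gt_eqF.
have Uc : mu (B `&` cyl k (a :: u)) = mu (U `&` B).
  rewrite -(measure_sftI muA); last by apply: measurableI => //; exact: measurable_cyl.
  by congr (mu _); rewrite /U setIC [B `&` _]setIC setIA.
have Vc : mu (B `&` cyl k (a :: v)) = mu (V `&` B).
  rewrite -(measure_sftI muA); last by apply: measurableI => //; exact: measurable_cyl.
  by congr (mu _); rewrite /V setIC [B `&` _]setIC setIA.
rewrite Uc Vc E -[mu (U `&` B)]fineK ?fin_num_measure // -EFinM /=.
by field; rewrite gt_eqF.
Qed.

End GibbsMeasure.

(** * Gibbs measures under finite permutations *)

Section ExchangeableSets.
Variables (R : realType) (n : nat) (A : 'M[nat]_n.+1) (mu : probability (fullshift n) R).
Local Notation X := (fullshift n).
Local Notation I := 'I_n.+1.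
Hypothesis mu_sft : mu (sft A) = 1%E.
Hypothesis mu_shift : shift_invariant mu.
Hypothesis mu_tail : tail_trivial mu.
Hypothesis mu_inv : rel_invariant (sft A) (sym_rel A) mu.
Implicit Types (x y : X) (k : int) (L N : nat) (w u v : seq I).

Lemma window_set_cylinder k w : window_set k (size w) (cyl k w).
Proof. by move=> x y xy; rewrite /cyl /= => wx; rewrite -[RHS]wx; apply: eq_word => i ki; rewrite xy. Qed.

Lemma cyl_ends k a u x : cyl k (a :: u) x -> x k = a /\ x (k + (size u)%:Z) = last a u.
Proof.
move=> ux; split; first by move: ux; rewrite cyl_cons => -[].
rewrite (cylE ux); last by rewrite [size (_ :: _)]/=; lia.
rewrite (_ : absz _ = (size (a :: u)).-1) ?nth_last //=; lia.
Qed.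

Lemma shift_pow0 x : shift_pow 0 x = x.
Proof. by apply/funext => i; rewrite /shift_pow addr0. Qed.

Lemma shift_powD k l x : shift_pow k (shift_pow l x) = shift_pow (k + l) x.
Proof. by apply/funext => i; rewrite /shift_pow addrA. Qed.

Lemma cyl_shift k l w x : cyl k w (shift_pow l x) = cyl (k + l) w x.
Proof.
rewrite /cyl /= (_ : word k _ (shift_pow l x) = word (k + l) (size w) x) //.
apply: (@eq_from_nth _ ord0); rewrite !size_word // => i iw.
by rewrite !nth_word // /shift_pow addrAC.
Qed.

Lemma sft_shift k x : sft A x -> sft A (shift_pow k x).
Proof. by move=> xA i; have := xA (i + k); rewrite /shift_pow addrAC. Qed.

Lemma sym_rel_sym x y : sym_rel A (x, y) -> sym_rel A (y, x).
Proof.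
move=> /sym_relP[xA yA [N [xy p]]]; apply/sym_relP; split => //; exists N.
by split; [move=> i Ni; rewrite xy|rewrite perm_sym].
Qed.

Lemma sym_rel_trans x y z : sym_rel A (x, y) -> sym_rel A (y, z) -> sym_rel A (x, z).
Proof.
move=> [/= xA _ [s [bs fs ys]]] [/= _ zA [t [bt ft zt]]]; split => //.
exists (s \o t); split; first exact: bij_comp.
  apply: (@sub_finite_set _ _ ([set k | s k <> k] `|` [set k | t k <> k])).
    move=> k /= st; have [tk|] := eqVneq (t k) k; last by move/eqP; right.
    by left; rewrite tk in st.
  by rewrite finite_setU.
by move=> k /=; have /= -> := zt k; have /= -> := ys (t k).
Qed.

Lemma sym_rel_refl x : sft A x -> sym_rel A (x, x).
Proof.
move=> xA; split => //; exists id; split => //; first by exists id.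
by rewrite (_ : [set _ | _] = set0) //; apply/seteqP; split => // k /=.
Qed.

Lemma sym_rel_shift m x y : sym_rel A (x, y) -> sym_rel A (shift_pow m x, shift_pow m y).
Proof.
move=> [/= xA yA [s [[t st ts] fs ys]]]; split; [exact: sft_shift|exact: sft_shift|].
exists (fun j => s (j + m) - m); split.
- exists (fun j => t (j + m) - m) => j /=; first by rewrite subrK st addrK.
  by rewrite subrK ts addrK.
- have -> : [set k | s (k + m) - m <> k] = (fun k => k - m) @` [set k | s k <> k].
    apply/seteqP; split => k /=.
      move=> sk; exists (k + m); last by rewrite addrK.
      by apply: contra_not sk => ->; rewrite addrK.
    by move=> [j sj <-]; rewrite subrK => /addIr.
  exact: finite_image.
- by move=> k; rewrite /shift_pow; have /= -> := ys (k + m); rewrite subrK.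
Qed.

(* For a [sym_rel]-saturated set [B], mu(B /\ [u]) / mu [u] depends only on the
   length and on the end letters of [u]. *)
Lemma exchange_saturated (B : set X) k a u v : measurable B ->
  (forall x y, sym_rel A (x, y) -> B x -> B y) ->
  size u = size v -> last a u = last a v ->
  fine (mu (B `&` cyl k (a :: u))) * fine (mu (cyl 0 (a :: v))) =
  fine (mu (B `&` cyl k (a :: v))) * fine (mu (cyl 0 (a :: u))).
Proof.
move=> mB sB suv luv; pose D : set X := shift_pow (- k) @^-1` B.
have mD : measurable D by exact: measurable_shift.
have E w : mu (B `&` cyl k w) = mu (cyl 0 w `&` D).
  rewrite -(shift_invariant_int mu_shift (- k)); last first.
    by apply: measurableI => //; exact: measurable_cyl.
  congr (mu _); apply/seteqP; split => x /=.
    by rewrite cyl_shift subrr => -[].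
  by rewrite cyl_shift subrr => -[].
rewrite !E.
have wU : window_set 0 (size u).+1 (cyl 0 (a :: u)) := @window_set_cylinder 0 (a :: u).
have wV : window_set 0 (size v).+1 (cyl 0 (a :: v)) := @window_set_cylinder 0 (a :: v).
apply: (exchange mu_sft mu_shift mu_tail mu_inv wU wV mD (a := a) (b := last a u)).
- by move=> x /cyl_ends[-> h]; rewrite -h add0r.
- by move=> x /cyl_ends[-> h]; rewrite luv -h add0r.
exists 0%N => g _ x xA /cyl_ends[x0 xl] /cyl_ends[y0 yl].
have yA : sft A (reindex (block_exchange (size u) (size v) g) x).
  apply: sft_block_exchange => //.
    by rewrite x0 -y0 /shift_pow add0r.
  rewrite add0r in xl; rewrite xl luv -yl /shift_pow.
  by congr (x _); lia.
have xy := finite_perm_rel (finite_perm_block_exchange _ _ _) xA yA.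
split; rewrite /D /=; apply: sB; apply: sym_rel_shift => //.
exact: sym_rel_sym.
Qed.

End ExchangeableSets.

(** * Invariance and ergodicity of Gibbs measures *)

Section PartTwo.
Variables (R : realType) (n : nat) (A A' : 'M[nat]_n.+1).
Local Notation X := (fullshift n).
Local Notation I := 'I_n.+1.
Variables (Phi : X -> R) (k0 : int) (mu : probability X R).
Hypothesis A'01 : zero_one A'.
Hypothesis A01 : zero_one A.
Hypothesis A'A : forall i j, (A' i j <= A i j)%N.
Hypothesis A'ia : irreducible_aperiodic_sft A'.
Hypothesis A'sat : saturation (sym_rel A) (sft A') = sft A'.
Hypothesis Phi1 : depends_only_on (sft A') k0 Phi.
Hypothesis gibbs : gibbs_measure A' Phi mu.
Implicit Types (x y : X) (k : int) (L N : nat) (w u v : seq I).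

Lemma single_letter : exists phi : I -> R, forall x, sft A' x -> Phi x = phi (x k0).
Proof.
suff /choice[phi h] : forall a, exists r, forall x, sft A' x -> x k0 = a -> Phi x = r.
  by exists phi => x xA; exact: h.
move=> a; have [[y [yA ya]]|no] := pselect (exists y, sft A' y /\ y k0 = a).
  by exists (Phi y) => x xA xa; apply: Phi1 => //; rewrite xa ya.
by exists 0 => x xA xa; exfalso; apply: no; exists x.
Qed.

Lemma sft_le x : sft A' x -> sft A x.
Proof.
move=> xA k; have := A'A (x k) (x (k + 1)); rewrite xA.
by case: (A01 (x k) (x (k + 1))) => ->.
Qed.

Lemma sft_sym_rel x y : sym_rel A (x, y) -> sft A' x -> sft A' y.
Proof. by move=> xy xA'; rewrite -A'sat; exists x. Qed.

Lemma sft_full (mu' : probability X R) : mu' (sft A') = 1%E -> mu' (sft A) = 1%E.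
Proof.
move=> h; apply/eqP; rewrite eq_le probability_le1 /=; last exact: measurable_sft.
rewrite -h le_measure ?inE //; [exact: measurable_sft|exact: measurable_sft|].
exact: sft_le.
Qed.

Let muA' : mu (sft A') = 1%E. Proof. by case: gibbs. Qed.
Let muA : mu (sft A) = 1%E. Proof. exact: sft_full. Qed.

(** Saturation lets [W] restrict to [sft A'], where it lies in the full group of the Gibbs relation.
    It permutes central words, so weights change by the factor 1. *)
Lemma gibbs_sym_invariant : rel_invariant (sft A) (sym_rel A) mu.
Proof.
move=> W [[bij mW imW] EW] B mB sB.
have [phi hphi] := single_letter.
have [funW injW surW] := bij.
have mA' := measurable_sft A'.
have WA' x : sft A x -> sft A' (W x) <-> sft A' x.
  move=> xA; have xW := EW x xA; split; apply: sft_sym_rel => //.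
  exact: sym_rel_sym.
have fW : in_full_group (sft A') (gibbs_rel A') W.
  split; last first.
    move=> x xA'; have /sym_relP[_ _ [N [h _]]] := EW x (sft_le xA').
    by apply/gibbs_relP; split => //; [apply/WA' => //; exact: sft_le|exists N].
  split.
  - split; first by move=> x xA'; apply/WA' => //; exact: sft_le.
      by move=> x y; rewrite !inE => xA' yA'; apply: injW; rewrite inE; exact: sft_le.
    move=> y yA'; have [x xA Wx] := surW y (sft_le yA'); exists x => //.
    by apply/(WA' x xA); rewrite Wx.
  - apply: measurable_funS mW => //; [exact: measurable_sft|exact: sft_le].
  - by move=> C mC sC; apply: imW => // x /sC; exact: sft_le.
rewrite -(measure_sftI muA' mB) -(measure_sftI muA' (imW _ mB sB)).
have -> : W @` B `&` sft A' = W @` (B `&` sft A').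
  apply/seteqP; split => [_ [[x Bx <-] WxA']|_ [x [Bx xA'] <-]].
    by exists x => //; split => //; apply/WA' => //; exact: sB.
  by split; [exists x|apply/WA' => //; exact: sft_le].
rewrite (gibbs_full_group hphi gibbs (c := 1) fW) ?mul1e //.
  exact: measurableI.
move=> x [Bx xA']; have /sym_relP[_ _ [N [h p]]] := EW x (sB x Bx).
exists N; split => //; rewrite mul1r /weight; apply: perm_big.
by rewrite perm_sym.
Qed.

Let swap B : measurable B ->
  (forall N x y, sft A' x -> sft A' y -> agree_off N x y -> B x -> B y) ->
  exists2 phi : I -> R, forall i, 0 < boltzmann phi i &
    gibbs_swap A' (boltzmann phi) mu setT /\ gibbs_swap A' (boltzmann phi) mu B.
Proof.
move=> mB tB; have [phi hphi] := single_letter.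
exists phi; first exact: boltzmann_gt0.
split; first by apply: (gibbs_measure_swap hphi gibbs A'01).
exact: (gibbs_measure_swap hphi gibbs A'01 mB tB).
Qed.

Lemma gibbs_tail_trivial : tail_trivial mu.
Proof.
move=> B mB tB; have [|phi phi0 [swT swB]] := swap mB.
  by move=> N x y _ _; exact: tB.
exact: (gibbs_zero_one phi0 A'ia muA' mB swT swB).
Qed.

(** The swap rule holds at every position with the same weights, so the image of [mu] under the
    shift obeys it too and uniqueness applies. *)
Lemma gibbs_shift_invariant : shift_invariant mu.
Proof.
have [//|phi phi0 [swT _]] := swap (@measurableT _ X).
have ms : measurable_fun setT (shift_pow 1 : X -> X).
  by move=> _ B mB; rewrite setTI; exact: measurable_shift.
pose s : {mfun X >-> X} := HB.pack (shift_pow 1 : X -> X) (isMeasurableFun.Build _ _ _ _ _ ms).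
pose nu : probability X R := distribution mu s.
have nuE B : nu B = mu (shift_pow 1 @^-1` B) by [].
have nuA' : nu (sft A') = 1%E.
  rewrite nuE -muA'; congr (mu _); apply/seteqP; split => x /= xA'; last exact: sft_shift.
  by have := sft_shift (- 1) xA'; rewrite shift_powD addNr shift_pow0.
move=> B mB; rewrite -nuE.
apply: (gibbs_unique phi0 A'ia muA' nuA' swT) mB => k a u v Sa pu pv suv luv.
have := swT (k + 1) a u v Sa pu pv suv luv; rewrite !setTI !nuE.
have E w : shift_pow 1 @^-1` (cyl k w) = cyl (k + 1) w.
  by apply/seteqP; split => x /=; rewrite cyl_shift.
by rewrite !E.
Qed.

Lemma gibbs_sym_ergodic : rel_ergodic (sft A) (sym_rel A) mu.
Proof.
have mA := measurable_sft A; have mA' := measurable_sft A'.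
split=> [B mB B0|B mB sB].
  have mS := @measurable_saturation_sym _ A _ mB.
  have [_ quasi _] := gibbs.
  rewrite -(measure_sftI muA' mS); apply/eqP; rewrite eq_le measure_ge0 andbT.
  rewrite -(quasi _ mB B0); apply: le_measure; rewrite ?inE.
  - exact: measurableI.
  - exact: measurable_saturation_gibbs.
  move=> y [[x Bx xy] yA']; exists x => //.
  have xA' := sft_sym_rel (sym_rel_sym xy) yA'.
  by apply/gibbs_relP; split => //; have /sym_relP[_ _ [N [h _]]] := xy; exists N.
set S := saturation _ _; have mS : measurable S by exact: measurable_saturation_sym.
have SS x y : sym_rel A (x, y) -> S x -> S y.
  by move=> xy [z Bz zx]; exists z => //; exact: sym_rel_trans zx xy.
have [//|phi phi0 [swT _]] := swap (@measurableT _ X).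
have ex := exchange_saturated muA gibbs_shift_invariant gibbs_tail_trivial
  gibbs_sym_invariant.
have swS : gibbs_swap A' (boltzmann phi) mu S.
  move=> k a u v Sa pu pv suv luv.
  have h1 := ex S k a u v mS SS suv luv.
  have := swT 0 a u v Sa pu pv suv luv; rewrite !setTI.
  move: h1; set p := fine (mu (cyl 0 (a :: u))); set q := fine (mu (cyl 0 (a :: v))).
  have wu := weight_gt0 phi0 u; have wv := weight_gt0 phi0 v.
  set P := fine _; set Q := fine _ => h1 h2.
  have mc w : measurable (cyl k w) by exact: measurable_cyl.
  have le w : 0 <= fine (mu (S `&` cyl k w)) <= fine (mu (cyl 0 w)).
    rewrite fine_ge0 //= fine_le ?fin_num_measure //.
    - exact: measurableI.
    - exact: measurable_cyl.
    rewrite -(shift_invariant_int gibbs_shift_invariant k (measurable_cyl 0 w)).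
    apply: le_measure; rewrite ?inE; [exact: measurableI| |].
      by apply: measurable_shift; exact: measurable_cyl.
    by move=> x [_ wx] /=; rewrite cyl_shift add0r.
  (* The exchange relation [P * q = Q * p] and the swap rule for [p], [q] give that for [P], [Q] on
     cancelling [q]. If [q = 0], then all four vanish, as [P <= p] and [Q <= q]. *)
  have [q0|q0] := eqVneq q 0.
    have p0 : p = 0.
      by move: h2; rewrite q0 mul0r => /eqP; rewrite mulf_eq0 (gt_eqF wv) orbF => /eqP.
    have P0 : P = 0 by have := le (a :: u); rewrite -/P -/p p0 => /le_anti.
    have Q0 : Q = 0 by have := le (a :: v); rewrite -/Q -/q q0 => /le_anti.
    by rewrite P0 Q0 !mul0r.
  apply: (mulIf q0); rewrite mulrAC h1 [RHS]mulrAC -!mulrA; congr (_ * _).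
  by rewrite h2.
have [->|S1] := gibbs_zero_one phi0 A'ia muA' mS swT swS; [by left|right].
apply/eqP; rewrite eq_le measure_ge0 andbT.
have <- : mu (~` S) = 0%E by rewrite probability_setC // S1 subee.
apply: le_measure; rewrite ?inE; [exact: measurableD|exact: measurableC|].
by move=> x [].
Qed.

End PartTwo.

(** * Measures ergodic under finite permutations *)

(** Related points differ in finitely many coordinates, so the trace of a tail event on [sft A] is
    saturated. *)
Lemma rel_ergodic_tail_trivial (R : realType) (n : nat) (A : 'M[nat]_n.+1)
    (mu : probability (fullshift n) R) :
  mu (sft A) = 1%E -> rel_ergodic (sft A) (sym_rel A) mu -> tail_trivial mu.
Proof.
move=> muA [_ erg] B mB tB; have mA := measurable_sft A.
have mBA : measurable (B `&` sft A) by exact: measurableI.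
have sat : saturation (sym_rel A) (B `&` sft A) = B `&` sft A.
  apply/seteqP; split => [y [x [Bx _] xy]|x [Bx xA]]; last first.
    by exists x => //; exact: sym_rel_refl.
  have /sym_relP[_ yA [N [h _]]] := xy.
  by split => //; exact: tB h Bx.
have sub : B `&` sft A `<=` sft A by move=> x [].
have := erg _ mBA sub; rewrite sat (measure_sftI muA mB) => -[|h]; [by left|right].
have : mu (~` B) = 0%E.
  rewrite -(measure_sftI muA (measurableC mB)) -h; congr (mu _).
  apply/seteqP; split => x /=; first by move=> [nB xA]; split => // -[].
  by move=> [xA nBA]; split => // Bx; apply: nBA.
by rewrite probability_setC // => /eqP; rewrite sube_eq ?fin_num_measure // add0e => /eqP.
Qed.

(** * The Markov property *)

Section MarkovProperty.
Variables (R : realType) (n : nat) (A : 'M[nat]_n.+1) (mu : probability (fullshift n) R).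
Local Notation X := (fullshift n).
Local Notation I := 'I_n.+1.
Hypothesis mu_sft : mu (sft A) = 1%E.
Hypothesis mu_shift : shift_invariant mu.
Hypothesis mu_tail : tail_trivial mu.
Hypothesis mu_inv : rel_invariant (sft A) (sym_rel A) mu.
Implicit Types (x y : X) (k : int) (L N : nat) (w u v : seq I).

Lemma measure_cyl_shift k w : mu (cyl k w) = mu (cyl 0 w).
Proof.
rewrite -(shift_invariant_int mu_shift k (measurable_cyl 0 w)).
by congr (mu _); apply/seteqP; split => x /=; rewrite cyl_shift add0r.
Qed.

Definition pr w : R := fine (mu (cyl 0 w)).

Lemma pr_ge0 w : 0 <= pr w.
Proof. exact: fine_ge0. Qed.

Lemma prE k w : fine (mu (cyl k w)) = pr w.
Proof. by rewrite measure_cyl_shift. Qed.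

Lemma fine_neq0 (B : set X) : measurable B -> (fine (mu B) != 0) = (mu B != 0%E).
Proof. by move=> mB; rewrite -[mu B in RHS]fineK ?fin_num_measure. Qed.

Lemma fine_le_measure (B C : set X) : measurable B -> measurable C -> B `<=` C ->
  fine (mu B) <= fine (mu C).
Proof.
by move=> mB mC BC; rewrite fine_le ?fin_num_measure // le_measure ?inE.
Qed.

(* Exchanging the block of [x] between two occurrences of [a] with a fixed block
   between later occurrences shows that, given [x 0 = a], the past [D] is
   independent of the future. *)
Lemma past_independent a (D : set X) : measurable D -> pr [:: a] != 0 ->
  (forall x y, (forall i, i <= 0 -> x i = y i) -> D x -> D y) ->
  exists kappa, forall M (U : set X), window_set 0 M U -> (forall x, U x -> x 0 = a) ->
    fine (mu (U `&` D)) = kappa * fine (mu U).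
Proof.
move=> mD pa past.
have mc := measurable_cyl 0 [:: a].
have c0 : mu (cyl 0 [:: a]) != 0%E by rewrite -fine_neq0.
have wa : window_set 0 1 (cyl 0 [:: a]) := @window_set_cylinder n 0 [:: a].
(* Recurrence supplies the fixed reference block [V]: a return to [a] after [K] steps that has
   positive probability. *)
have [K _ VK] := shift_ergodic_meet mu_shift mu_tail 1 mc wa c0 c0.
pose loop M (U : set X) : set X := U `&` shift_pow M%:Z @^-1` cyl 0 [:: a].
have loopP M U x : loop M U x <-> U x /\ x M%:Z = a.
  by rewrite /loop /= cyl_shift add0r cyl1.
have wloop M L U : window_set 0 M U -> (M <= L)%N -> window_set 0 L.+1 (loop L U).
  move=> wU ML x y xy /loopP[Ux xL]; apply/loopP; split.
    by apply: wU Ux => i iM; apply: xy; lia.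
  by rewrite -xy //; lia.
pose V := loop K (cyl 0 [:: a]).
have wV : window_set 0 K.+1 V.
  move=> x y xy /loopP[]; rewrite cyl1 /= => x0 xK; apply/loopP; rewrite cyl1 /=.
  by rewrite -!xy //; lia.
have mV := measurable_window_set wV.
have V0 : fine (mu V) != 0 by rewrite fine_neq0.
exists (fine (mu (V `&` D)) / fine (mu V)) => M U wU Ua.
have mU := measurable_window_set wU.
(* Requiring [a] at time [L] turns [U] into a block with the same end letters as [V]. Averaging over
   [L] then removes this condition at the price of a factor [pr [:: a]] on both sides. *)
have E L : (M <= L)%N -> fine (mu (U `&` D `&` shift_pow L%:Z @^-1` cyl 0 [:: a])) =
    fine (mu (V `&` D)) / fine (mu V) * fine (mu (U `&` shift_pow L%:Z @^-1` cyl 0 [:: a])).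
  move=> ML; apply: (mulIf V0); rewrite [RHS]mulrAC divfK //.
  rewrite -setIA [D `&` _]setIC setIA -/(loop L U).
  apply: (exchange mu_sft mu_shift mu_tail mu_inv (wloop M L U wU ML) wV mD (a := a) (b := a)).
  - by move=> x /loopP[/Ua].
  - by move=> x /loopP[]; rewrite cyl1.
  exists 0%N => g _ x xA /loopP[Ux _] /loopP[]; rewrite cyl1 /= /shift_pow add0r => xj _.
  have agr i : i <= 0 -> x i = reindex (block_exchange L K g) x i.
    rewrite /reindex le_eqVlt => /predU1P[->|i0]; last by rewrite block_exchange_neg.
    by rewrite block_exchange_head ?add0r ?xj ?(Ua x Ux) //; lia.
  by split; apply: past => i i0; rewrite agr.
have wa' : window_set (0 + M%:Z) 1 (shift_pow M%:Z @^-1` cyl 0 [:: a]).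
  exact: window_set_shift.
have lim1 := shift_ergodic mu_shift mu_tail (measurableI _ _ mU mD) wa'.
have lim2 := shift_ergodic mu_shift mu_tail mU wa'.
rewrite shift_invariant_int // in lim1 lim2.
set kap := _ / _ in E *.
have EE : (fun N : nat => N%:R^-1 * \sum_(j < N) fine (mu (U `&` D `&`
      shift_pow j%:Z @^-1` (shift_pow M%:Z @^-1` cyl 0 [:: a])))) =
    (fun N : nat => kap * (N%:R^-1 * \sum_(j < N) fine (mu (U `&`
      shift_pow j%:Z @^-1` (shift_pow M%:Z @^-1` cyl 0 [:: a]))))).
  apply/funext => N; rewrite mulrCA; congr (_ * _); rewrite mulr_sumr.
  apply: eq_bigr => j _; have := E (M + j)%N (leq_addr _ _).
  suff -> : shift_pow j%:Z @^-1` (shift_pow M%:Z @^-1` cyl 0 [:: a]) =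
    shift_pow (M + j)%N%:Z @^-1` cyl 0 [:: a] by [].
  by apply/seteqP; split => x /=; rewrite shift_powD.
rewrite EE in lim1.
have h := cvg_unique (@Rhausdorff R) lim1 (cvgMr lim2).
by apply: (mulIf pa); rewrite -mulrA; exact: h.
Qed.

Lemma pr_neq0_head a w : pr (a :: w) != 0 -> pr [:: a] != 0.
Proof.
apply: contra => /eqP p0; rewrite eq_le pr_ge0 andbT -p0.
apply: fine_le_measure; try exact: measurable_cyl.
by rewrite cyl1 cyl_cons => x [].
Qed.

(** The past event is the cylinder of [a :: u] ending at coordinate 0; the futures [last a u :: v]
    and [[:: last a u]] share the same factor [kappa], which is eliminated. *)
Lemma pr_cat a u v : pr (a :: u ++ v) * pr [:: last a u] =
  pr (a :: u) * pr (last a u :: v).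
Proof.
have [l0|l0] := eqVneq (pr [:: last a u]) 0.
  rewrite l0 mulr0; suff -> : pr (last a u :: v) = 0 by rewrite mulr0.
  by apply/eqP/negPn/negP => /pr_neq0_head; rewrite l0 eqxx.
pose k : int := - (size u)%:Z.
have e1 : mu (cyl 0 (last a u :: v) `&` cyl k (a :: u)) = mu (cyl k (a :: u ++ v)).
  congr (mu _); rewrite -cat_cons cyl_cat cyl_cons setIC; apply/seteqP; split => x.
    move=> [ux [/= xl vx]]; split => //.
    by rewrite (_ : k + _ = 0 + 1) // /k [size _]/=; lia.
  move=> [ux vx]; split => //; split.
    by have [_] := cyl_ends ux; rewrite /k addNr.
  by move: vx; rewrite (_ : k + _ = 0 + 1) // /k [size (_ :: _)]/=; lia.
have e2 : mu (cyl 0 [:: last a u] `&` cyl k (a :: u)) = mu (cyl k (a :: u)).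
  congr (mu _); rewrite cyl1; apply/seteqP; split => x; first by case.
  move=> ux; split => //.
  by have [_] := cyl_ends ux; rewrite /k addNr.
have [|kap hk] := @past_independent (last a u) (cyl k (a :: u)) (measurable_cyl _ _) l0.
  move=> x y xy ux; rewrite /cyl /= -[RHS]ux; apply: eq_word => i ki.
  by rewrite xy //; move: ki; rewrite /k /=; lia.
have wc w : window_set 0 (size w) (cyl 0 w) by exact: window_set_cylinder.
have h1 := hk _ _ (wc (last a u :: v)); have h2 := hk _ _ (wc [:: last a u]).
rewrite -(prE k (a :: u ++ v)) -(prE k (a :: u)) -e1 -e2 h1 ?h2.
- by rewrite /pr; ring.
- by move=> x; rewrite cyl1.
- by move=> x; rewrite cyl_cons => -[].
Qed.

End MarkovProperty.

(** * From the swap rule to the Gibbs property *)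

Section GibbsFromSwap.
Variables (R : realType) (n : nat) (A : 'M[nat]_n.+1) (phi : 'I_n.+1 -> R).
Variable mu : probability (fullshift n) R.
Local Notation X := (fullshift n).
Local Notation I := 'I_n.+1.
Local Notation wt := (boltzmann phi).
Hypothesis mu_sft : mu (sft A) = 1%E.
Hypothesis swap : gibbs_swap A wt mu setT.
Implicit Types (x y : X) (k : int) (L N : nat) (w u v : seq I).

Let ok a u := (a \in symbols A) && path (allowed A) a u.

Lemma swap_context k al be a u v : ok a u -> ok a v -> size u = size v ->
  last a u = last a v ->
  fine (mu (cyl k (al ++ (a :: u) ++ be))) * weight wt v =
  fine (mu (cyl k (al ++ (a :: v) ++ be))) * weight wt u.
Proof.
move=> /andP[Sa pu] /andP[_ pv] suv luv.
have spec := measure_specification mu_sft measurableT swap.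
have sp := spec_supp spec; have sw := spec_swap spec.
have fE k' w : fine (mu (setT `&` cyl k' w)) = fine (mu (cyl k' w)) by rewrite setTI.
have pE b (x : seq I) : path (allowed A) b (x ++ (a :: u) ++ be) =
              path (allowed A) b (x ++ (a :: v) ++ be).
  by rewrite !cat_path /= pu pv luv.
have wE (x y : seq I) : weight wt (x ++ y ++ be) = weight wt x * weight wt y * weight wt be.
  by rewrite !weight_cat mulrA.
have w0 w' := weight_gt0 (boltzmann_gt0 phi) w'.
case: al => [|b al].
  have [p|np] := boolP (path (allowed A) a (u ++ be)); last first.
    have np' : ~~ path (allowed A) a (v ++ be).
      by move: np; rewrite !cat_path pu pv luv.
    rewrite -!fE /= (sp k a (u ++ be)) ?(sp k a (v ++ be)) ?mul0r //.
      by rewrite Sa.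
    by rewrite Sa.
  have p' : path (allowed A) a (v ++ be) by move: p; rewrite !cat_path pu pv luv.
  have := sw k a (u ++ be) (v ++ be) Sa p p'; rewrite !size_cat !last_cat suv luv.
  rewrite !fE !weight_cat !mulrA => /(_ erefl erefl) h.
  by apply: (mulIf (lt0r_neq0 (w0 be))); exact: h.
rewrite !cat_cons.
have [/andP[Sb p]|np] := boolP ((b \in symbols A) && path (allowed A) b (al ++ (a :: u) ++ be)); last first.
  rewrite -!fE (sp k b (al ++ (a :: u) ++ be)) // (sp k b (al ++ (a :: v) ++ be)) ?mul0r //.
  by move: np; rewrite pE.
have p' := p; rewrite pE in p'.
have esz : size (al ++ (a :: u) ++ be) = size (al ++ (a :: v) ++ be).
  by rewrite !size_cat /= suv.
have ela : last b (al ++ (a :: u) ++ be) = last b (al ++ (a :: v) ++ be).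
  by rewrite !last_cat /= luv.
have := sw k b _ _ Sb p p' esz ela; rewrite !fE !wE => h.
have wc w : weight wt (a :: w) = wt a * weight wt w by rewrite /weight big_cons.
rewrite !wc in h.
have c0 : weight wt al * wt a * weight wt be != 0.
  by rewrite !mulf_neq0 // gt_eqF // ?w0 // boltzmann_gt0.
apply: (mulIf c0); move: h; set P := fine _; set Q := fine _ => h.
have -> : P * weight wt v * (weight wt al * wt a * weight wt be) =
  P * (weight wt al * (wt a * weight wt v) * weight wt be) by ring.
by rewrite h; ring.
Qed.

(** Both sides are finite measures in [B], namely an image of a restriction and a scaled
    restriction. They agree on the central cylinders that contain the block, by the swap rule in
    context. *)
Lemma swap_measurable k a u v (B : set X) : measurable B -> ok a u -> ok a v ->
  size u = size v -> last a u = last a v ->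
  mu (cyl k (a :: v) `&` overwrite k (a :: u) @^-1` B) =
  ((weight wt v / weight wt u)%:E * mu (cyl k (a :: u) `&` B))%E.
Proof.
move=> mB oku okv suv luv.
have w0 w' := weight_gt0 (boltzmann_gt0 phi) w'.
have c0 : 0 <= weight wt v / weight wt u by rewrite divr_ge0 // ltW.
pose c : {nonneg R} := NngNum c0.
have mu' := measurable_cyl k (a :: u); have mv' := measurable_cyl k (a :: v).
pose m1' : {measure set X -> \bar R} := pushforward (mrestr mu mv') (overwrite k (a :: u)).
pose m1 := m1' (@measurable_overwrite n k (a :: u)).
pose m2 : {measure set X -> \bar R} := mscale c (mrestr mu mu').
have E1 (C : set X) : m1 C = mu (cyl k (a :: v) `&` overwrite k (a :: u) @^-1` C).
  by rewrite /m1 /m1' /= /pushforward /mrestr setIC.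
have E2 (C : set X) : m2 C = ((weight wt v / weight wt u)%:E * mu (cyl k (a :: u) `&` C))%E.
  by rewrite /m2 /= /mscale /mrestr /= setIC.
rewrite -E1 -E2; apply: (@eq_measure_cyl n R m1 m2 (`|k| + size u + 1)%N) mB.
  by rewrite E1 /=; apply: le_lt_trans (probability_le1 mu _) _; rewrite ?setIT ?ltry.
move=> N w NN sw; rewrite E1 E2; set K := - N%:Z.
pose l := absz (k + N%:Z)%R.
pose al := take l w; pose mid := take (size u).+1 (drop l w).
pose be := drop (size u).+1 (drop l w).
have lE : k = K + l%:Z by rewrite /K /l; lia.
have wE : w = al ++ mid ++ be by rewrite !cat_take_drop.
have sal : size al = l by rewrite size_take sw /l; case: ifP; lia.
have smid : size mid = (size u).+1.
  by rewrite size_take size_drop sw /l; case: ifP; lia.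
have [um|um] := eqVneq mid (a :: u); last first.
  rewrite (_ : _ `&` overwrite k (a :: u) @^-1` _ = set0); last first.
    apply/seteqP; split => // x [_ /= wx]; move: wx; rewrite wE !cyl_cat sal -lE => -[_ [mx _]].
    have := cyl_overwrite k (a :: u) x; move: mx; rewrite /cyl /= smid => -> h.
    by rewrite h eqxx in um.
  rewrite (_ : _ `&` cyl K w = set0) ?measure0 ?mule0 //.
  apply/seteqP; split => // x [ux]; rewrite wE !cyl_cat sal -lE => -[_ [mx _]].
  by move: ux mx; rewrite /cyl /= smid => -> h; rewrite h eqxx in um.
rewrite wE um.
have cE z x : size z = size u -> cyl K (al ++ (a :: z) ++ be) x <->
    [/\ cyl K al x, cyl k (a :: z) x & cyl (k + (size u).+1%:Z) be x].
  by move=> sz; rewrite !cyl_cat sal -lE [size (a :: z)]/= sz; split=> [[? []]|[]].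
have -> : cyl k (a :: v) `&` overwrite k (a :: u) @^-1` cyl K (al ++ (a :: u) ++ be) =
    cyl K (al ++ (a :: v) ++ be).
  have outE x i : ~~ (k <= i < k + (size u).+1%:Z) -> overwrite k (a :: u) x i = x i.
    by move=> h; apply: overwrite_out.
  have alE x : cyl K al (overwrite k (a :: u) x) <-> cyl K al x.
    by rewrite /cyl /= sal (eq_word (y := x)) // => i iK; rewrite outE //; lia.
  have beE x : cyl (k + (size u).+1%:Z) be (overwrite k (a :: u) x) <->
      cyl (k + (size u).+1%:Z) be x.
    by rewrite /cyl /= (eq_word (y := x)) // => i iK; rewrite outE //; lia.
  apply/seteqP; split => x.
    move=> [vx /(cE _ _ erefl)[alx _ bex]]; apply/cE => //.
    by split; [exact/alE|exact: vx|exact/beE].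
  move=> /(cE _ _ (esym suv))[alx vx bex]; split => //; apply/(cE _ _ erefl).
  by split; [exact/alE|exact: cyl_overwrite|exact/beE].
have -> : cyl k (a :: u) `&` cyl K (al ++ (a :: u) ++ be) = cyl K (al ++ (a :: u) ++ be).
  by apply/seteqP; split => x; [case|move=> h; split => //; case/(cE _ _ erefl): h].
have h := swap_context K al be oku okv suv luv.
have mc w' := measurable_cyl K w'.
rewrite -[LHS]fineK ?fin_num_measure //.
rewrite -[X in (_ * X)%E]fineK ?fin_num_measure // -EFinM; congr EFin.
apply: (mulIf (lt0r_neq0 (w0 u))); rewrite -h; field.
by rewrite gt_eqF.
Qed.

Lemma gibbs_rel_words x y : gibbs_rel A (x, y) -> exists k a u v,
  [/\ ok a u /\ ok a v, size u = size v /\ last a u = last a v,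
      cyl k (a :: u) x, cyl k (a :: v) y &
      forall j, ~~ (k <= j < k + (size (a :: u))%:Z) -> x j = y j].
Proof.
(* One more letter on each side than the window of differences, so that the two words share their
   end letters. *)
move=> /gibbs_relP[xA yA [N xy]]; pose k : int := - N.+1%:Z.
have ends z : word (k + 1) (2 * N).+2 z = rcons (word (k + 1) (2 * N).+1 z) (z N.+1%:Z).
  by rewrite word_rcons; congr (rcons _ (z _)); rewrite /k; lia.
have xk : x k = y k by rewrite xy // /k; lia.
exists k, (x k), (word (k + 1) (2 * N).+2 x), (word (k + 1) (2 * N).+2 y).
have cx : cyl k (x k :: word (k + 1) (2 * N).+2 x) x by rewrite -wordS; exact: cyl_word.
have cy : cyl k (x k :: word (k + 1) (2 * N).+2 y) y.
  by rewrite xk -wordS; exact: cyl_word.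
split => //.
- by split; [exact: allowed_cyl xA cx|exact: allowed_cyl yA cy].
- split; first by rewrite ![LHS]size_word [RHS]size_word.
  by rewrite !ends !last_rcons xy //; lia.
- by move=> j; rewrite -wordS size_word => jk; apply: xy; move: jk; rewrite /k; lia.
Qed.

Let admissible (p : int * I * seq I * seq I) :=
  let: (k, a, u, v) := p in
  [&& ok a u, ok a v, size u == size v & last a u == last a v].

Lemma swap_quasi_invariant : rel_quasi_invariant (gibbs_rel A) mu.
Proof.
move=> B mB B0.
pose Q (p : int * I * seq I * seq I) : set X := let: (k, a, u, v) := p in
  if admissible p then cyl k (a :: v) `&` overwrite k (a :: u) @^-1` B else set0.
have mQ p : measurable (Q p).
  case: p => [[[k a] u] v]; rewrite /Q; case: ifP => // _.
  apply: measurableI; first exact: measurable_cyl.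
  by rewrite -[X in measurable X]setTI; exact: measurable_overwrite.
have Q0 p : mu (Q p) = 0%E.
  case: p => [[[k a] u] v]; rewrite /Q; case: ifP => [|_]; last exact: measure0.
  move=> /and4P[oku okv /eqP suv /eqP luv].
  rewrite swap_measurable // (_ : mu (_ `&` _) = 0%E) ?mule0 //.
  apply/eqP; rewrite eq_le measure_ge0 andbT -B0; apply: le_measure; rewrite ?inE //.
  by apply: measurableI => //; exact: measurable_cyl.
apply/eqP; rewrite eq_le measure_ge0 andbT.
rewrite -(measure_bigcup_countable0 mQ Q0).
apply: le_measure; rewrite ?inE.
- exact: measurable_saturation_gibbs.
- exact: measurable_bigcup_countable.
move=> y [x Bx /gibbs_rel_words[k [a [u [v [[oku okv] [suv luv] ux vy xy]]]]]].
exists (k, a, u, v) => //=; rewrite oku okv suv luv !eqxx /=; split => //.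
suff -> : overwrite k (a :: u) y = x by [].
exact: eq_overwrite.
Qed.

Lemma measurable_eq_shift d (T : measurableType d) (D : set T) (f g : T -> X) :
  measurable D -> measurable_fun D f -> measurable_fun D g ->
  measurable (D `&` [set t | f t = g t]).
Proof.
move=> mD mf mg.
have -> : D `&` [set t | f t = g t] = \bigcap_(i : int) (\bigcup_(a : I)
    ((D `&` f @^-1` [set x | x i = a]) `&` (D `&` g @^-1` [set x | x i = a]))).
  apply/seteqP; split => t.
    by move=> [Dt /= fg] i _; exists (f t i) => //; split; split => //=; rewrite fg.
  move=> h; split; first by have [a _ [[]]] := h 0 Logic.I.
  by apply/funext => i; have [a _ [[_ /= ->] [_ /= ->]]] := h i Logic.I.
apply: measurable_bigcap_countable => i; apply: measurable_bigcup_countable => a.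
by apply: measurableI; [apply: mf|apply: mg] => //; exact: measurable_coord.
Qed.

Definition gibbs_density (p : X * X) : R :=
  expR (\sum_(k \in [set: int]) (phi (p.1 k) - phi (p.2 k))).

Lemma gibbs_densityE x y N : agree_off N x y ->
  gibbs_density (x, y) =
  expR (\sum_(i < (2 * N).+1) (phi (x (- N%:Z + i%:Z)) - phi (y (- N%:Z + i%:Z)))).
Proof.
move=> xy; rewrite /gibbs_density /=; congr expR.
apply: (fsbig_window (F := fun k => phi (x k) - phi (y k))) => j jN.
by rewrite xy ?subrr //; lia.
Qed.

Lemma agree_off_le N M x y : (N <= M)%N -> agree_off N x y -> agree_off M x y.
Proof. by move=> NM xy i Mi; apply: xy; exact: leq_ltn_trans Mi. Qed.

(** On related points the sums over central windows are eventually constant, so the density is a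
    pointwise limit of measurable functions. General [f] and [g] cover both the projections of the
    relation and the pair [(W x, x)]. *)
Lemma measurable_gibbs_density d (T : measurableType d) (D : set T) (f g : T -> X) :
  measurable_fun D f -> measurable_fun D g ->
  (forall t, D t -> gibbs_rel A (f t, g t)) ->
  measurable_fun D (fun t => gibbs_density (f t, g t)).
Proof.
move=> mf mg fg.
pose h N t : R := expR (\sum_(i < (2 * N).+1)
  (phi (f t (- N%:Z + i%:Z)) - phi (g t (- N%:Z + i%:Z)))).
have ml k : measurable_fun setT (fun x : X => phi (x k)).
  move=> _ Y mY; rewrite setTI.
  exact: (measurable_coord2 (fun a _ => Y (phi a)) k k).
apply: (measurable_fun_cvg (h := h)) => [N|t /fg /gibbs_relP[_ _ [N xy]]].
  apply: measurableT_comp => //; apply: measurable_sum => i; apply: measurable_funB.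
    exact: (measurableT_comp (ml _) mf).
  exact: (measurableT_comp (ml _) mg).
apply: cvg_near_cst; exists N => // M /= NM.
by rewrite (gibbs_densityE (agree_off_le NM xy)).
Qed.

(** For an arbitrary [W] in the full group, [B] splits into countably many disjoint pieces on which
    [W] overwrites one fixed word by another. On each piece the density is constant and
    [swap_measurable] gives the measure of the image. *)
Theorem gibbs_measure_of_swap : gibbs_measure A (fun x => phi (x 0)) mu.
Proof.
split => //; first exact: swap_quasi_invariant.
exists gibbs_density; last first.
  exists set0; first exact: negligible_set0.
  move=> x y _ _; rewrite /gibbs_density expRK /=.
  by apply: eq_fsbigr => k _; rewrite /shift_pow add0r.
split.
- have -> : gibbs_density = fun p => gibbs_density (p.1, p.2).
    by apply/funext => -[].
  apply: measurable_gibbs_density; [exact: measurable_funTS|exact: measurable_funTS|].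
  by case.
- by move=> p _; exact: expR_gt0.
- move=> x y z /gibbs_relP[_ _ [N xy]] /gibbs_relP[_ _ [M yz]].
  have xy' := agree_off_le (leq_addr M N) xy; have yz' := agree_off_le (leq_addl N M) yz.
  have xz : agree_off (N + M) x z by move=> i Ni; rewrite xy' // yz'.
  rewrite (gibbs_densityE xy') (gibbs_densityE yz') (gibbs_densityE xz) -expRD -big_split /=.
  by congr expR; apply: eq_bigr => i _; rewrite addrA subrK.
move=> W [[bij mW imW] EW] B mB sB.
have mD := measurable_sft A.
pose G (p : int * I * seq I * seq I) : set X := let: (k, a, u, v) := p in
  if admissible p then B `&` (cyl k (a :: u) `&`
    (sft A `&` [set x | W x = overwrite k (a :: v) x])) else set0.
have mG p : measurable (G p).
  case: p => [[[k a] u] v]; rewrite /G; case: ifP => // _.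
  apply: measurableI => //; apply: measurableI; first exact: measurable_cyl.
  by apply: measurable_eq_shift => //; apply: measurable_funTS; exact: measurable_overwrite.
pose H i := oapp G set0 (unpickle i).
have mH i : measurable (H i) by rewrite /H; case: unpickle => [p|] //=.
have mF i : measurable (seqDU H i).
  by apply: measurableD => //; apply: bigsetU_measurable => j _; exact: mH.
have BE : B = \bigcup_i seqDU H i.
  rewrite -seqDU_bigcup_eq -bigcup_unpickle; apply/seteqP; split => [x Bx|x [[[[k a] u] v] _]].
    have xA := sB x Bx.
    have [k [a [u [v [[oku okv] [suv luv] ux vy xy]]]]] := gibbs_rel_words (EW x xA).
    exists (k, a, u, v) => //=; rewrite oku okv suv luv !eqxx /=; split => //; split => //.
    split => //=; symmetry; apply: eq_overwrite => // j jk.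
    by rewrite xy //; move: jk => /=; rewrite suv.
  by rewrite /G; case: ifP => // _ [].
have sF i : seqDU H i `<=` sft A.
  by move=> x Fx; apply: sB; rewrite BE; exists i.
have tF := trivIset_seqDU H.
have injW x y : sft A x -> sft A y -> W x = W y -> x = y.
  by move=> xA yA; case: bij => _ inj _; apply: inj; rewrite inE.
have mWF i : measurable (W @` seqDU H i) by exact: imW.
have tWF : trivIset setT (fun i => W @` seqDU H i).
  move=> i j _ _ [_ [[x Fx <-] [y Fy E]]].
  apply: (tF i j Logic.I Logic.I); exists x; split => //.
  by rewrite -(injW y x (sF j y Fy) (sF i x Fx) E).
have -> : mu (W @` B) = (\sum_(i <oo) mu (W @` seqDU H i))%E.
  rewrite [in LHS]BE image_bigcup measure_semi_bigcup //.
  exact: bigcupT_measurable.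
rewrite [in RHS]BE ge0_integral_bigcup //; last 2 first.
- rewrite -BE; apply/measurable_EFinP; apply: measurable_gibbs_density.
  + exact: measurable_funS mW.
  + exact: measurable_id.
  + move=> x /sB xA; have /gibbs_relP[_ WA [N h]] := EW x xA.
    by apply/gibbs_relP; split => //; exists N => i Ni; rewrite h.
- by move=> x _; rewrite lee_fin expR_ge0.
apply: eq_eseriesr => i _; move: (mF i) => mP.
have : seqDU H i `<=` H i by move=> x [].
move: (seqDU H i) mP => P mP; rewrite /H; case: unpickle => [p|] /=; last first.
  by rewrite subset0 => ->; rewrite image_set0 measure0 integral_set0.
case: p => [[[k a] u] v]; rewrite /G; case: ifP => [|_]; last first.
  by rewrite subset0 => ->; rewrite image_set0 measure0 integral_set0.
move=> /and4P[oku okv /eqP suv /eqP luv] PG.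
(* On [P] the map [W] writes [a :: v] over [a :: u], and writing [a :: u] back inverts it. *)
have imP : W @` P = cyl k (a :: v) `&` overwrite k (a :: u) @^-1` P.
  apply/seteqP; split => [_ [x Px <-]|y [vy Py]].
    have [_ [ux [_ /= ->]]] := PG x Px; split; first exact: cyl_overwrite.
    by rewrite /preimage /mkset overwrite_overwrite ?overwrite_id //= suv.
  exists (overwrite k (a :: u) y) => //; have [_ [_ [_ /= ->]]] := PG _ Py.
  by rewrite overwrite_overwrite ?overwrite_id //= suv.
rewrite imP swap_measurable // setIidr; last by move=> x /PG[_ []].
rewrite -integral_cst //; apply: eq_integral => x /set_mem /PG[Bx [ux [xA /= Wx]]].
congr EFin; rewrite Wx /gibbs_density /=.
rewrite (@energy_difference R n phi _ _ k (size u).+1); last first.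
  by move=> j jk; rewrite overwrite_out //= -suv.
have -> : word k (size u).+1 x = a :: u by exact: ux.
have -> : word k (size u).+1 (overwrite k (a :: v) x) = a :: v.
  by rewrite suv; exact: (cyl_overwrite k (a :: v) x).
have w0 w := weight_gt0 (boltzmann_gt0 phi) w.
rewrite lnK ?posrE ?divr_gt0 // /weight !big_cons -/(weight wt v) -/(weight wt u).
by rewrite -mulf_div divff ?mul1r // gt_eqF // boltzmann_gt0.
Qed.

End GibbsFromSwap.

(** * The support of the measure *)

Section PartOne.
Variables (R : realType) (n : nat) (A : 'M[nat]_n.+1) (mu : probability (fullshift n) R).
Local Notation X := (fullshift n).
Local Notation I := 'I_n.+1.
Hypothesis mu_sft : mu (sft A) = 1%E.
Hypothesis mu_shift : shift_invariant mu.
Hypothesis mu_tail : tail_trivial mu.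
Hypothesis mu_inv : rel_invariant (sft A) (sym_rel A) mu.
Implicit Types (x y : X) (k : int) (L N : nat) (w u v : seq I).

Local Notation pr := (pr mu).

Definition support_mx : 'M[nat]_n.+1 := \matrix_(i, j) nat_of_bool (pr [:: i; j] != 0).
Local Notation A' := support_mx.

Lemma measure_neq0_nonempty (B : set X) : mu B != 0%E -> B !=set0.
Proof. by move=> B0; apply/set0P; apply: contra B0 => /eqP ->; rewrite measure0. Qed.

Lemma measure_neq0_coord (B : set X) k : measurable B -> mu B != 0%E ->
  exists a, mu (B `&` [set x | x k = a]) != 0%E.
Proof.
move=> mB; rewrite (measure_coord mu k mB) => B0; apply: contrapT => no.
move: B0; rewrite big1 ?eqxx // => a _; apply/eqP/negPn/negP => h; apply: no.
by exists a.
Qed.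

Lemma pr_neq0 k w : (pr w != 0) = (mu (cyl k w) != 0%E).
Proof. by rewrite -(prE mu_shift k) fine_neq0 //; exact: measurable_cyl. Qed.

Lemma support_zero_one : zero_one A'.
Proof. by move=> i j; rewrite mxE; case: (_ != 0); [right|left]. Qed.

Lemma sft_cyl_nonempty k w : pr w != 0 -> exists x, sft A x /\ cyl k w x.
Proof.
have mw := measurable_cyl k w.
rewrite (pr_neq0 k) -(measure_sftI mu_sft mw) => /measure_neq0_nonempty[x [wx xA]].
by exists x.
Qed.

Lemma support_le i j : (A' i j <= A i j)%N.
Proof.
rewrite mxE; case: (boolP (pr _ != 0)) => // /(sft_cyl_nonempty 0)[x [xA]].
rewrite cyl_cons cyl1 => -[/= xi xj].
by have := xA 0; rewrite xi xj => ->.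
Qed.

Lemma pr_step_neq0_tail i j : pr [:: i; j] != 0 -> pr [:: j] != 0.
Proof.
rewrite (pr_neq0 (-1)) (pr_neq0 0); apply: contra => /eqP j0.
rewrite eq_le measure_ge0 andbT -j0; apply: le_measure; rewrite ?inE; try exact: measurable_cyl.
by rewrite cyl_cons addNr => x [].
Qed.

Lemma mem_symbols i : (i \in symbols A') = (pr [:: i] != 0).
Proof.
rewrite inE; apply/andP/idP => [[/existsP[j]]|pi].
  by rewrite mxE eqb0 negbK => /pr_neq0_head.
have mi := measurable_cyl 0 [:: i].
split; apply/existsP.
  have [|b] := @measure_neq0_coord (cyl 0 [:: i]) 1 mi; first by rewrite -pr_neq0.
  move=> h; exists b; rewrite mxE eqb0 negbK (pr_neq0 0).
  by rewrite cyl_cons add0r cyl1 -(cyl1 0).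
have [|b] := @measure_neq0_coord (cyl 0 [:: i]) (-1) mi; first by rewrite -pr_neq0.
move=> h; exists b; rewrite mxE eqb0 negbK (pr_neq0 (-1)).
by rewrite cyl_cons addNr setIC.
Qed.

Lemma allowedE i j : allowed A' i j = (pr [:: i; j] != 0).
Proof.
rewrite /allowed !mem_symbols mxE eqb0 negbK.
case: (boolP (pr [:: i; j] != 0)) => //= h.
by rewrite (pr_neq0_head h) (pr_step_neq0_tail h).
Qed.

Lemma support_full : mu (sft A') = 1%E.
Proof.
pose Q (p : int * I * I) : set X := let: (k, a, b) := p in
  if pr [:: a; b] == 0 then cyl k [:: a; b] else set0.
have mQ p : measurable (Q p).
  by case: p => [[k a] b]; rewrite /Q; case: ifP => // _; exact: measurable_cyl.
have Q0 p : mu (Q p) = 0%E.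
  case: p => [[k a] b]; rewrite /Q; case: ifPn => [p0|_]; last exact: measure0.
  by apply/eqP/negPn; rewrite -pr_neq0 negbK.
have : mu (~` sft A') = 0%E.
  apply/eqP; rewrite eq_le measure_ge0 andbT -(measure_bigcup_countable0 mQ Q0).
  apply: le_measure; rewrite ?inE.
  - by apply: measurableC; exact: measurable_sft.
  - exact: measurable_bigcup_countable.
  move=> x nx; apply: contrapT => no; apply: nx => k; rewrite mxE.
  case: eqP => // /eqP p0; case: no; exists (k, x k, x (k + 1)) => //=.
  by rewrite p0 cyl_cons cyl1.
rewrite probability_setC; last exact: measurable_sft.
by move=> /eqP; rewrite sube_eq ?fin_num_measure // add0e => /eqP.
Qed.

Lemma pr_path_neq0 a w : pr [:: a] != 0 -> path (allowed A') a w -> pr (a :: w) != 0.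
Proof.
move=> pa; elim/last_ind: w => [//|w b IH]; rewrite rcons_path => /andP[pw].
rewrite allowedE => lb; rewrite -cats1.
have := pr_cat mu_sft mu_shift mu_tail mu_inv a w [:: b] => E.
by apply: contraNN (mulf_neq0 (IH pw) lb) => /eqP E0; rewrite -E E0 mul0r.
Qed.

Lemma support_reach i j (J : nat) : pr [:: i] != 0 -> pr [:: j] != 0 ->
  exists2 k, (J < k)%N & reach (allowed A') k i j.
Proof.
rewrite !(pr_neq0 0) => pi pj.
have mi := measurable_cyl 0 [:: i].
have wj := @window_set_cylinder n 0 [:: j].
have [k Jk] := shift_ergodic_meet mu_shift mu_tail J.+1 mi wj pi pj.
have mm : measurable (cyl 0 [:: i] `&` shift_pow k%:Z @^-1` cyl 0 [:: j]).
  by apply: measurableI => //; apply: measurable_shift; exact: measurable_cyl.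
rewrite -(measure_sftI support_full mm) => /measure_neq0_nonempty[x [[xi xj] xA]].
exists k => //; exists (word (0 + 1) k x).
move: xi xj; rewrite /= cyl_shift !cyl1 /= add0r => xi xj.
rewrite size_word -xi -xj; split => //.
  by apply: path_word => l _; exact: sft_allowed.
by case: k Jk {mm xj} => // k _; rewrite word_rcons last_rcons; congr x; lia.
Qed.

(* If all return times to [i] were multiples of [d], then visiting [i]
   infinitely often along multiples of [d] would be a tail event of positive
   measure whose translate by one is disjoint from it. *)
Lemma support_aperiodic (i : I) (d : nat) : pr [:: i] != 0 ->
  (forall k : nat, (0 < k)%N -> reach (allowed A') k i i -> (d %| k)%N) -> d = 1%N.
Proof.
move=> pi hd.
have d0 : (0 < d)%N.
  have [k k0 /(hd k k0)] := support_reach 0 pi pi.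
  by case: (d) => //; rewrite dvd0n => /eqP k0'; rewrite k0' in k0.
pose E m : set X := cyl (d * m)%N%:Z [:: i].
have mE m : measurable (E m) by exact: measurable_cyl.
pose B := lim_sup_set E.
have mB : measurable B.
  by apply: bigcap_measurable => // m _; apply: bigcup_measurable.
have tB N x y : agree_off N x y -> B x -> B y.
  move=> xy Bx k _; have [m /= km] := Bx (k + N).+1 Logic.I.
  rewrite /E cyl1 /= => xm; exists m => /=; first by lia.
  by rewrite /E cyl1 /= -xy //; nia.
(* A null [B] would force the unions of the [E m] over [m >= j] to have measure tending to 0, but
   each contains an event of probability [pr [:: i]]. *)
have B1 : mu B = 1%E.
  have [B0|//] := mu_tail mB tB.
  have fin : (mu (\bigcup_(m >= 0) E m) < +oo)%E.
    apply: le_lt_trans (probability_le1 mu _) _; last exact: ltry.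
    by apply: bigcup_measurable => m _; exact: mE.
  have cvB : mu (\bigcup_(m >= j) E m) @[j --> \oo] --> 0%E.
    by rewrite -B0; exact: lim_sup_set_cvg.
  have : ((pr [:: i])%:E <= 0)%E.
    rewrite -(cvg_lim _ cvB) //; apply: lime_ge; first by apply/cvg_ex; exists 0%E.
    apply: nearW => j; rewrite -(prE mu_shift (d * j)%N%:Z) fineK ?fin_num_measure //; last first.
      exact: mE.
    apply: le_measure; rewrite ?inE; [exact: mE| |by move=> x Ex; exists j => /=].
    by apply: bigcup_measurable => m _; exact: mE.
  by rewrite lee_fin => le0; move: pi; rewrite (@le_anti _ _ (pr [:: i]) 0) ?eqxx // le0 pr_ge0.
have mA := measurable_sft A'; have mB' := measurable_shift 1 mB.
have : mu (B `&` (shift_pow 1 @^-1` B) `&` sft A') != 0%E.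
  have BA : mu (B `&` shift_pow 1 @^-1` B) = 1%E.
    have mBB := measurableI _ _ mB mB'.
    have : mu (~` (B `&` shift_pow 1 @^-1` B)) = 0%E.
      have C0 (Z : set X) : measurable Z -> mu Z = 1%E -> mu (~` Z) = 0%E.
        by move=> mZ Z1; rewrite probability_setC // Z1 subee.
      rewrite setCI; apply: null_set_setU; [exact: measurableC|exact: measurableC| |].
        exact: C0.
      by apply: C0 => //; rewrite (shift_invariant_int mu_shift).
    by rewrite probability_setC // => /eqP; rewrite sube_eq ?fin_num_measure // add0e => /eqP.
  by rewrite (measure_sftI support_full) ?BA ?oner_neq0 //; exact: measurableI.
move=> /measure_neq0_nonempty[x [[Bx Bsx] xA]].
(* A point of [B] and of its translate visits [i] at times [d * m] and [d * m' + 1] with [m < m']: a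
   return time that is 1 modulo [d]. *)
have [m _] := Bx 0%N Logic.I; rewrite /E cyl1 /= => xm.
have [m' /= mm'] := Bsx m.+1 Logic.I; rewrite /E cyl1 /= /shift_pow => xm'.
have [k k0 kE] : exists2 k : nat, (0 < k)%N & k = (d * (m' - m) + 1)%N.
  by exists (d * (m' - m) + 1)%N => //; rewrite addn1.
have : (d %| k)%N.
  apply: hd k0 _; exists (word ((d * m)%N%:Z + 1) k x); rewrite size_word -{1}xm; split => //.
    by apply: path_word => l _; exact: sft_allowed.
  rewrite kE addn1 word_rcons last_rcons -[RHS]xm'; congr (x _); nia.
by rewrite kE dvdn_addr ?dvdn_mulr // dvdn1 => /eqP.
Qed.

Lemma support_irreducible_aperiodic : irreducible_aperiodic_sft A'.
Proof.
apply/irreducible_aperiodic_sftP; split=> [i j|i d]; rewrite !mem_symbols.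
  by move=> pi pj; exact: support_reach.
exact: support_aperiodic.
Qed.

End PartOne.

(** * The potential, saturation of the support and transition matrix *)

Section Potential.
Variables (R : realType) (n : nat) (A : 'M[nat]_n.+1) (mu : probability (fullshift n) R).
Local Notation X := (fullshift n).
Local Notation I := 'I_n.+1.
Hypothesis A01 : zero_one A.
Hypothesis mu_sft : mu (sft A) = 1%E.
Hypothesis mu_shift : shift_invariant mu.
Hypothesis mu_tail : tail_trivial mu.
Hypothesis mu_inv : rel_invariant (sft A) (sym_rel A) mu.
Implicit Types (x y : X) (k : int) (L N : nat) (w u v : seq I).

Local Notation pr := (pr mu).
Local Notation A' := (support_mx mu).

Let prcat := pr_cat mu_sft mu_shift mu_tail mu_inv.
Let pr_path := pr_path_neq0 mu_sft mu_shift mu_tail mu_inv.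

Lemma pr_gt0 w : (0 < pr w) = (pr w != 0).
Proof. by rewrite lt_def pr_ge0 andbT. Qed.

Lemma allowed_support_step i j : allowed A' i j -> step A i j.
Proof.
move=> ij; have A'ij := allowed_step (support_zero_one mu) ij.
have := support_le mu_sft mu_shift i j; rewrite (eqP A'ij) /step.
by case: (A01 i j) => ->.
Qed.

Lemma pr_perm a u v : perm_eq u v -> last a u = last a v ->
  path (allowed A') a u -> path (allowed A') a v -> pr (a :: u) = pr (a :: v).
Proof.
move=> puv luv pu pv; have suv := perm_size puv.
have puv' : perm_eq (a :: u) (a :: v) by rewrite perm_cons.
have [s [t [N [fst out hs]]]] := perm_eq_reindex 0 puv'.
have mA := measurable_sft A; rewrite /pr.
have mc w := measurable_cyl 0 w.
have stepP w : path (allowed A') a w -> path (step A) a w.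
  by apply: sub_path => i j; exact: allowed_support_step.
have outE x j : ~~ (0 <= j < 0 + (size (a :: u))%:Z) -> reindex s x j = x j.
  by move=> jn; rewrite /reindex out.
have out' x j : ~~ (0 <= j < 0 + (size (a :: v))%:Z) -> reindex s x j = x j.
  by move=> jn; apply: outE; move: jn; rewrite /= suv.
rewrite -(measure_sftI mu_sft (mc (a :: u))) -(measure_sftI mu_sft (mc (a :: v))).
congr fine; apply: (perm_invariant mu_inv fst); try exact: measurableI.
- by move=> x [].
- by move=> x [].
move=> x; split=> -[cx xA].
  have vx := (hs x).1 cx; split => //.
  rewrite -(eq_overwrite vx (out' x)); exact: sft_overwrite xA cx (stepP _ pv) suv luv.
have ux := (hs x).2 cx; split => //.
rewrite -(eq_overwrite ux (fun j jn => esym (outE x j jn))).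
exact: sft_overwrite xA cx (stepP _ pu) (esym suv) (esym luv).
Qed.

Let a0_ex : exists a, pr [:: a] != 0.
Proof.
have [|a h] := @measure_neq0_coord _ _ mu setT 0 measurableT.
  by rewrite [X in X != _]probability_setT oner_neq0.
by exists a; rewrite (pr_neq0 mu_shift 0) cyl1; rewrite setTI in h.
Qed.

(** Indexed by natural numbers and integer-valued, the format of [additive_extension]. *)
Let cnt w (i : nat) : int := (count (fun a : I => val a == i) w)%:Z.

Lemma sum_count (f : nat -> R) w :
  \sum_(i < n.+1) f i * (cnt w i)%:~R = \sum_(a <- w) f (val a).
Proof.
elim: w => [|a w IH]; first by rewrite big_nil big1 // => i _; rewrite mulr0.
rewrite big_cons -IH.
under eq_bigr => i _.
  rewrite /cnt /= PoszD rmorphD /= mulrDr -/(cnt w i).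
over.
rewrite big_split /=; congr (_ + _).
rewrite (bigD1 a) //= eqxx mulr1 big1 ?addr0 // => i ia.
by rewrite (_ : (val a == i) = false) ?mulr0 //; apply/negbTE; apply: contra ia => /eqP E; apply/eqP/val_inj.
Qed.

Lemma count_perm_eq u v : (forall i, (i < n.+1)%N -> cnt u i = cnt v i) -> perm_eq u v.
Proof.
move=> h; apply/allP => a _ /=; apply/eqP.
have := h (val a) (ltn_ord a); rewrite /cnt => -[] E.
have e w : count_mem a w = count (fun b : I => val b == val a) w by apply: eq_count.
by rewrite !e E.
Qed.

(* The logarithm of the probability of a loop at [a] depends additively on the
   letter counts of the loop, hence extends to a linear function of them. *)
Lemma loop_potential a : pr [:: a] != 0 -> exists phi : I -> R, forall w,
  path (allowed A') a w -> last a w = a ->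
  weight (boltzmann phi) w = pr (a :: w) / pr [:: a].
Proof.
move=> pa.
pose loop w := path (allowed A') a w /\ last a w = a.
pose tau w := ln (pr (a :: w) / pr [:: a]).
have loop_cat u v : loop u -> loop v -> loop (u ++ v).
  by move=> [pu lu] [pv lv]; split; rewrite ?cat_path ?last_cat lu ?pu.
have q0 w : loop w -> 0 < pr (a :: w) / pr [:: a].
  by move=> [pw _]; rewrite divr_gt0 // pr_gt0; exact: pr_path.
have tau_cat u v : loop u -> loop v -> tau (u ++ v) = tau u + tau v.
  move=> lu lv; rewrite /tau -lnM ?posrE ?q0 //; congr ln.
  have := prcat a u v; case: lu => _ -> E.
  by apply: (mulIf pa); rewrite mulrAC E; field; rewrite pa.
have cnt_cat u v i : cnt (u ++ v) i = cnt u i + cnt v i by rewrite /cnt count_cat PoszD.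
(* Loops only form a monoid under concatenation; formal differences of two loops make it a group.
   Single-valuedness is [pr_perm]: equal counts mean permuted words. *)
pose H (c : nat -> int) (t : R) := exists u v, [/\ loop u, loop v,
  c = (fun i => cnt u i - cnt v i) & t = tau u - tau v].
have [|||phi hphi] := @additive_extension R n.+1 H.
- exists [::], [::]; split; [by []|by []| |by rewrite subrr].
  by apply/funext => i; rewrite subrr.
- move=> c t c' t' [u [v [lu lv -> ->]]] [u' [v' [lu' lv' -> ->]]].
  exists (u ++ v'), (v ++ u'); split; [exact: loop_cat|exact: loop_cat| |].
    by apply/funext => i; rewrite !cnt_cat; lia.
  by rewrite !tau_cat //; ring.
- move=> c t [u [v [[pu lu] [pv lv] -> ->]]] c0.
  have puv : perm_eq u v.
    by apply: count_perm_eq => i i_n; apply/eqP; rewrite -subr_eq0 c0.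
  by rewrite /tau (pr_perm puv) ?subrr // lu lv.
exists (fun i => phi (val i)) => w pw lw.
have := hphi (fun i => cnt w i - cnt [::] i) (tau w - tau [::]) (ex_intro _ w (ex_intro _ [::]
  (And4 (conj pw lw) (conj isT erefl) erefl erefl))).
under eq_bigr do rewrite subr0.
rewrite sum_count {2}/tau divff // ln1 subr0 => E.
rewrite /weight /boltzmann -expR_sum E lnK // posrE; exact: q0.
Qed.

(** The potential is only known on loops at [a0]. Fixed paths [al] from [a0] to [a] and [be] from
    [b] back to [a0] close up both words; the Markov property factors the probabilities, and the
    contributions of [al] and [be] cancel. *)
Lemma swap_potential : exists phi : I -> R, gibbs_swap A' (boltzmann phi) mu setT.
Proof.
have [a0 pa0] := a0_ex; have [phi hphi] := loop_potential pa0.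
exists phi => k a u v; rewrite (mem_symbols mu_shift) => pa pu pv suv luv.
rewrite !setTI !(prE mu_shift); pose b := last a u.
have pb : pr [:: b] != 0.
  rewrite /b; case/lastP: (u) pu => [//|u' c]; rewrite rcons_path last_rcons => /andP[_].
  by rewrite allowedE // => /(pr_step_neq0_tail mu_shift).
have [? _ [al [_ pal lal]]] := support_reach mu_shift mu_tail 0 pa0 pa.
have [? _ [be [_ pbe lbe]]] := support_reach mu_shift mu_tail 0 pb pa0.
set wt := boltzmann phi.
have key w : path (allowed A') a w -> last a w = b ->
    weight wt al * weight wt w * weight wt be * (pr [:: a0] * pr [:: a] * pr [:: b]) =
    pr (a0 :: al) * pr (a :: w) * pr (b :: be).
  move=> pw lw; rewrite -!weight_cat -catA hphi; last 2 first.
  - by rewrite !cat_path pal lal pw lw.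
  - by rewrite !last_cat lal lw.
  have e1 := prcat a0 al (w ++ be); rewrite lal in e1.
  have e2 := prcat a w be; rewrite lw in e2.
  rewrite mulrA mulrA divfK // e1 -[RHS]mulrA -e2.
  by ring.
have ku := key u pu erefl; have kv := key v pv (esym luv).
have c0 : pr (a0 :: al) * pr (b :: be) != 0.
  by rewrite mulf_neq0 //; exact: pr_path.
apply: (mulIf c0).
have -> : pr (a :: u) * weight wt v * (pr (a0 :: al) * pr (b :: be)) =
  weight wt v * (pr (a0 :: al) * pr (a :: u) * pr (b :: be)) by ring.
have -> : pr (a :: v) * weight wt u * (pr (a0 :: al) * pr (b :: be)) =
  weight wt u * (pr (a0 :: al) * pr (a :: v) * pr (b :: be)) by ring.
by rewrite -ku -kv; ring.
Qed.

(** A central cylinder of a point [x] of [sft A'] has positive measure. Permuting coordinates keeps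
    this measure and moves the cylinder into that of [y k, y (k + 1)], so this transition of [y] has
    positive probability. *)
Lemma support_saturated : saturation (sym_rel A) (sft A') = sft A'.
Proof.
have le x : sft A' x -> sft A x.
  exact: (sft_le A01 (support_le mu_sft mu_shift)).
apply/seteqP; split => [y [x xA' xy]|x xA']; last first.
  by exists x => //; apply: sym_rel_refl; exact: le.
have [/= xA yA [s [[t st ts] fs ys]]] := xy.
have {}ys : y = reindex s x by apply/funext; exact: ys.
have /finite_seqP[K KE] := fs.
pose N := (\sum_(i <- K) `|i|)%N.
have out i : (N < `|i|)%N -> s i = i.
  move=> Ni; apply: contrapT => si; have : [set` K] i by rewrite -KE.
  by move=> /= iK; move: Ni; rewrite /N (big_rem i) //= ltnNge leq_addr.
have fp : finite_perm s t N by [].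
have tout := fperm_out (finite_perm_sym fp).
(* The window contains [k] and [k + 1], and exceeds the support of [s] by enough that a transition
   not inside it only involves coordinates fixed by [t]. *)
move=> k; pose N' := (N + `|k|%N + 2)%N.
pose D1 : set X := cyl (- N'%:Z) (central_word N' x) `&` sft A.
pose D2 : set X := reindex t @^-1` D1.
have mD1 : measurable D1.
  by apply: measurableI; [exact: measurable_cyl|exact: measurable_sft].
have mD2 : measurable D2.
  by rewrite -[X in measurable X]setTI; exact: measurable_reindex.
have near z i : D2 z -> (`|i| <= N')%N -> z i = y i.
  move=> [tz _] iN.
  have tzE j : (`|j| <= N')%N -> z (t j) = x j.
    move=> jN; rewrite -[LHS]/(reindex t z j) (cylE tz) ?size_word; last by lia.
    by rewrite nth_word; [congr x; lia|lia].
  have -> : i = t (s i) by rewrite st.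
  rewrite ys /reindex tzE ?st //.
  have [h|h] := leqP `|i| N; last by rewrite out.
  have := fperm_out fp; have : (`|s i| <= N)%N; last by rewrite /N'; lia.
  rewrite leqNgt; apply/negP => h'.
  by have := tout _ h'; rewrite st => E; rewrite -E ltnNge h in h'.
have sD2 : D2 `<=` sft A.
  move=> z Dz i; have [iN|iN] := boolP ((`|i| <= N')%N && (`|(i + 1)%R| <= N')%N).
    by case/andP: iN => h1 h2; rewrite !(near z) //; exact: yA.
  have [_ tzA] := Dz; have := tzA i; rewrite /reindex !tout //; rewrite /N' in iN; lia.
have E : mu D1 = mu D2.
  apply: (perm_invariant mu_inv fp) => //; first by move=> x' [].
  move=> z; rewrite /D2 /preimage /mkset (_ : reindex t (reindex s z) = z) //.
  by apply/funext => i; rewrite /reindex ts.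
have D10 : mu D1 != 0%E.
  rewrite /D1 measure_sftI //; last exact: measurable_cyl.
  rewrite -(pr_neq0 mu_shift) /central_word wordS; apply: pr_path.
    by rewrite -(mem_symbols mu_shift); exact: sft_symbols.
  by apply: path_word => i _; exact: sft_allowed.
have : pr [:: y k; y (k + 1)] != 0.
  rewrite (pr_neq0 mu_shift k); apply: contra D10 => /eqP y0.
  rewrite E eq_le measure_ge0 andbT -y0; apply: le_measure; rewrite ?inE //.
    exact: measurable_cyl.
  by move=> z Dz; rewrite cyl_cons cyl1; split; apply: near => //; rewrite /N'; lia.
by rewrite mxE => ->.
Qed.

Lemma support_markov : markov_measure mu.
Proof.
have sumb i : \sum_j pr [:: i; j] = pr [:: i].
  have mi := measurable_cyl 0 [:: i].
  rewrite /pr [in RHS](measure_coord mu 1 mi) -sum_fine; last first.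
    by move=> j _; rewrite fin_num_measure //; apply: measurableI => //; exact: measurable_coord.
  by apply: eq_bigr => j _; rewrite (cyl_cons 0 i) add0r !cyl1.
(* Letters of probability 0 get an identity row, which keeps the matrix stochastic. *)
exists (\row_i pr [:: i]),
  (\matrix_(i, j) if pr [:: i] == 0 then (i == j)%:R else pr [:: i; j] / pr [:: i]).
split.
- split=> [i|]; first by rewrite mxE pr_ge0.
  have := measure_coord mu 0 (@measurableT _ X).
  rewrite [X in X = _]probability_setT => /(congr1 fine) /= ->.
  rewrite -sum_fine; last first.
    by move=> j _; rewrite fin_num_measure // setTI; exact: measurable_coord.
  by apply: eq_bigr => j _; rewrite mxE /pr cyl1 setTI.
- split=> [i j|i]; first by rewrite mxE; case: ifP => _; rewrite ?ler0n // divr_ge0 ?pr_ge0.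
  have [p0|p0] := eqVneq (pr [:: i]) 0.
    rewrite (bigD1 i) //= mxE p0 !eqxx big1 ?addr0 // => j ji.
    by rewrite mxE p0 eqxx eq_sym (negbTE ji).
  under eq_bigr do rewrite mxE (negbTE p0).
  by rewrite -mulr_suml sumb divff.
- apply/rowP => j; rewrite !mxE -[RHS](prE mu_shift 1).
  have mj := measurable_cyl 1 [:: j].
  rewrite [in RHS](measure_coord mu 0 mj) -sum_fine; last first.
    by move=> i _; rewrite fin_num_measure //; apply: measurableI => //; exact: measurable_coord.
  apply: eq_bigr => i _; rewrite !mxE.
  have -> : fine (mu (cyl 1 [:: j] `&` [set x | x 0 = i])) = pr [:: i; j].
    by rewrite /pr (cyl_cons 0 i) add0r setIC.
  have [p0|p0] := eqVneq (pr [:: i]) 0; last by rewrite mulrC divfK.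
  rewrite p0 mul0r; apply/esym/eqP/negPn/negP => /pr_neq0_head.
  by rewrite p0 eqxx.
move=> k m a; set P := \matrix_(_, _) _.
have -> : [set x | forall i : nat, (i <= m)%N -> x (k + i%:Z) = a i] = cyl k (mkseq a m.+1).
  apply/seteqP; split => x h.
    apply: cylP => i; rewrite size_mkseq ltnS => im.
    by rewrite nth_mkseq // h.
  move=> i im; rewrite (cylE h) ?size_mkseq; last by lia.
  by rewrite nth_mkseq; [congr a; lia|lia].
rewrite -[LHS]fineK ?fin_num_measure //; last exact: measurable_cyl.
congr EFin; rewrite (prE mu_shift); elim: m => [|m IH].
  by rewrite big_ord0 mulr1 mxE.
rewrite big_ord_recr /= mulrA -IH mxE mkseqS.
have mE : mkseq a m.+1 = a 0%N :: [seq a i | i <- iota 1 m] by [].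
have lE : last (a 0%N) [seq a i | i <- iota 1 m] = a m.
  by rewrite -(last_cons (a 0%N)) -mE mkseqS last_rcons.
have := prcat (a 0%N) [seq a i | i <- iota 1 m] [:: a m.+1].
rewrite lE -cat_cons -mE cats1.
(* If the letter [a m] has probability 0, both words contain it and both sides vanish. *)
have [p0|p0] := eqVneq (pr [:: a m]) 0 => E; last first.
  by apply: (mulIf p0); rewrite E -mulrA divfK.
have z : pr (mkseq a m.+1) = 0.
  apply/eqP; rewrite eq_le pr_ge0 andbT -p0 -(prE mu_shift m%:Z [:: a m]).
  apply: fine_le_measure; try exact: measurable_cyl.
  by rewrite mkseqS cyl_rcons size_mkseq cyl1 add0r => x [].
rewrite z mul0r; apply/eqP; rewrite eq_le pr_ge0 andbT -z.
apply: fine_le_measure; try exact: measurable_cyl.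
by rewrite cyl_rcons => x [].
Qed.

End Potential.

Theorem theorem6p2 (R : realType) (n : nat) (A : 'M[nat]_n.+1)
    (A01 : zero_one A) (Airr : irreducible_mx A) (Aaper : aperiodic_mx A) :
  (forall mu : probability (fullshift n) R,
     mu (sft A) = 1%E -> nonatomic mu -> shift_invariant mu ->
     rel_invariant (sft A) (sym_rel A) mu -> rel_ergodic (sft A) (sym_rel A) mu ->
     exists (A' : 'M[nat]_n.+1) (phi : fullshift n -> R),
       [/\ zero_one A' /\ (forall i j, (A' i j <= A i j)%N),
           irreducible_aperiodic_sft A',
           saturation (sym_rel A) (sft A') = sft A',
           depends_only_on (sft A') 0 phi &
           [/\ gibbs_measure A' phi mu, markov_measure mu &
               forall nu : probability (fullshift n) R,
                 gibbs_measure A' phi nu ->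
                 forall B, measurable B -> nu B = mu B]])
  /\
  (forall (A' : 'M[nat]_n.+1) (phi : fullshift n -> R) (k : int)
          (mu : probability (fullshift n) R),
     zero_one A' -> (forall i j, (A' i j <= A i j)%N) ->
     irreducible_aperiodic_sft A' ->
     saturation (sym_rel A) (sft A') = sft A' ->
     depends_only_on (sft A') k phi ->
     gibbs_measure A' phi mu ->
     rel_invariant (sft A) (sym_rel A) mu /\ rel_ergodic (sft A) (sym_rel A) mu).
Proof.
split=> [mu mu_sft _ mu_shift mu_inv mu_erg|A' Phi k0 mu A'01 A'A A'ia A'sat Phi1 gibbs].
  have mu_tail := rel_ergodic_tail_trivial mu_sft mu_erg.
  have [phi swap] := swap_potential A01 mu_sft mu_shift mu_tail mu_inv.
  have A'01 := support_zero_one mu.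
  have mu_sft' := support_full mu_shift.
  have A'ia := support_irreducible_aperiodic mu_shift mu_tail.
  exists (support_mx mu), (fun x => phi (x 0)); split.
  - by split=> // i j; exact: support_le.
  - exact: A'ia.
  - exact: (support_saturated A01 mu_sft mu_shift mu_tail mu_inv).
  - by move=> x y _ _ ->.
  - split; [exact: (gibbs_measure_of_swap mu_sft' swap)|exact: (support_markov mu_sft mu_shift mu_tail mu_inv)|].
    move=> nu nu_gibbs B mB; have [nu_sft _ _] := nu_gibbs.
    apply: (gibbs_unique (boltzmann_gt0 phi) A'ia) => //.
    by apply: (gibbs_measure_swap (k0 := 0) _ nu_gibbs).
split; first exact: (gibbs_sym_invariant A01 A'A A'sat Phi1 gibbs).
exact: (gibbs_sym_ergodic A'01 A01 A'A A'ia A'sat Phi1 gibbs).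
Qed.
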